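(* Consider the setting, the assumptions on $f$, and the algorithm (ALG) given in the context. Assume that: (1) $F(x)\to+\infty$ as $\|x\|\to+\infty$; (2) the continuous functions $\mathsf h,\mathsf r,\mathsf p,\mathsf q:(0,+\infty)\to\mathbb{R}_+$ satisfy: $\mathsf h$ is $C^1$ with $\dot{\mathsf h}\le0$ on $(0,+\infty)$ and $h_\infty:=\lim_{t\to\infty}\mathsf h(t)>0$; $\mathsf r,\mathsf q$ are non-increasing with $r_\infty:=\lim_{t\to\infty}\mathsf r(t)>0$ and $q_\infty:=\lim_{t\to\infty}\mathsf q(t)>0$; $\mathsf p(t)\to p_\infty$ as $t\to\infty$; $\mathsf r(t)\ge\mathsf q(t)/4$ for all $t>0$ and $r_\infty>q_\infty/4$; (3) $\gamma_{n+1}/\gamma_n\to1$ and $\sum_n\gamma_n=+\infty$; (4) either of the following conditions holds: (4.i) there exists $q\ge2$ such that for every compact set $K\subset\mathbb{R}^d$, $\sup_{x\in K}\mathbb{E}_\xi\|\nabla f(x,\xi)\|^{2q}<\infty$, and $\sum_n\gamma_n^{1+q/2}<\infty$; (4.ii) for every compact set $K\subset\mathbb{R}^d$ there exists a real $\sigma_K\ne0$ such that for every $x,u\in\mathbb{R}^d$, $$\mathbb{E}_\xi\big[\exp\langle u,\nabla f(x,\xi)-\nabla F(x)\rangle\big]\mathbf 1_{x\in K}\le e^{\sigma_K^2\|u\|^2/2},\qquad \mathbb{E}_\xi\big[\exp\langle u,\nabla f(x,\xi)^{\odot2}-S(x)\rangle\big]\mathbf 1_{x\in K}\le e^{\sigma_K^2\|u\|^2/2},$$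 and moreover, for every $\alpha>0$, $\sum_n\exp(-\alpha/\gamma_n)<\infty$; (5) the set $F(\{x:\nabla F(x)=0\})\subset\mathbb{R}$ has empty interior. Assume that the random sequence $(z_n=(v_n,m_n,x_n):n\in\mathbb{N})$ given by (ALG) is bounded with probability one. Then, with probability one, $(z_n)$ converges towards the set $$\Upsilon:=\{(p_\infty S(x_\star)/q_\infty,\,0,\,x_\star)\,:\,\nabla F(x_\star)=0\}.$$ If, in addition, the set of critical points of $F$ is finite or countable, then with probability one the sequence $(z_n)$ converges to a single point of $\Upsilon$.
   Context: $d\ge1$; $\mathbb{R}_+=[0,\infty)$; $\mathcal Z_+:=\mathbb{R}_+^d\times\mathbb{R}^d\times\mathbb{R}^d$; vector operations (quotients, square roots, powers $x^{\odot\alpha}$, addition of a scalar) are componentwise. Convergence towards a set means that the distance to the set tends to $0$. Setting: $(\Xi,\mathcal T,\mu)$ is a probability space, $f:\mathbb{R}^d\times\Xi\to\mathbb{R}$ is $\mathcal B(\mathbb{R}^d)\otimes\mathcal T$-measurable, and $\mathbb{E}_\xi\varphi(\xi):=\int\varphi\,d\mu$. $\nabla f(x,s)$ denotes the gradient with respect to $x$. Assumptions on $f$: for every $x$, $f(x,\cdot)$ is $\mu$-integrable; for every $s\in\Xi$, $f(\cdot,s)$ is differentiable; for every $x$, $\nabla f(x,\cdot)^{\odot2}$ is $\mu$-integrable; and there is a measurable $\kappa:\mathbb{R}^d\times\Xi\to\mathbb{R}_+$ such that for every $x\in\mathbb{R}^d$, $\kappa(x,\cdot)$ is $\mu$-integrable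 and there exists $\varepsilon_x>0$ such that for every $s\in\Xi$ and all $u,v$ in the open ball $B(x,\varepsilon_x)$, $$\max\big(\|\nabla f(u,s)-\nabla f(v,s)\|,\ \|\nabla f(u,s)^{\odot2}-\nabla f(v,s)^{\odot2}\|\big)\le\kappa(x,s)\|u-v\|.$$ Define $F(x)=\mathbb{E}_\xi[f(x,\xi)]$ and $S(x)=\mathbb{E}_\xi[\nabla f(x,\xi)^{\odot2}]$. Then $F$ is differentiable with $\nabla F(x)=\mathbb{E}_\xi[\nabla f(x,\xi)]$, and $\nabla F$ and $S$ are locally Lipschitz. $(\gamma_n)_{n\ge1}$ is a sequence of positive reals, $\tau_n=\sum_{k=1}^n\gamma_k$, and $(\xi_n)_{n\ge1}$ are i.i.d. $\Xi$-valued random variables with law $\mu$ on a probability space $(\Omega,\mathcal F,\mathbb{P})$. Let $h_0,r_0,p_0,q_0\in(0,\infty)$ and, for $n\ge1$, $h_n=\mathsf h(\tau_n)$, $r_n=\mathsf r(\tau_n)$, $p_n=\mathsf p(\tau_n)$, $q_n=\mathsf q(\tau_n)$. It is assumed throughout that $1-\gamma_{n+1}q_n\ge0$ for all $n\in\mathbb{N}$. Let $\varepsilon>0$. Algorithm (ALG): given $z_0=(v_0,m_0,x_0)\in\mathcal Z_+$, for $n\ge0$, $$v_{n+1}=(1-\gamma_{n+1}q_n)v_n+\gamma_{n+1}p_n\nabla f(x_n,\xi_{n+1})^{\odot2},$$ $$m_{n+1}=(1-\gamma_{n+1}r_n)m_n+\gamma_{n+1}h_n\nabla f(x_n,\xi_{n+1}),\qquad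 x_{n+1}=x_n-\gamma_{n+1}\frac{m_{n+1}}{\sqrt{v_{n+1}+\varepsilon}}.$$ *)

(* Defs.v *)
From HB Require Import structures.
From mathcomp Require Import all_boot all_order all_algebra.
From mathcomp Require Import all_classical all_reals all_analysis.

Set Implicit Arguments.
Unset Strict Implicit.
Unset Printing Implicit Defensive.

Import Order.TTheory GRing.Theory Num.Theory.
Import numFieldNormedType.Exports.

Local Open Scope classical_set_scope.
Local Open Scope ring_scope.

(* A triple (v, m, x) is encoded as ((v, m), x). *)
Notation state R d := ('rV[R]_d * 'rV[R]_d * 'rV[R]_d)%type (only parsing).

Section vectors.
Context {R : realType} {d : nat}.
Implicit Types u v : 'rV[R]_d.

Definition dotv u v : R := \sum_(i < d) u 0 i * v 0 i.

(* Euclidean norm; the library norm `|u| on 'rV[R]_d is the sup norm. *)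
Definition enorm u : R := Num.sqrt (\sum_(i < d) u 0 i ^+ 2).

Definition eball (x : 'rV[R]_d) (e : R) : set 'rV[R]_d :=
  [set u | enorm (u - x) < e].

Definition sqv u : 'rV[R]_d := map_mx (fun t => t ^+ 2) u.

Definition grad (g : 'rV[R]_d -> R) (x : 'rV[R]_d) : 'rV[R]_d :=
  \row_(i < d) 'D_(delta_mx 0 i) g x.

Definition state_nonneg : set (state R d) :=
  [set z : state R d | forall i : 'I_d, 0 <= z.1.1 0 i].

Definition snorm (z : state R d) : R :=
  Num.sqrt (enorm z.1.1 ^+ 2 + enorm z.1.2 ^+ 2 + enorm z.2 ^+ 2).

(* Taken in \bar R, so that the distance to the empty set is +oo, not 0. *)
Definition sdist (z : state R d) (A : set (state R d)) : \bar R :=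
  ereal_inf [set (snorm (z - a))%:E | a in A].

End vectors.

(* 'rV[R]_d with its Borel sigma-algebra. *)
Definition borel_rV (R : realType) (d : nat) :=
  g_sigma_algebraType (@open 'rV[R]_d).

Section expectations.
Context {R : realType} {d : nat} {dX : measure_display}
  {Xi : measurableType dX} (mu : probability Xi R).
Implicit Type f : 'rV[R]_d -> Xi -> R.

Definition objF f (x : 'rV[R]_d) : R := fine 'E_mu[f x].

Definition gradf f (x : 'rV[R]_d) (s : Xi) : 'rV[R]_d := grad (f^~ s) x.

Definition objS f (x : 'rV[R]_d) : 'rV[R]_d :=
  \row_(i < d) fine 'E_mu[fun s => sqv (gradf f x s) 0 i].

Definition crit f : set 'rV[R]_d := [set x | grad (objF f) x = 0].

Definition limit_set f (p_oo q_oo : R) : set (state R d) :=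
  [set ((p_oo / q_oo) *: objS f x, 0 : 'rV[R]_d, x) | x in crit f].

End expectations.

Section random_sequence.
Context {R : realType} {dO dX : measure_display}
  {Om : measurableType dO} {Xi : measurableType dX}
  (P : probability Om R) (mu : probability Xi R).

Definition mutually_independent (I : set nat) (xi : nat -> {RV P >-> Xi}) :=
  forall (J : seq nat) (A : nat -> set Xi),
    uniq J -> [set` J] `<=` I -> (forall n, measurable (A n)) ->
    P (\bigcap_(n in [set` J]) (xi n @^-1` A n)) =
    (\prod_(n <- J) P (xi n @^-1` A n))%E.

Definition iid_with_law (I : set nat) (xi : nat -> {RV P >-> Xi}) :=
  (forall n A, I n -> measurable A -> distribution P (xi n) A = mu A) /\
  mutually_independent I xi.

End random_sequence.

Section algorithm.
Context {R : realType} {d : nat} {Xi : Type}.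

Definition tau (gamma : nat -> R) (n : nat) : R :=
  \sum_(1 <= k < n.+1) gamma k.

(* The coefficient sequence c_n: a free initial value, then c (tau_n). *)
Definition coef (gamma : nat -> R) (c0 : R) (c : R -> R) (n : nat) : R :=
  if n is 0 then c0 else c (tau gamma n).

(* [g x s] stands for the stochastic gradient, and [s n] for the n-th sample;
   [s 0] is never used. *)
Fixpoint alg (g : 'rV[R]_d -> Xi -> 'rV[R]_d) (eps : R)
    (gamma h r p q : nat -> R) (z0 : state R d) (s : nat -> Xi) (n : nat)
    : state R d :=
  if n is k.+1 then
    let: (v, m, x) := alg g eps gamma h r p q z0 s k in
    let v' := (1 - gamma k.+1 * q k) *: v
              + (gamma k.+1 * p k) *: sqv (g x (s k.+1)) in
    let m' := (1 - gamma k.+1 * r k) *: m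
              + (gamma k.+1 * h k) *: g x (s k.+1) in
    let x' := x - gamma k.+1 *:
                map2_mx (fun a b => a / Num.sqrt (b + eps)) m' v' in
    (v', m', x')
  else z0.

End algorithm.

(* Main.v *)
Require Import Defs.
From HB Require Import structures.
From mathcomp Require Import all_boot all_order all_algebra.
From mathcomp Require Import all_classical all_reals all_analysis.
From mathcomp Require Import measurable_realfun ring lra.

Set Implicit Arguments.
Unset Strict Implicit.
Unset Printing Implicit Defensive.

Import Order.TTheory GRing.Theory Num.Theory.
Import numFieldNormedType.Exports.

Local Open Scope classical_set_scope.
Local Open Scope ring_scope.

(** Let [G] be the gradient of [F] and [a_i = 1 / sqrt (v_i + eps)].  The function
    [W = h_oo F + (1/2) sum_i a_i m_i^2 - delta <G, m>] with a small [delta > 0]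
    decreases, over a time window of length [T], by at least
    [c T (|m|^2 + |G|^2)] up to an error [O(T^2)]: the derivative of [a_i]
    contributes at most [(q_oo / 4) a_i m_i^2], which [r_oo > q_oo / 4] absorbs,
    and the cross term [-delta <G, m>] produces the missing [-|G|^2].  Letting
    [T -> 0] and using the Sard-type assumption to find levels that [W] cannot
    cross slowly, one gets [m -> 0] and [G(x_n) -> 0]; then [v_n] follows
    [(p_oo / q_oo) S(x_n)].  No limiting differential equation is needed.

    The noise accumulated over windows of bounded length vanishes almost surely
    by Borel-Cantelli applied to blocks of unit length.  The block probabilities
    are bounded by a maximal inequality for the supermartingales
    [exp(- D t) |M|^q] in case (4.i) and [exp(l M - l^2 sigma^2 [t] / 2)] in
    case (4.ii). *)

(** * Windowed error calculus and the Lyapunov function *)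

(** A single noise term has the order of the step size itself; only sums over many steps are small,
    so no useful inequality holds step by step. A sum that is merely o(1) on windows of unit length
    is eventually below [T ^+ 2] for each fixed [T]. Letting the first admissible window depend on
    [T] thus turns noise, convergence of the coefficients and discretisation into one kind of
    second-order error. The weights of [W] come from a cancellation: with [h_oo] in front of [F],
    the products [G_i m_i a_i] produced by [F] and by [a_i m_i^2 / 2] cancel. What is left
    dissipates in [m] only, hence the cross term. As [G] is only locally Lipschitz, its variation is
    bounded rather than differentiated, and the resulting cost in [|m|^2] limits [delta]. The bound
    on the trajectory is random, whereas the tail assumptions concern fixed compact sets. The noise
    is therefore multiplied by the indicator that the current iterate lies in a box of integer size.
    It stays a martingale increment, all sizes are treated in one almost sure event, and the size is
    chosen afterwards for each trajectory. *)

Section Windows.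
Context {R : realType} (tm : nat -> R).
Hypothesis tm_nd : {homo tm : n k / (n <= k)%N >-> n <= k}.

(* [X n k = O(T ^ j)] as [T -> 0], on all windows [n, k] of duration at most [T]
   that start late enough; the threshold for [n] may depend on [T]. *)
Definition winO (j : nat) (X : nat -> nat -> R) :=
  exists2 C : R, 0 <= C & forall T : R, 0 < T -> T <= 1 ->
    \forall n \near \oo, forall k : nat, (n <= k)%N -> tm k - tm n <= T ->
      `|X n k| <= C * T ^+ j.

Lemma winO_le j X Y : winO j Y ->
  (forall n k, (n <= k)%N -> `|X n k| <= `|Y n k|) -> winO j X.
Proof.
move=> [C C0 HC] XY; exists C => // T T0 T1; near=> n => k nk tT.
by apply: (le_trans (XY _ _ nk)); move: k nk tT; near: n; exact: HC.
Unshelve. all: by end_near. Qed.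

Lemma winO_eq j X Y : winO j Y -> (forall n k, (n <= k)%N -> X n k = Y n k) ->
  winO j X.
Proof. by move=> HY XY; apply: (winO_le HY) => n k nk; rewrite XY. Qed.

Lemma winO_weak j X : winO j.+1 X -> winO j X.
Proof.
move=> [C C0 HC]; exists C => // T T0 T1; near=> n => k nk tT.
apply: (@le_trans _ _ (C * T ^+ j.+1)).
  by move: k nk tT; near: n; exact: HC.
by rewrite ler_wpM2l// exprS ler_piMl// exprn_ge0// ltW.
Unshelve. all: by end_near. Qed.

Lemma winO_bounded X (B : R) : (forall n k, (n <= k)%N -> `|X n k| <= B) ->
  winO 0 X.
Proof.
move=> XB; exists (Num.max 0 B); first by rewrite le_max lexx.
move=> T T0 T1; near=> n => k nk _.
by rewrite expr0 mulr1 le_max XB// orbT.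
Unshelve. all: by end_near. Qed.

Lemma winON j X : winO j X -> winO j (fun n k => - X n k).
Proof. by move=> HX; apply: (winO_le HX) => n k _; rewrite normrN. Qed.

Lemma winO_norm j X : winO j X -> winO j (fun n k => `|X n k|).
Proof. by move=> HX; apply: (winO_le HX) => n k _; rewrite normr_id. Qed.

Lemma winOD j X Y : winO j X -> winO j Y -> winO j (fun n k => X n k + Y n k).
Proof.
move=> [C C0 HC] [C' C'0 HC']; exists (C + C'); first exact: addr_ge0.
move=> T T0 T1; near=> n => k nk tT; rewrite mulrDl.
apply: (le_trans (ler_normD _ _)); apply: lerD; move: k nk tT; near: n.
  exact: HC.
exact: HC'.
Unshelve. all: by end_near. Qed.

Lemma winOB j X Y : winO j X -> winO j Y -> winO j (fun n k => X n k - Y n k).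
Proof. by move=> HX HY; apply: winOD => //; exact: winON. Qed.

Lemma winOM i j X Y : winO i X -> winO j Y ->
  winO (i + j) (fun n k => X n k * Y n k).
Proof.
move=> [C C0 HC] [C' C'0 HC']; exists (C * C'); first exact: mulr_ge0.
move=> T T0 T1; near=> n => k nk tT.
rewrite normrM exprD mulrACA; apply: ler_pM => //; move: k nk tT; near: n.
  exact: HC.
exact: HC'.
Unshelve. all: by end_near. Qed.

Lemma winO_cst (c : R) : winO 0 (fun _ _ => c).
Proof. exact: (@winO_bounded _ `|c|). Qed.

Lemma winO_Zl (a : R) j X : winO j X -> winO j (fun n k => a * X n k).
Proof. by move=> HX; exact: (winOM (winO_cst a) HX). Qed.

Lemma winO_sum (I : finType) j (X : I -> nat -> nat -> R) :
  (forall i, winO j (X i)) -> winO j (fun n k => \sum_i X i n k).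
Proof.
move=> HX; elim: (index_enum I) => [|a s IH].
  exists 0 => // T T0 T1; near=> n => k _ _.
  by rewrite big_nil normr0 mul0r.
apply: (winO_eq (winOD (HX a) IH)) => n k _; by rewrite big_cons.
Unshelve. all: by end_near. Qed.

(** Since the starting index may depend on [T], smallness without any rate on unit windows counts as
    an error of every order. Noise and converging coefficients enter the calculus this way. *)
Lemma winO_small j X : (forall e : R, 0 < e ->
    \forall n \near \oo, forall k, (n <= k)%N -> tm k - tm n <= 1 ->
      `|X n k| <= e) -> winO j X.
Proof.
move=> HX; exists 1 => // T T0 T1; rewrite mul1r.
have := HX (T ^+ j) (exprn_gt0 _ T0); apply: filterS => n Hn k nk tT.
by apply: Hn => //; apply: (le_trans tT).
Qed.

Lemma winO_lim (u : nat -> R) l j : u n @[n --> \oo] --> l ->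
  winO j (fun _ k => u k - l).
Proof.
move=> ul; apply: winO_small => e e0.
have /cvgrPdist_le /(_ e e0)[N _ HN] := ul.
exists N => // n /= Nn k nk _; rewrite distrC; apply: HN => /=.
exact: leq_trans nk.
Qed.

Lemma winO_time : winO 1 (fun n k => tm k - tm n).
Proof.
exists 1 => // T T0 T1; near=> n => k nk tT.
by rewrite mul1r expr1 ger0_norm// subr_ge0 tm_nd.
Unshelve. all: by end_near. Qed.

Lemma sum_time n k : (n <= k)%N ->
  \sum_(n <= i < k) (tm i.+1 - tm i) = tm k - tm n.
Proof. exact: telescope_sumr. Qed.

(** Discrete integration: the weights add up to the duration of the window, which gains one power of
    [T]. *)
Lemma winO_gsum j X : winO j X ->
  winO j.+1 (fun n k => \sum_(n <= i < k) (tm i.+1 - tm i) * X n i).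
Proof.
move=> [C C0 HC]; exists C => // T T0 T1; near=> n => k nk tT.
apply: (le_trans (ler_norm_sum _ _ _)).
apply: (@le_trans _ _ (\sum_(n <= i < k) (tm i.+1 - tm i) * (C * T ^+ j))).
  rewrite big_nat_cond [leRHS]big_nat_cond; apply: ler_sum => i.
  rewrite andbT => /andP[ni ik].
  have t0 : 0 <= tm i.+1 - tm i by rewrite subr_ge0 tm_nd.
  rewrite normrM (ger0_norm t0) ler_wpM2l//.
  have {}tT : tm i - tm n <= T.
    by apply: le_trans tT; rewrite lerD2r tm_nd// ltnW.
  by move: {ik t0} i ni tT; near: n; exact: HC.
rewrite -mulr_suml sum_time// exprS [leRHS]mulrCA ler_wpM2r//.
by rewrite mulr_ge0// exprn_ge0// ltW.
Unshelve. all: by end_near. Qed.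

(** Right-endpoint version, for the update of [x], which uses the already updated [m] and [v]. *)
Lemma winO_gsumS j X : winO j X ->
  winO j.+1 (fun n k => \sum_(n <= i < k) (tm i.+1 - tm i) * X n i.+1).
Proof.
move=> [C C0 HC]; exists C => // T T0 T1; near=> n => k nk tT.
apply: (le_trans (ler_norm_sum _ _ _)).
apply: (@le_trans _ _ (\sum_(n <= i < k) (tm i.+1 - tm i) * (C * T ^+ j))).
  rewrite big_nat_cond [leRHS]big_nat_cond; apply: ler_sum => i.
  rewrite andbT => /andP[ni ik].
  have t0 : 0 <= tm i.+1 - tm i by rewrite subr_ge0 tm_nd.
  rewrite normrM (ger0_norm t0) ler_wpM2l//.
  have {}tT : tm i.+1 - tm n <= T.
    by apply: le_trans tT; rewrite lerD2r tm_nd.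
  have {}ni : (n <= i.+1)%N by rewrite ltnW.
  by move: {ik t0} i.+1 ni tT; near: n; exact: HC.
rewrite -mulr_suml sum_time// exprS [leRHS]mulrCA ler_wpM2r//.
by rewrite mulr_ge0// exprn_ge0// ltW.
Unshelve. all: by end_near. Qed.

Hypothesis tm_oo : forall A : R, exists n, A <= tm n.
Hypothesis tm_step : tm n.+1 - tm n @[n --> \oo] --> (0 : R).

(** Take the first index at which time [T / 2] has elapsed: steps are eventually at most [T / 2], so
    it does not overshoot [T]. *)
Lemma window_end (T : R) : 0 < T -> \forall n \near \oo,
  exists k : nat, [/\ (n <= k)%N, T / 2 <= tm k - tm n & tm k - tm n <= T].
Proof.
move=> T0; have T2 : 0 < T / 2 by lra.
have /cvgrPdist_le /(_ _ T2)[N _ HN] := tm_step.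
exists N => // n /= Nn.
have ex : exists k, (n <= k)%N && (T / 2 <= tm k - tm n).
  have [k Hk] := tm_oo (T / 2 + tm n); exists k.
  have TH : T / 2 <= tm k - tm n by lra.
  rewrite TH andbT leqNgt; apply/negP => kn.
  by have := tm_nd (ltnW kn); lra.
case: (ex_minnP ex) => k /andP[nk Hk] kmin; exists k; split => //.
case: k nk Hk kmin => [|k] nk Hk kmin.
  by move: nk; rewrite leqn0 => /eqP n0; move: Hk; rewrite n0; lra.
have [nk'|nk'] := leqP n k; last first.
  have -> : n = k.+1 by apply/eqP; rewrite eqn_leq nk.
  by lra.
have : ~~ (T / 2 <= tm k - tm n).
  apply/negP => H; have := kmin k; rewrite nk' H => /(_ isT).
  by rewrite ltnn.
rewrite -ltNge => H.
have := HN k (leq_trans Nn nk'); rewrite sub0r normrN.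
have := ler_norm (tm k.+1 - tm k); lra.
Qed.

(** Because of [X], [W] need not be monotone; the levels given by the last hypothesis act as
    barriers. [D] is bounded below near such a level, so the linear drop beats the quadratic error
    and [W], once below, cannot climb back through it. Hence [W] converges, and then [D] cannot be
    large infinitely often, since each time would cost a fixed drop. *)
Lemma lyapunov_descent (W D : nat -> R) (X : nat -> nat -> R) (c B : R) :
  0 < c -> (forall n, `|W n| <= B) -> (forall n, 0 <= D n) -> winO 2 X ->
  (forall n k, (n <= k)%N -> W k <= W n - c * (tm k - tm n) * D n + X n k) ->
  (forall a b : R, a < b -> exists l e : R, [/\ 0 < e, a < l - e, l + e < b &
     forall n, `|W n - l| <= e -> e <= D n]) ->
  D n @[n --> \oo] --> (0 : R).
Proof.
move=> c0 WB D0 [C C0 XC] desc sep.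
(* [U] collects the eventual upper bounds, so its infimum [b] is the upper limit of [W]. *)
pose U : set R := [set y | \forall n \near \oo, W n <= y].
have U0 : U B by near=> n; apply: le_trans (WB n); exact: ler_norm.
have Ulb : lbound U (- B).
  move=> y [N _ HN]; have := HN N (leqnn N); apply: le_trans.
  by have := WB N; rewrite ler_norml => /andP[].
have Uinf : has_inf U by split; [exists B | exists (- B)].
pose b := inf U.
have Wup (e : R) : 0 < e -> \forall n \near \oo, W n <= b + e.
  move=> e0; have [y Uy yb] := inf_adherent e0 Uinf.
  by apply: filterS Uy => n /le_trans; apply; exact: ltW.
have small (e : R) : 0 < e -> exists T : R, [/\ 0 < T, T <= 1 & C * T <= e].
  move=> e0; exists (Num.min 1 (e / (C + 1))); split.
  - by rewrite lt_min ltr01 divr_gt0//; lra.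
  - by rewrite ge_min lexx.
  - apply: (@le_trans _ _ (C * (e / (C + 1)))).
      by rewrite ler_wpM2l// ge_min lexx orbT.
    by rewrite mulrCA ler_piMr ?(ltW e0)// ler_pdivrMr; lra.
(* With [C * T <= e] the error [C * T ^+ 2] is at most [e * T], as small a fraction of the linear
   drop as wanted. *)
have dec (e : R) : 0 < e -> exists T : R, [/\ 0 < T, T <= 1, C * T <= e &
    \forall n \near \oo, forall k, (n <= k)%N -> tm k - tm n <= T ->
     W k <= W n + e * T /\
     (T / 2 <= tm k - tm n -> W k <= W n - c * T / 2 * D n + e * T)].
  move=> e0; have [T [T0 T1 CT]] := small e e0; exists T; split => //.
  have := XC T T0 T1; apply: filterS => n Hn k nk tT.
  have X1 : X n k <= e * T.
    apply: le_trans (ler_norm _) _; apply: le_trans (Hn k nk tT) _.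
    by rewrite expr2 mulrA ler_wpM2r// ltW.
  have tnk : tm n <= tm k by exact: tm_nd.
  have D1 : 0 <= c * (tm k - tm n) * D n.
    by rewrite mulr_ge0// mulr_ge0 ?subr_ge0// ltW.
  have dnk := desc n k nk.
  split; first lra.
  move=> t2; have : c * (T / 2) * D n <= c * (tm k - tm n) * D n.
    by rewrite ler_wpM2r// ler_wpM2l// ltW.
  by rewrite !mulrA; lra.
have Wlo (e : R) : 0 < e -> \forall n \near \oo, b - e <= W n.
  move=> e0; apply: contrapT => fr.
  have freq N : exists2 n, (N <= n)%N & W n < b - e.
    apply: contrapT => H; apply: fr; exists N => // n /= Nn.
    by rewrite leNgt; apply/negP => Wn; apply: H; exists n.
  have be : b - e < b by lra.
  have [l [s [s0 ls lsb sepls]]] := sep _ _ be.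
  (* The bound [s / 2] keeps excursions below [l + s]; the bound [c * s / 4] makes the error at most
     half of the drop [c * T / 2 * s]. *)
  have e'0 : 0 < Num.min (s / 2) (c * s / 4).
    by rewrite lt_min !divr_gt0// mulr_gt0.
  have [T [T0 T1 CT [N1 _ HT]]] := dec _ e'0.
  have T2 : 0 < T / 2 by lra.
  have /cvgrPdist_le /(_ _ T2)[N2 _ HN2] := tm_step.
  have [n0 N12 Wn0] := freq (maxn N1 N2).
  (* Every [j] is within time [T] of an anchor [n] with [W n <= l]. When [j.+1] leaves the window of
     the anchor, [j] becomes the new anchor: at least [T / 2] has elapsed, so either [W n <= l - s]
     and the error cannot bring [W] above [l], or [W n] lies in the barrier and the drop wins. *)
  have inv j : (n0 <= j)%N -> exists n : nat,
      [/\ (n0 <= n)%N, (n <= j)%N, tm j - tm n <= T & W n <= l].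
    elim: j => [|j IH].
      rewrite leqn0 => /eqP n00; exists n0; rewrite -n00; split => //; lra.
    rewrite leq_eqVlt => /orP[/eqP <-|nj].
      by exists n0; split => //; lra.
    have [n [n0n nj' tT Wn]] := IH nj.
    have [tT'|tT'] := leP (tm j.+1 - tm n) T.
      by exists n; split => //; exact: leqW.
    have N2j : (N2 <= j)%N by rewrite (leq_trans (leq_trans (leq_maxr _ _) N12)).
    have := HN2 j N2j; rewrite sub0r normrN.
    have := ler_norm (tm j.+1 - tm j) => H1 H2.
    exists j; split => //; first lra.
    have N1n : (N1 <= n)%N by rewrite (leq_trans _ n0n)// (leq_trans _ N12)// leq_maxl.
    have [W1 W2] := HT n N1n j nj' tT.
    have {}W2 := W2 ltac:(lra).
    have m1 : Num.min (s / 2) (c * s / 4) * T <= s / 2.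
      apply: (@le_trans _ _ (s / 2 * T)).
        by rewrite ler_wpM2r ?(ltW T0)// ge_min lexx.
      by rewrite ler_piMr//; lra.
    have m2 : Num.min (s / 2) (c * s / 4) * T <= c * s / 4 * T.
      by rewrite ler_wpM2r ?(ltW T0)// ge_min lexx orbT.
    have [Wl|Wl] := leP (W n) (l - s); first lra.
    have Dn : s <= D n by apply: sepls; rewrite ler_norml; lra.
    have : c * T / 2 * s <= c * T / 2 * D n.
      by rewrite ler_wpM2l// divr_ge0// mulr_ge0// ltW.
    have : 0 < c * s * T by rewrite !mulr_gt0.
    lra.
  have : U (l + s).
    exists n0 => // j /= n0j.
    have [n [n0n nj tT Wn]] := inv j n0j.
    have N1n : (N1 <= n)%N by rewrite (leq_trans _ n0n)// (leq_trans _ N12)// leq_maxl.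
    have [W1 _] := HT n N1n j nj tT.
    have m1 : Num.min (s / 2) (c * s / 4) * T <= s / 2.
      apply: (@le_trans _ _ (s / 2 * T)).
        by rewrite ler_wpM2r ?(ltW T0)// ge_min lexx.
      by rewrite ler_piMr//; lra.
    lra.
  move=> /(ge_inf (ex_intro _ _ Ulb)); rewrite -/b; lra.
(* If [D n > e], the net drop over a window is at least [c * e * T / 4], whereas [W] eventually
   stays in a band of width [c * e * T / 8]. *)
apply/cvgrPdist_le => e e0.
have e'0 : 0 < c * e / 4 by rewrite divr_gt0// mulr_gt0.
have [T [T0 T1 CT HT]] := dec _ e'0.
have e''0 : 0 < c * e * T / 16 by rewrite divr_gt0// !mulr_gt0.
have [N1 _ H1] := Wup _ e''0.
near=> n; rewrite sub0r normrN ger0_norm// leNgt; apply/negP => eD.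
have [k [nk t1 t2]] : exists k : nat,
    [/\ (n <= k)%N, T / 2 <= tm k - tm n & tm k - tm n <= T].
  by near: n; exact: window_end.
have Wn : W n <= b + c * e * T / 16 by near: n; exact: Wup.
have Wk : b - c * e * T / 16 <= W k.
  by move: {t1 t2} k nk; near: n; have [N _ HN] := Wlo _ e''0;
    exists N => // n /= Nn k nk; apply: HN; exact: leq_trans nk.
have [_ /(_ t1)] : W k <= W n + c * e / 4 * T /\
     (T / 2 <= tm k - tm n -> W k <= W n - c * T / 2 * D n + c * e / 4 * T).
  by move: {t1 Wk} k nk t2; near: n.
have : c * T / 2 * e <= c * T / 2 * D n.
  by rewrite ler_wpM2l// ?divr_ge0// ?mulr_ge0// ltW.
lra.
Unshelve. all: by end_near. Qed.

End Windows.

(** * Averaged dynamics of one trajectory under small noise *)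

Section Dynamics.
Context {R : realType} (tm : nat -> R).
Hypothesis tm_nd : {homo tm : n k / (n <= k)%N >-> n <= k}.
Let dt n : R := tm n.+1 - tm n.
Local Notation winO := (winO tm).

Lemma winO_lim_start (u : nat -> R) l j : u n @[n --> \oo] --> l ->
  winO j (fun n _ => u n - l).
Proof.
move=> ul; apply: winO_small => e e0.
have /cvgrPdist_le /(_ e e0)[N _ HN] := ul.
by exists N => // n /= Nn k nk _; rewrite distrC; apply: HN.
Qed.

Lemma winO_incr (u b e : nat -> R) (B : R) : (forall n, `|b n| <= B) ->
  (forall n, u n.+1 - u n = dt n * b n + e n) ->
  winO 2 (fun n k => \sum_(n <= i < k) e i) ->
  winO 1 (fun n k => u k - u n).
Proof.
move=> bB ub he.
have wb : winO 0 (fun _ k => b k) by apply: (@winO_bounded _ _ _ B).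
apply: (winO_eq (winOD (winO_gsum tm_nd wb) (winO_weak he))) => n k nk.
rewrite -big_split/= -(telescope_sumr _ nk); apply: eq_bigr => i _.
exact: ub.
Qed.

(** Freezing the drift at the start of the window costs O(T) per unit of time, hence O(T^2) in
    total. *)
Lemma winO_incr2 (u b c e : nat -> R) :
  (forall n, u n.+1 - u n = dt n * b n + e n) ->
  winO 1 (fun n k => b k - c n) ->
  winO 2 (fun n k => \sum_(n <= i < k) e i) ->
  winO 2 (fun n k => u k - u n - (tm k - tm n) * c n).
Proof.
move=> ub hb he.
apply: (winO_eq (winOD (winO_gsum tm_nd hb) he)) => n k nk.
rewrite -big_split/= -(telescope_sumr _ nk) -(telescope_sumr tm nk) mulr_suml.
rewrite -sumrB; apply: eq_bigr => i _; rewrite ub /dt; ring.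
Qed.

Lemma winO_incrS (u b : nat -> R) (B : R) : (forall n, `|b n| <= B) ->
  (forall n, u n.+1 - u n = dt n * b n.+1) ->
  winO 1 (fun n k => u k - u n).
Proof.
move=> bB ub.
have wb : winO 0 (fun _ k => b k) by apply: (@winO_bounded _ _ _ B).
apply: (winO_eq (winO_gsumS tm_nd wb)) => n k nk.
rewrite -(telescope_sumr _ nk); apply: eq_bigr => i _; exact: ub.
Qed.

Lemma winO_incrS2 (u b : nat -> R) :
  (forall n, u n.+1 - u n = dt n * b n.+1) ->
  winO 1 (fun n k => b k - b n) ->
  winO 2 (fun n k => u k - u n - (tm k - tm n) * b n).
Proof.
move=> ub hb.
apply: (winO_eq (winO_gsumS tm_nd hb)) => n k nk.
rewrite -(telescope_sumr _ nk) -(telescope_sumr tm nk) mulr_suml.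
rewrite -sumrB; apply: eq_bigr => i _; rewrite ub /dt; ring.
Qed.

Lemma winO_bdd_k j (a : nat -> R) (A : R) X : (forall n, `|a n| <= A) ->
  winO j X -> winO j (fun n k => a k * X n k).
Proof.
by move=> aA; apply: (@winOM _ _ 0); apply: (@winO_bounded _ _ _ A).
Qed.

Lemma winO_bdd_n j (a : nat -> R) (A : R) X : (forall n, `|a n| <= A) ->
  winO j X -> winO j (fun n k => a n * X n k).
Proof.
by move=> aA; apply: (@winOM _ _ 0); apply: (@winO_bounded _ _ _ A).
Qed.

Lemma winO_mul_diff (a b : nat -> R) (A l : R) : (forall n, `|b n| <= A) ->
  a n @[n --> \oo] --> l -> winO 1 (fun n k => b k - b n) ->
  winO 1 (fun n k => a k * b k - l * b n).
Proof.
move=> bA al hb.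
apply: (winO_eq (winOD (winO_bdd_k bA (winO_lim tm 1 al)) (winO_Zl l hb))).
by move=> n k _; ring.
Qed.

Hypothesis tm_oo : forall A : R, exists n, A <= tm n.
Hypothesis tm_step : tm n.+1 - tm n @[n --> \oo] --> (0 : R).

(** All data are real sequences read along one trajectory: [F n], [G i n] and [S i n] stand for
    values at the iterate [x n], and [I] indexes the coordinates. *)
Context (I : finType) (F : nat -> R) (v m x G S : I -> nat -> R)
  (h r p q : nat -> R) (hoo roo poo qoo eps : R) (nv nm : I -> nat -> R) (B L : R).
Hypotheses (FB : forall n, `|F n| <= B) (vB : forall i n, `|v i n| <= B)
  (mB : forall i n, `|m i n| <= B) (GB : forall i n, `|G i n| <= B)
  (SB : forall i n, `|S i n| <= B).
Hypotheses (v0 : forall i n, 0 <= v i n) (S0 : forall i n, 0 <= S i n).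
Hypothesis L0 : 0 <= L.
Hypothesis F_taylor : forall n k, F k - F n <=
  \sum_i G i n * (x i k - x i n) + L * \sum_i (x i k - x i n) ^+ 2.
Hypothesis G_lip : forall i n k, `|G i k - G i n| <= L * \sum_j `|x j k - x j n|.
Hypothesis S_lip : forall i n k, `|S i k - S i n| <= L * \sum_j `|x j k - x j n|.
Hypotheses (h_lim : h n @[n --> \oo] --> hoo) (r_lim : r n @[n --> \oo] --> roo)
  (p_lim : p n @[n --> \oo] --> poo) (q_lim : q n @[n --> \oo] --> qoo).
Hypotheses (hoo0 : 0 < hoo) (poo0 : 0 <= poo) (qoo0 : 0 < qoo)
  (rq : qoo / 4 < roo) (eps0 : 0 < eps).
Hypothesis v_rec : forall i n,
  v i n.+1 - v i n = dt n * (p n * S i n - q n * v i n) + nv i n.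
Hypothesis m_rec : forall i n,
  m i n.+1 - m i n = dt n * (h n * G i n - r n * m i n) + nm i n.
Hypothesis x_rec : forall i n,
  x i n.+1 - x i n = - (dt n * (m i n.+1 / Num.sqrt (v i n.+1 + eps))).
Hypothesis nv_small : forall i, winO 2 (fun n k => \sum_(n <= l < k) nv i l).
Hypothesis nm_small : forall i, winO 2 (fun n k => \sum_(n <= l < k) nm i l).

Let al i n : R := (Num.sqrt (v i n + eps))^-1.
Let s i n : R := Num.sqrt (v i n + eps).
Let amax : R := (Num.sqrt eps)^-1.
Let amin : R := (Num.sqrt (B + eps))^-1.

Let s_gt0 i n : 0 < s i n.
Proof. by rewrite sqrtr_gt0 ltr_wpDl. Qed.

Let al_gt0 i n : 0 < al i n.
Proof. by rewrite invr_gt0 s_gt0. Qed.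

Let B0 : 0 <= B.
Proof. exact: le_trans (normr_ge0 _) (FB 0). Qed.

Let al_s i n : al i n * s i n = 1.
Proof. by rewrite /al mulVf// gt_eqF// s_gt0. Qed.

Let s_sq i n : s i n ^+ 2 = v i n + eps.
Proof. by rewrite sqr_sqrtr// addr_ge0// ltW. Qed.

Let al_sq i n : al i n ^+ 2 * (v i n + eps) = 1.
Proof. by rewrite -s_sq -exprMn al_s expr1n. Qed.

Let al_max i n : al i n <= amax.
Proof.
rewrite lef_pV2 ?posrE ?sqrtr_gt0//; last exact: ltr_wpDl.
by apply: ler_wsqrtr; rewrite lerDr.
Qed.

Let al_min i n : amin <= al i n.
Proof.
rewrite lef_pV2 ?posrE ?sqrtr_gt0//; try exact: ltr_wpDl.
by apply: ler_wsqrtr; rewrite lerD2r; exact: le_trans (ler_norm _) (vB i n).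
Qed.

Let amax0 : 0 < amax. Proof. by rewrite invr_gt0 sqrtr_gt0. Qed.
Let amin0 : 0 < amin. Proof. by rewrite invr_gt0 sqrtr_gt0 ltr_wpDl. Qed.

Let al_norm i n : `|al i n| <= amax.
Proof. by rewrite gtr0_norm. Qed.

Let ma_norm i n : `|- (m i n * al i n)| <= B * amax.
Proof. by rewrite normrN normrM ler_pM. Qed.

Let x_rec' i n : x i n.+1 - x i n = dt n * - (m i n.+1 * al i n.+1).
Proof. by rewrite x_rec mulrN. Qed.

Let seq_bound (u : nat -> R) (l : R) : u n @[n --> \oo] --> l ->
  exists A, forall n, `|u n| <= A.
Proof.
move=> ul; have /cvg_seq_bounded[A [_ HA]] := cvgP _ ul.
by exists (A + 1) => n; apply: HA => //; rewrite ltrDl.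
Qed.

Let dx i : winO 1 (fun n k => x i k - x i n).
Proof. exact: (winO_incrS (ma_norm i) (x_rec' i)). Qed.

Let dG i : winO 1 (fun n k => G i k - G i n).
Proof.
apply: (winO_le (winO_Zl L (winO_sum (fun j => winO_norm (dx j))))) => n k _.
by apply: (le_trans (G_lip i n k)); exact: ler_norm.
Qed.

Let dS i : winO 1 (fun n k => S i k - S i n).
Proof.
apply: (winO_le (winO_Zl L (winO_sum (fun j => winO_norm (dx j))))) => n k _.
by apply: (le_trans (S_lip i n k)); exact: ler_norm.
Qed.

Let prodB (a b : nat -> R) A A' : (forall n, `|a n| <= A) ->
  (forall n, `|b n| <= A') -> forall n, `|a n * b n| <= A * A'.
Proof. by move=> HA HA' n; rewrite normrM ler_pM. Qed.

Let subB (a b : nat -> R) A A' : (forall n, `|a n| <= A) ->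
  (forall n, `|b n| <= A') -> forall n, `|a n - b n| <= A + A'.
Proof.
by move=> HA HA' n; rewrite (le_trans (ler_normB _ _))// lerD.
Qed.

Let dv i : winO 1 (fun n k => v i k - v i n).
Proof.
have [A HA] := seq_bound p_lim; have [A' HA'] := seq_bound q_lim.
exact: (winO_incr (subB (prodB HA (SB i)) (prodB HA' (vB i))) (v_rec i)).
Qed.

Let dm i : winO 1 (fun n k => m i k - m i n).
Proof.
have [A HA] := seq_bound h_lim; have [A' HA'] := seq_bound r_lim.
exact: (winO_incr (subB (prodB HA (GB i)) (prodB HA' (mB i))) (m_rec i)).
Qed.

Let Ev i n k : R := v i k - v i n - (tm k - tm n) * (poo * S i n - qoo * v i n).
Let Em i n k : R := m i k - m i n - (tm k - tm n) * (hoo * G i n - roo * m i n).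
Let Ex i n k : R := x i k - x i n - (tm k - tm n) * - (m i n * al i n).

Let Ev2 i : winO 2 (Ev i).
Proof.
apply: (winO_incr2 (v_rec i)) => //.
apply: (winO_eq (winOB (winO_mul_diff (SB i) p_lim (dS i))
                       (winO_mul_diff (vB i) q_lim (dv i)))).
by move=> n k _; ring.
Qed.

Let Em2 i : winO 2 (Em i).
Proof.
apply: (winO_incr2 (m_rec i)) => //.
apply: (winO_eq (winOB (winO_mul_diff (GB i) h_lim (dG i))
                       (winO_mul_diff (mB i) r_lim (dm i)))).
by move=> n k _; ring.
Qed.

(** [al ^+ 2] is rational in [v], so its increments are exact and the square root is never
    differentiated. Increments of [al] follow on division by [al i k + al i n]. *)
Let dal2E i n k : al i k ^+ 2 - al i n ^+ 2 =
  - ((v i k - v i n) * al i k ^+ 2 * al i n ^+ 2).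
Proof.
have := al_sq i k; have := al_sq i n.
set a := al i k ^+ 2; set b := al i n ^+ 2 => Hb Ha.
have -> : a - b = a * (b * (v i n + eps)) - b * (a * (v i k + eps)).
  by rewrite Ha Hb !mulr1.
ring.
Qed.

Let dal i : winO 1 (fun n k => al i k - al i n).
Proof.
apply: (winO_le (winO_Zl (amax ^+ 3) (dv i))) => n k _.
rewrite normrM (ger0_norm (exprn_ge0 _ (ltW amax0))).
have E : (al i k - al i n) * (al i k + al i n) =
    - ((v i k - v i n) * al i k ^+ 2 * al i n ^+ 2).
  by rewrite -dal2E; ring.
have a0 := al_gt0 i k; have b0 := al_gt0 i n.
have -> : al i k - al i n = - ((v i k - v i n) * al i k ^+ 2 * al i n ^+ 2)
    / (al i k + al i n).
  by rewrite -E mulfK// gt_eqF// addr_gt0.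
move: (al_max i k) (al_max i n) a0 b0.
move: (al i k) (al i n) (v i k - v i n) => a b w aA bA a0 b0.
have ab0 : 0 < a + b by rewrite addr_gt0.
rewrite normrM normrN normfV (gtr0_norm ab0) -(mulrA w) (normrM w).
have ab2 : 0 <= a ^+ 2 * b ^+ 2 by apply: mulr_ge0; exact: sqr_ge0.
rewrite (ger0_norm ab2) ler_pdivrMr//.
have -> : amax ^+ 3 * `|w| * (a + b) = `|w| * (amax ^+ 2 * (amax * (a + b))).
  by ring.
rewrite ler_wpM2l//; apply: ler_pM; rewrite ?exprn_ge0 ?(ltW a0) ?(ltW b0)//.
  by rewrite lerXn2r// ?nnegrE ltW.
by rewrite expr2; apply: ler_pM; rewrite ?(ltW b0)// lerDr ltW.
Qed.

Let Ex2 i : winO 2 (Ex i).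
Proof.
apply: (winO_incrS2 (x_rec' i)).
apply: (winO_eq (winON (winOD (winO_bdd_k (mB i) (dal i))
  (winO_bdd_n (al_norm i) (dm i))))).
by move=> n k _; ring.
Qed.

Let s_norm i n : `|s i n| <= Num.sqrt (B + eps).
Proof.
rewrite ger0_norm ?sqrtr_ge0//; apply: ler_wsqrtr; rewrite lerD2r.
exact: le_trans (ler_norm _) (vB i n).
Qed.

(** The derivative of [(v + eps)^(-1/2)] is [- al ^+ 3 / 2]. The remainder is deduced from that of
    [al ^+ 2] through [b^2 - a^2 - (b - a)^2 = 2 a (b - a)] and the factor [s / 2], where
    [a s = 1]. *)
Let dal_taylor i : winO 2 (fun n k =>
  al i k - al i n + (v i k - v i n) * al i n ^+ 3 / 2).
Proof.
have w : winO 2 (fun n k =>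
  al i n ^+ 4 * ((v i k - v i n) * (v i k - v i n)) * (al i k ^+ 2)
  - (al i k - al i n) * (al i k - al i n)).
  apply: winOB; last exact: (winOM (dal i) (dal i)).
  have a4 n : `|al i n ^+ 4| <= amax ^+ 4.
    by rewrite normrX lerXn2r// ?nnegrE// ltW.
  have a2 n : `|al i n ^+ 2| <= amax ^+ 2.
    by rewrite normrX lerXn2r// ?nnegrE// ltW.
  have := winO_bdd_k a2 (winO_bdd_n a4 (winOM (dv i) (dv i))).
  by move/winO_eq; apply => n k _; rewrite [LHS]mulrC.
apply: (winO_eq (winO_bdd_n (s_norm i) (winO_Zl (1/2) w))) => n k _.
have E := dal2E i n k.
have -> : al i n ^+ 4 * ((v i k - v i n) * (v i k - v i n)) * al i k ^+ 2 =
    al i k ^+ 2 - al i n ^+ 2 + (v i k - v i n) * al i n ^+ 4.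
  transitivity (- ((v i k - v i n) * al i n ^+ 2 * (al i k ^+ 2 - al i n ^+ 2))).
    by rewrite E; ring.
  by rewrite mulrBr opprB addrC [in RHS]E; ring.
have := al_s i n; move: (al i n) (al i k) (s i n) (v i k - v i n) => a b t y ta.
transitivity ((a * t) * (b - a + y * a ^+ 3 / 2)); first by rewrite ta mul1r.
by field.
Qed.

(** Product rule for [m ^+ 2 * al / 2] along the limit drifts. Below, [w1], [w2], [w3] carry the
    remainders of [m], [al], [v], while [w4] and [w5] contain products of two first-order
    increments. *)
Let phi_taylor i : winO 2 (fun n k =>
  (m i k ^+ 2 * al i k - m i n ^+ 2 * al i n) / 2
  - (tm k - tm n) * (m i n * al i n * (hoo * G i n - roo * m i n)
     - m i n ^+ 2 * al i n ^+ 3 / 4 * (poo * S i n - qoo * v i n))).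
Proof.
have sq (a : nat -> R) A (j : nat) : (forall n, `|a n| <= A) ->
    forall n, `|a n ^+ j| <= A ^+ j.
  by move=> aA n; rewrite normrX lerXn2r// ?nnegrE// (le_trans _ (aA n)).
have w1 := winO_bdd_n (prodB (mB i) (al_norm i)) (Em2 i).
have w2 := winO_Zl (1/2) (winO_bdd_n (sq _ _ 2 (mB i)) (dal_taylor i)).
have w3 := winO_Zl (1/4) (winO_bdd_n (prodB (sq _ _ 2 (mB i)) (sq _ _ 3 (al_norm i)))
  (Ev2 i)).
have w4 := winO_bdd_n (mB i) (winOM (dm i) (dal i)).
have w5 := winO_Zl (1/2) (winO_bdd_k (al_norm i) (winOM (dm i) (dm i))).
apply: (winO_eq (winOD (winOD (winOB (winOD w1 w2) w3) w4) w5)) => n k _.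
by rewrite /Em /Ev; field.
Qed.

Let N : R := \sum_(i : I) 1.

Let sum_cst (a : R) : \sum_(i : I) a = N * a.
Proof. by rewrite mulr_suml; under [RHS]eq_bigr do rewrite mul1r. Qed.

Let N0 : 0 <= N.
Proof. exact: sumr_ge0. Qed.

Let abs_mul_le (a b : R) : `|a| * `|b| <= (a ^+ 2 + b ^+ 2) / 2.
Proof.
rewrite -(real_normK (num_real a)) -(real_normK (num_real b)).
have := sqr_ge0 (`|a| - `|b|); rewrite sqrrB; lra.
Qed.

Let sumsq_double (u : I -> R) :
  \sum_i \sum_j `|u j| * `|u i| <= N * \sum_i u i ^+ 2.
Proof.
apply: (@le_trans _ _ (\sum_i \sum_j (u j ^+ 2 + u i ^+ 2) / 2)).
  by do 2 (apply: ler_sum => ? _); exact: abs_mul_le.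
have E i : \sum_j (u j ^+ 2 + u i ^+ 2) / 2 =
    (\sum_j u j ^+ 2 + N * u i ^+ 2) / 2.
  by rewrite -mulr_suml big_split/= sum_cst.
rewrite (eq_bigr _ (fun i _ => E i)) -mulr_suml big_split/= sum_cst.
rewrite -mulr_sumr; lra.
Qed.

Let D n : R := \sum_i m i n ^+ 2 + \sum_i G i n ^+ 2.

Let D0 n : 0 <= D n.
Proof. by rewrite addr_ge0// sumr_ge0// => i _; rewrite sqr_ge0. Qed.

(** The barriers: levels of [F] near which the gradient stays away from 0 along the trajectory. They
    will come from compactness and the assumption on critical values. *)
Hypothesis sep : forall a b : R, a < b -> exists l e : R,
  [/\ 0 < e, a < l - e, l + e < b &
   forall n, `|F n - l| <= e -> (forall i, `|G i n| <= e) -> False].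

Let rq0 : 0 < (roo - qoo / 4) * amin.
Proof. by rewrite mulr_gt0// subr_gt0. Qed.

(** Cost in [|m|^2] of the cross term per unit of [de]: the first summand is due to Young's
    inequality on [roo * G * m], the second to the motion of the [L]-Lipschitz [G] along [x]. *)
Let K : R := roo ^+ 2 / (2 * hoo) + L * amax * N.
Let K0 : 0 <= K.
Proof.
apply: addr_ge0; first by rewrite divr_ge0 ?sqr_ge0// mulr_ge0// ltW.
by rewrite !mulr_ge0// ltW.
Qed.

(** Chosen so that the cross term uses at most half of the dissipation [(roo - qoo / 4) * amin] in
    [m]; the [+ 1] keeps the denominator positive. *)
Let de : R := (roo - qoo / 4) * amin / (2 * (K + 1)).
Let de0 : 0 < de.
Proof. by rewrite divr_gt0// mulr_gt0// ltr_wpDl. Qed.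

Let deK : de * K <= (roo - qoo / 4) * amin / 2.
Proof.
rewrite /de; set a := (_ * amin); have a0 : 0 < a by exact: rq0.
rewrite invfM mulrA -[leLHS]mulrA ler_piMr//; first by rewrite divr_ge0// ltW.
by rewrite mulrC ler_pdivrMr ?mul1r ?lerDl// ltr_wpDl.
Qed.

Let sumsq_ge (u : I -> R) i : u i ^+ 2 <= \sum_j u j ^+ 2.
Proof.
by rewrite (bigD1 i)//= lerDl; apply: sumr_ge0 => j _; exact: sqr_ge0.
Qed.

Let G_D i n : G i n ^+ 2 <= D n.
Proof.
apply: (le_trans (sumsq_ge (G ^~ n) i)).
by rewrite /D lerDr; apply: sumr_ge0 => j _; exact: sqr_ge0.
Qed.

Let m_D i n : m i n ^+ 2 <= D n.
Proof.
apply: (le_trans (sumsq_ge (m ^~ n) i)).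
by rewrite /D lerDl; apply: sumr_ge0 => j _; exact: sqr_ge0.
Qed.

Let W n : R := hoo * F n + \sum_i m i n ^+ 2 * al i n / 2 - de * \sum_i G i n * m i n.

(** The three errors come from [F], from [m ^+ 2 * al / 2] and from the cross term. In [XG], the
    factor [|m i k - m i n|] is the price of replacing [m i k] by [m i n]. *)
Let XF n k : R := \sum_i G i n * Ex i n k + L * \sum_i (x i k - x i n) * (x i k - x i n).
Let Xphi i n k : R := (m i k ^+ 2 * al i k - m i n ^+ 2 * al i n) / 2
  - (tm k - tm n) * (m i n * al i n * (hoo * G i n - roo * m i n)
     - m i n ^+ 2 * al i n ^+ 3 / 4 * (poo * S i n - qoo * v i n)).
Let XG i n k : R := L * \sum_j ((tm k - tm n) * (amax * B) * `|m i k - m i n|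
   + `|Ex j n k| * B) - G i n * Em i n k.
Let X n k : R := hoo * XF n k + \sum_i Xphi i n k + de * \sum_i XG i n k.

Let X2 : winO 2 X.
Proof.
apply: winOD; first apply: winOD.
- apply: winO_Zl; apply: winOD.
    by apply: winO_sum => i; exact: (winO_bdd_n (GB i) (Ex2 i)).
  by apply: winO_Zl; apply: winO_sum => i; exact: (winOM (dx i) (dx i)).
- by apply: winO_sum => i; exact: phi_taylor.
- apply: winO_Zl; apply: winO_sum => i; apply: winOB; last first.
    exact: (winO_bdd_n (GB i) (Em2 i)).
  apply: winO_Zl; apply: winO_sum => j; apply: winOD.
    have := winO_Zl (amax * B) (winOM (winO_time tm_nd) (winO_norm (dm i))).
    by move/winO_eq; apply => n k _; ring.
  by have := winO_Zl B (winO_norm (Ex2 j)); move/winO_eq; apply => n k _; ring.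
Qed.

(** What remains of each dissipation: that of [m ^+ 2] after paying for the cross term, and that of
    [G ^+ 2] after giving half of [de * hoo] to Young's inequality. *)
Let c : R := Num.min ((roo - qoo / 4) * amin / 2) (de * hoo / 2).
Let c0 : 0 < c.
Proof. by rewrite lt_min (divr_gt0 rq0)// divr_gt0// mulr_gt0. Qed.

Let W_descent n k : (n <= k)%N ->
  W k <= W n - c * (tm k - tm n) * D n + X n k.
Proof.
move=> nk; have t0 : 0 <= tm k - tm n by rewrite subr_ge0 tm_nd.
set t := tm k - tm n in t0 *.
have HF : F k - F n <= \sum_i (- (t * (G i n * m i n * al i n))) + XF n k.
  apply: (le_trans (F_taylor n k)); rewrite /XF addrA lerD2r -big_split/=.
  by apply: ler_sum => i _; rewrite /Ex -/t le_eqVlt; apply/orP; left; apply/eqP; ring.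
(* The part [(G i k - G i n) * m i k] can only be bounded in absolute value, by the Lipschitz
   property. The part [- G i n * (m i k - m i n)] yields the wanted [- hoo * G i n ^+ 2]. *)
have HG i : - (G i k * m i k - G i n * m i n) <=
    - (t * (hoo * G i n ^+ 2 - roo * G i n * m i n)) +
    t * L * amax * (\sum_j `|m j n| * `|m i n|) + XG i n k.
  pose Z : R := \sum_j (t * (amax * B) * `|m i k - m i n| + `|Ex j n k| * B).
  have XGE : XG i n k = L * Z - G i n * Em i n k by [].
  have : - ((G i k - G i n) * m i k) <=
    L * \sum_j (t * amax * (`|m j n| * `|m i n|) + (t * (amax * B) * `|m i k - m i n|
   + `|Ex j n k| * B)).
    apply: (le_trans (ler_norm _)); rewrite normrN normrM.
    apply: (@le_trans _ _ (L * (\sum_j `|x j k - x j n|) * `|m i k|)).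
      by rewrite ler_wpM2r.
    rewrite -mulrA ler_wpM2l// mulr_suml; apply: ler_sum => j _.
    have H1 : `|x j k - x j n| <= t * amax * `|m j n| + `|Ex j n k|.
      have -> : x j k - x j n = - (t * al j n * m j n) + Ex j n k.
        by rewrite /Ex -/t; ring.
      apply: (le_trans (ler_normD _ _)); rewrite lerD2r normrN !normrM.
      by rewrite (ger0_norm t0) ler_wpM2r// ler_wpM2l.
    have H2 : `|m i k| <= `|m i n| + `|m i k - m i n|.
      by rewrite -{1}(subrK (m i n) (m i k)) addrC ler_normD.
    have P0 : 0 <= t * amax by rewrite mulr_ge0// ltW.
    apply: (le_trans (ler_wpM2r (normr_ge0 _) H1)); rewrite mulrDl.
    rewrite addrA lerD//; last by rewrite ler_wpM2l.
    apply: (le_trans (ler_wpM2l (mulr_ge0 P0 (normr_ge0 _)) H2)).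
    rewrite mulrDr !mulrA lerD2l ler_wpM2r// ler_wpM2l//.
  rewrite big_split/= -mulr_sumr -/Z mulrDr XGE => {XGE}H.
  have -> : - (G i k * m i k - G i n * m i n) =
     - ((G i k - G i n) * m i k) - G i n * (m i k - m i n) by ring.
  have -> : m i k - m i n = t * (hoo * G i n - roo * m i n) + Em i n k.
    by rewrite /Em -/t; ring.
  move: H; move: (Em i n k) (\sum_j `|m j n| * `|m i n| : R) => em Y.
  clearbody Z t; lra.
pose SS : R := \sum_i \sum_j `|m j n| * `|m i n|.
pose P1 : R := \sum_i Xphi i n k.
pose P2 : R := \sum_i XG i n k.
pose Y1 : R := \sum_i - (t * (G i n * m i n * al i n)).
pose Y2 : R := \sum_i t * (m i n * al i n * (hoo * G i n - roo * m i n)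
     - m i n ^+ 2 * al i n ^+ 3 / 4 * (poo * S i n - qoo * v i n)).
pose Y3 : R := \sum_i - (t * (hoo * G i n ^+ 2 - roo * G i n * m i n)).
have HW : W k - W n <= hoo * (Y1 + XF n k) + (Y2 + P1)
    + de * (Y3 + t * L * amax * SS + P2).
  have -> : W k - W n = hoo * (F k - F n)
    + (\sum_i m i k ^+ 2 * al i k / 2 - \sum_i m i n ^+ 2 * al i n / 2)
    + de * - (\sum_i G i k * m i k - \sum_i G i n * m i n) by rewrite /W; ring.
  apply: lerD; first apply: lerD.
  - by rewrite ler_wpM2l// ltW.
  - rewrite -sumrB -big_split/=; apply: ler_sum => i _; rewrite /Xphi -/t.
    by rewrite [leRHS]addrC subrK mulrBl.
  - rewrite ler_wpM2l ?(ltW de0)// -sumrB -sumrN /SS mulr_sumr -!big_split/=.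
    exact: ler_sum.
suff : W k - W n <= - (c * t * D n) + X n k by lra.
apply: (le_trans HW).
have P3 : de * (t * L * amax * SS) <= t * (de * (L * amax * N)) * \sum_i m i n ^+ 2.
  have := ler_wpM2l (mulr_ge0 (mulr_ge0 (mulr_ge0 (ltW de0) t0) L0) (ltW amax0))
    (sumsq_double (fun i => m i n)).
  rewrite -/SS; clear HW; move: SS (\sum_i _); clearbody t => *; lra.
rewrite /X -/P1 -/P2.
(* With the errors split off, an inequality between frozen first-order terms remains; it is proved
   coordinate by coordinate. *)
suff : hoo * Y1 + Y2 + de * Y3 + t * (de * (L * amax * N)) * \sum_i m i n ^+ 2
    <= - (c * t * D n).
  clear HW; move: P3; move: (XF n k) Y1 Y2 Y3 P1 P2 SS (D n) (\sum_i _).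
  clearbody t => *; lra.
rewrite /Y1 /Y2 /Y3 {HW P3 Y1 Y2 Y3 P1 P2}.
have [cN cNE] : exists y, y = L * amax * N by exists (L * amax * N).
rewrite -cNE /D mulrDr !mulr_sumr -!big_split/= -sumrN; apply: ler_sum => i _.
have a0 := al_gt0 i n.
have c1 : c <= (roo - qoo / 4) * amin / 2 by rewrite ge_min lexx.
have c2 : c <= de * hoo / 2 by rewrite ge_min lexx orbT.
have Q1 : 0 <= m i n ^+ 2 * al i n ^+ 3 / 4 * (poo * S i n).
  apply: mulr_ge0; last exact: mulr_ge0.
  apply: mulr_ge0; last by rewrite invr_ge0.
  by apply: mulr_ge0; [exact: sqr_ge0|exact/exprn_ge0/ltW].
(* Here [qoo / 4] arises: one factor 1/2 is the weight of [m ^+ 2 * al], the other comes from the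
   derivative of [al], and [al ^+ 2 * v <= 1]. *)
have Q2 : m i n ^+ 2 * al i n ^+ 3 / 4 * (qoo * v i n) <=
   qoo / 4 * (m i n ^+ 2 * al i n).
  have -> : m i n ^+ 2 * al i n ^+ 3 / 4 * (qoo * v i n) =
    qoo / 4 * (m i n ^+ 2 * al i n) * (al i n ^+ 2 * v i n) by ring.
  apply: ler_piMr.
    apply: mulr_ge0; first by rewrite divr_ge0// ltW.
    by apply: mulr_ge0; [exact: sqr_ge0|exact: ltW].
  have := al_sq i n; have : 0 <= al i n ^+ 2 * eps by rewrite mulr_ge0 ?sqr_ge0// ltW.
  lra.
have Q3 : (roo - qoo / 4) * amin * m i n ^+ 2 <= (roo - qoo / 4) * (m i n ^+ 2 * al i n).
  rewrite -mulrA ler_wpM2l//; first by rewrite subr_ge0 ltW.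
  by rewrite mulrC ler_wpM2l// sqr_ge0.
have Q4 : roo * G i n * m i n <= hoo / 2 * G i n ^+ 2 + roo ^+ 2 / (2 * hoo) * m i n ^+ 2.
  have := sqr_ge0 (hoo * G i n - roo * m i n).
  rewrite -(pmulr_rge0 _ (_ : 0 < (2 * hoo)^-1)); last by rewrite invr_gt0 mulr_gt0.
  move=> H; rewrite -subr_ge0; apply: (le_trans H); rewrite le_eqVlt; apply/orP; left.
  by apply/eqP; field; rewrite gt_eqF.
have Q5 := ler_wpM2r (sqr_ge0 (m i n)) deK.
have Q6 := ler_wpM2r (sqr_ge0 (m i n)) c1.
have Q7 := ler_wpM2r (sqr_ge0 (G i n)) c2.
have Q8 := ler_wpM2l (ltW de0) Q4.
(* The terms [hoo * G * m * al] of [Y1] and [Y2] have opposite signs and disappear in this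
   rewriting. *)
rewrite [leLHS](_ : _ =
  t * (- roo * (m i n ^+ 2 * al i n) - m i n ^+ 2 * al i n ^+ 3 / 4 * (poo * S i n)
    + m i n ^+ 2 * al i n ^+ 3 / 4 * (qoo * v i n)
    - de * hoo * G i n ^+ 2 + de * (roo * G i n * m i n) +
    de * cN * m i n ^+ 2)); last by ring.
rewrite [leRHS](_ : _ = t * (- (c * m i n ^+ 2) - c * G i n ^+ 2)); last by ring.
rewrite ler_wpM2l//.
move: Q5; rewrite /K -cNE mulrDr mulrDl.
move: Q1 Q2 Q3 Q4 Q6 Q7 Q8.
lra.
Qed.

(** The two differ by a quadratic form in [(m, G)], so where [D] is small, being near a level of [W]
    means being near a level of [hoo * F]. This transfers the barriers from [F] to [W]. *)
Let W_F n : `|W n - hoo * F n| <= (amax + de) * D n.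
Proof.
have -> : W n - hoo * F n = \sum_i (m i n ^+ 2 * al i n / 2 - de * (G i n * m i n)).
  by rewrite sumrB -mulr_sumr /W; ring.
apply: (le_trans (ler_norm_sum _ _ _)); rewrite /D -big_split mulr_sumr/=.
apply: ler_sum => i _; apply: (le_trans (ler_normB _ _)).
have m0 : 0 <= m i n ^+ 2 * al i n / 2.
  by rewrite divr_ge0//; apply: mulr_ge0; [exact: sqr_ge0|exact: ltW].
rewrite (ger0_norm m0) (normrM de) (normrM (G i n)) (gtr0_norm de0).
have := ler_wpM2l (ltW de0) (abs_mul_le (G i n) (m i n)).
have := ler_wpM2l (sqr_ge0 (m i n)) (al_max i n).
have := mulr_ge0 (sqr_ge0 (G i n)) (ltW amax0).
have := mulr_ge0 (sqr_ge0 (G i n)) (ltW de0).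
have := mulr_ge0 (sqr_ge0 (m i n)) (ltW amax0).
have := mulr_ge0 (sqr_ge0 (m i n)) (ltW de0).
lra.
Qed.

Lemma dynamics_D : D n @[n --> \oo] --> (0 : R).
Proof.
have Dbnd n : D n <= N * (B ^+ 2) + N * (B ^+ 2).
  apply: lerD; rewrite -sum_cst; apply: ler_sum => i _;
    by rewrite -real_normK ?num_real// lerXn2r// nnegrE.
have WB n : `|W n| <= hoo * B + (amax + de) * (N * (B ^+ 2) + N * (B ^+ 2)).
  rewrite -(subrK (hoo * F n) (W n)) addrC (le_trans (ler_normD _ _))// lerD//.
    by rewrite normrM gtr0_norm// ler_wpM2l// ltW.
  by apply: (le_trans (W_F n)); rewrite ler_wpM2l// addr_ge0// ltW.
apply: (lyapunov_descent tm_nd tm_oo tm_step c0 WB D0 X2 W_descent).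
move=> a b ab.
have ab' : a / hoo < b / hoo by rewrite ltr_pM2r// invr_gt0.
have [l [e [e0 al' lb Hl]]] := sep ab'.
have C0 : 0 < 1 + (amax + de) by rewrite ltr_pwDl// addr_ge0// ltW.
(* The first bound turns [|W n - hoo * l| <= e'] and [D n < e'] into [|F n - l| <= e]; the second
   gives [|G i n| <= e]; the third keeps the barrier between [a] and [b]. *)
pose e' := Num.min (hoo * e / (1 + (amax + de))) (Num.min (e ^+ 2) (hoo * e)).
have he0 : 0 < hoo * e by rewrite mulr_gt0.
have e'0 : 0 < e' by rewrite !lt_min divr_gt0// exprn_gt0.
have e1 : e' * (1 + (amax + de)) <= hoo * e by rewrite -ler_pdivlMr// ge_min lexx.
have e2 : e' <= e ^+ 2 by rewrite !ge_min lexx orbT.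
have e3 : e' <= hoo * e by rewrite !ge_min lexx !orbT.
exists (hoo * l), e'; split => //.
- by move: al'; rewrite ltr_pdivrMr// mulrBl; lra.
- by move: lb; rewrite ltr_pdivlMr// mulrDl; lra.
move=> n Wn; rewrite leNgt; apply/negP => De.
apply: (Hl n).
  rewrite -(ler_pM2l hoo0) -{1}(gtr0_norm hoo0) -normrM mulrBr.
  have -> : hoo * F n - hoo * l = - (W n - hoo * F n) + (W n - hoo * l) by ring.
  rewrite (le_trans (ler_normD _ _))// normrN.
  have := W_F n.
  have : (amax + de) * D n <= (amax + de) * e'.
    by rewrite ler_wpM2l ?addr_ge0 ?(ltW amax0) ?(ltW de0)// ltW.
  lra.
move=> i; rewrite -(@ler_pXn2r _ 2%N)// ?nnegrE ?(ltW e0)//.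
rewrite real_normK ?num_real//; apply: le_trans e2; apply: ltW.
exact: le_lt_trans (G_D i n) De.
Qed.

Let sq_cvg0 (u : nat -> R) : (forall n, u n ^+ 2 <= D n) -> u n @[n --> \oo] --> (0:R).
Proof.
move=> uD; apply/cvgrPdist_le => e e0.
have /cvgrPdist_le /(_ (e ^+ 2)) H := dynamics_D.
have := H (exprn_gt0 _ e0); apply: filterS => n.
rewrite !sub0r !normrN (ger0_norm (D0 n)) => De.
rewrite -(@ler_pXn2r _ 2%N)// ?nnegrE ?(ltW e0)// real_normK ?num_real//.
exact: le_trans De.
Qed.

Lemma dynamics_m i : m i n @[n --> \oo] --> (0 : R).
Proof. exact/sq_cvg0/m_D. Qed.

Lemma dynamics_G i : G i n @[n --> \oo] --> (0 : R).
Proof. exact/sq_cvg0/G_D. Qed.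

(** The difference [y] nearly solves [y' = - qoo y]: since [m] tends to 0, the motion of [x], hence
    of [S], over a window is a second-order error. [lyapunov_descent] then applies with [|y|] in
    both roles, [W] and [D]. *)
Lemma dynamics_v i : v i n - poo / qoo * S i n @[n --> \oo] --> (0 : R).
Proof.
pose y n := v i n - poo / qoo * S i n.
have dS2 : winO 2 (fun n k => S i k - S i n).
  have w j : winO 2 (fun n k => x j k - x j n).
    have wm : winO 1 (fun n _ => m j n).
      by apply: (winO_eq (winO_lim_start 1 (dynamics_m j))) => n k _; rewrite subr0.
    apply: (winO_eq (winOB (Ex2 j)
       (winOM (winO_time tm_nd) (winO_bdd_n (al_norm j) wm)))) => n k _.
    by rewrite /Ex; ring.
  apply: (winO_le (winO_Zl L (winO_sum (fun j => winO_norm (w j))))) => n k _.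
  by apply: (le_trans (S_lip i n k)); exact: ler_norm.
have yB n : `|y n| <= B + `|poo / qoo| * B.
  by rewrite (le_trans (ler_normB _ _))// lerD// normrM ler_wpM2l.
have EyE n k : y k = y n * (1 - qoo * (tm k - tm n)) +
     (Ev i n k - poo / qoo * (S i k - S i n)).
  by rewrite /y /Ev; field; rewrite gt_eqF.
(* The quadratic term covers long windows too, by [|1 - u| <= 1 - u + u^2] for every [u >= 0]. *)
pose Xy n k := qoo ^+ 2 * (`|y n| * ((tm k - tm n) * (tm k - tm n))) +
   `|Ev i n k - poo / qoo * (S i k - S i n)|.
suff : `|y n| @[n --> \oo] --> (0 : R).
  by move/cvgrPdist_le => H; apply/cvgrPdist_le => e /H; apply: filterS => n;
    rewrite !sub0r !normrN normr_id.
apply: (@lyapunov_descent _ _ tm_nd tm_oo tm_step (fun n => `|y n|) _ Xy qoo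
   (B + `|poo / qoo| * B)) => //.
- by move=> n; rewrite normr_id.
- apply: winOD.
    have y' n : `| `|y n| | <= B + `|poo / qoo| * B by rewrite normr_id.
    exact: (winO_Zl _ (winO_bdd_n y' (winOM (winO_time tm_nd) (winO_time tm_nd)))).
  by apply: winO_norm; apply: winOB => //; exact: winO_Zl.
- move=> n k nk; have t0 : 0 <= tm k - tm n by rewrite subr_ge0 tm_nd.
  rewrite (EyE n k) (le_trans (ler_normD _ _))// /Xy addrA lerD2r normrM.
  move: t0; set t := tm k - tm n => t0.
  have -> : `|y n| - qoo * t * `|y n| + qoo ^+ 2 * (`|y n| * (t * t)) =
    `|y n| * (1 - qoo * t + (qoo * t) ^+ 2) by ring.
  rewrite ler_wpM2l// ler_norml.
  have qt : 0 <= qoo * t by rewrite mulr_ge0// ltW.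
  have := sqr_ge0 (qoo * t - 1); have := sqr_ge0 (qoo * t); rewrite sqrrB; lra.
(* Any level strictly inside a positive interval is a barrier, as [W] and [D] coincide; values below
   0 are never taken. *)
- move=> a b ab; have [b0|b0] := leP b 0.
    exists ((a + b) / 2), ((b - a) / 4); split; [lra|lra|lra|].
    move=> n; rewrite ler_norml => /andP[_]; have := normr_ge0 (y n); lra.
  have a'b : Num.max a 0 < b by rewrite gt_max ab.
  have aa' : a <= Num.max a 0 by rewrite le_max lexx.
  have a'0 : 0 <= Num.max a 0 by rewrite le_max lexx orbT.
  move: a'b aa' a'0; set a' := Num.max a 0 => a'b aa' a'0.
  exists ((a' + b) / 2), ((b - a') / 4); split; [lra|lra|lra|].
  by move=> n; rewrite ler_norml => /andP[+ _]; lra.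
Qed.

Lemma dynamics_cvg : [/\ forall i, m i n @[n --> \oo] --> (0 : R),
  forall i, G i n @[n --> \oo] --> (0 : R) &
  forall i, v i n - poo / qoo * S i n @[n --> \oo] --> (0 : R)].
Proof.
by split => i; [exact: dynamics_m|exact: dynamics_G|exact: dynamics_v].
Qed.

End Dynamics.

(** * Regularity of the mean gradient and of the second moment *)

Section RowVectors.
Context {R : realType} {n : nat}.
Implicit Types u v : 'rV[R]_n.

Lemma row_coord_le u i : `|u 0 i| <= `|u|.
Proof.
have [//|H] := leP `|u 0 i| `|u|.
have : ball u `|u 0 i| 0 by rewrite -ball_normE /ball_/= subr0.
by case=> _ /(_ 0 i); rewrite mxE -ball_normE /ball_/= subr0 ltxx.
Qed.

Lemma row_norm_lt u (e : R) : 0 < e -> (forall i, `|u 0 i| < e) -> `|u| < e.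
Proof.
move=> e0 H; have : ball u e 0.
  by split => // i j; rewrite mxE -ball_normE /ball_/= subr0 ord1.
by rewrite -ball_normE /ball_/= subr0.
Qed.

(** It dominates both the Euclidean norm of the hypotheses and the sup norm of the topology, and it
    splits over coordinates. *)
Definition norm1 u : R := \sum_i `|u 0 i|.

Lemma norm1_ge0 u : 0 <= norm1 u.
Proof. exact: sumr_ge0. Qed.

Lemma norm1Z (a : R) u : norm1 (a *: u) = `|a| * norm1 u.
Proof. by rewrite /norm1 mulr_sumr; apply: eq_bigr => i _; rewrite mxE normrM. Qed.

Lemma norm1_le_norm u : norm1 u <= n%:R * `|u|.
Proof.
apply: (@le_trans _ _ (\sum_(i < n) `|u|)).
  by apply: ler_sum => i _; exact: row_coord_le.
by rewrite sumr_const card_ord mulr_natl.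
Qed.

Lemma norm1_coord u i : `|u 0 i| <= norm1 u.
Proof. by rewrite /norm1 (bigD1 i)//= lerDl sumr_ge0. Qed.

Lemma norm_le_norm1 u : `|u| <= norm1 u.
Proof.
apply/ler_addgt0Pr => e e0; apply/ltW/row_norm_lt => [|i].
  by rewrite ltr_wpDl// norm1_ge0.
by apply: (le_lt_trans (norm1_coord u i)); rewrite ltrDl.
Qed.

Lemma enorm_coord u i : `|u 0 i| <= enorm u.
Proof.
rewrite -sqrtr_sqr; apply: ler_wsqrtr; rewrite (bigD1 i)//= lerDl.
by apply: sumr_ge0 => j _; exact: sqr_ge0.
Qed.

Lemma enorm_ge0 u : 0 <= enorm u.
Proof. exact: sqrtr_ge0. Qed.

Lemma enorm_le_norm1 u : enorm u <= norm1 u.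
Proof.
rewrite -(ger0_norm (norm1_ge0 u)) -sqrtr_sqr; apply: ler_wsqrtr.
rewrite expr2 {1}/norm1 mulr_suml; apply: ler_sum => i _.
rewrite -real_normK ?num_real// expr2 ler_wpM2l//; exact: norm1_coord.
Qed.

Lemma dotv_le u v : `|dotv u v| <= enorm u * norm1 v.
Proof.
apply: (le_trans (ler_norm_sum _ _ _)); rewrite mulr_sumr.
by apply: ler_sum => i _; rewrite normrM ler_wpM2r// enorm_coord.
Qed.

Lemma measurable_coord (i : 'I_n) :
  measurable_fun setT (fun y : borel_rV R n => (y : 'rV[R]_n) 0 i).
Proof.
apply: (measurability _ (RGenOInfty.measurableE R)) => _ [_ [a ->] <-].
rewrite setTI; apply: sub_sigma_algebra.
apply: open_comp; last exact: interval_open.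
by move=> x _; exact: coord_continuous.
Qed.

(** An open set is a countable union of cubes with rational centre and radius, and the preimage of a
    cube is a finite intersection of coordinate preimages. *)
Lemma measurable_row d (T : measurableType d) (g : T -> borel_rV R n) :
  (forall i, measurable_fun setT (fun t => (g t : 'rV[R]_n) 0 i)) ->
  measurable_fun setT g.
Proof.
move=> mg; apply: (@measurability _ _ T (borel_rV R n) setT g (@open 'rV[R]_n) (erefl _)).
move=> _ [U oU <-]; rewrite setTI.
pose box (c : 'rV[rat]_n * rat) : set 'rV[R]_n :=
  [set y | forall i, `|y 0 i - ratr (c.1 0 i)| < ratr c.2].
have -> : g @^-1` U = \bigcup_c (if `[< box c `<=` U >] then g @^-1` (box c) else set0).
  rewrite eqEsubset; split => [t Ut|t [c _]]; last first.
    by case: ifPn => // /asboolP cU /cU.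
  have /nbhs_ballP[e /= e0 eU] : nbhs (g t : 'rV[R]_n) U.
    by rewrite nbhsE; exists U.
  have [q qe] : exists q : rat, ratr q \in `](0:R), (e / 2)[.
    by apply: rat_in_itvoo; rewrite divr_gt0.
  move: qe; rewrite in_itv/= => /andP[q0 q2].
  have ex i : exists r : rat, ratr r \in `](g t : 'rV[R]_n) 0 i - ratr q, (g t : 'rV[R]_n) 0 i + ratr q[.
    by apply: rat_in_itvoo; rewrite ltrBlDr -addrA ltrDl addr_gt0.
  have [c cP] := choice ex.
  exists (\row_i c i, q) => //; case: ifPn => [_|].
    by move=> i /=; rewrite mxE; have := cP i; rewrite in_itv/= ltr_norml; lra.
  move/asboolP => H; exfalso; apply: H => y Hy; apply: eU.
  rewrite -ball_normE /ball_/=; apply: row_norm_lt => // i.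
  have := Hy i; have := cP i; rewrite !mxE in_itv/= !ltr_norml; lra.
apply: countable_bigcupT_measurable; first exact: countableP.
move=> c; case: ifPn => // _.
have -> : g @^-1` box c = \bigcap_(i : 'I_n)
   ((fun t => (g t : 'rV[R]_n) 0 i) @^-1` [set y | `|y - ratr (c.1 0 i)| < ratr c.2]).
  by rewrite eqEsubset; split => [t H i _|t H i]; [exact: H|exact: (H i)].
apply: fin_bigcap_measurable => // i _; rewrite -[X in measurable X]setTI.
apply: mg => //; apply: open_measurable.
rewrite (_ : [set y | _] = ball (ratr (c.1 0 i) : R) (ratr c.2)); first exact: ball_open.
by rewrite -ball_normE; apply/seteqP; split => y; rewrite /ball_/= distrC.
Qed.

End RowVectors.

Section DirectionalDerivative.
Context {R : realType} {d : nat}.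
Implicit Types (g : 'rV[R]_d -> R) (u v x : 'rV[R]_d).

Lemma derive_dotv g x v : differentiable g x -> 'D_v g x = dotv (grad g x) v.
Proof.
move=> dg; rewrite deriveE// {1}(row_sum_delta v) linear_sum/=.
by apply: eq_bigr => i _; rewrite linearZ/= mxE deriveE// mulrC.
Qed.

Lemma is_derive_line g u v (t : R) : differentiable g (v + t *: u) ->
  is_derive t 1 (fun t => g (v + t *: u)) (dotv (grad g (v + t *: u)) u).
Proof.
move=> dg; have Dg : derivable g (v + t *: u) u by exact: diff_derivable.
have E : (fun h : R => h^-1 *: (((fun t => g (v + t *: u)) \o shift t) (h *: 1) -
    g (v + t *: u))) = (fun h : R => h^-1 *: ((g \o shift (v + t *: u)) (h *: u) -
    g (v + t *: u))).
  apply/funext => h /=; congr (_ *: (g _ - _)).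
  by rewrite [h *: 1]mulr1 scalerDl addrCA.
apply: DeriveDef.
  by rewrite /derivable E.
by rewrite /derive E -derive_dotv.
Qed.

(** The scalar mean value theorem on the segment; continuity of the gradient is not assumed. *)
Lemma segment_mvt g u v : (forall x, differentiable g x) ->
  exists2 t : R, 0 <= t <= 1 & g u - g v = dotv (grad g (v + t *: (u - v))) (u - v).
Proof.
move=> dg.
have D (t : R) : is_derive t 1 (fun t => g (v + t *: (u - v)))
    (dotv (grad g (v + t *: (u - v))) (u - v)) by exact: is_derive_line.
have [|t + E] := @MVT R (fun t => g (v + t *: (u - v))) _ 0 1 ltr01
  (fun t _ => D t).
  apply: derivable_within_continuous => t _.
  by have [] := D t.
rewrite in_itv/= => /andP[t0 t1]; exists t; first by rewrite !ltW.
by move: E; rewrite scale0r scale1r addr0 subr0 mulr1 [v + (u - v)]addrC subrK.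
Qed.

End DirectionalDerivative.

Section RealIntegrals.
Context {d : measure_display} {T : measurableType d} {R : realType}
  (mu : probability T R).

Lemma Rintegral_sumr (I : Type) (s : seq I) (h : I -> T -> R) :
  (forall i, mu.-integrable setT (EFin \o h i)) ->
  mu.-integrable setT (EFin \o (fun x => \sum_(i <- s) h i x)) /\
  \int[mu]_x (\sum_(i <- s) h i x) = \sum_(i <- s) \int[mu]_x h i x.
Proof.
move=> hi; elim: s => [|a s [IH1 IH2]].
  split; last first.
    by rewrite big_nil; under eq_Rintegral do rewrite big_nil; rewrite Rintegral_cst// mul0r.
  apply: (eq_integrable measurableT (cst 0%E)); last exact: integrable0.
  by move=> x _ /=; rewrite big_nil.
have E : (fun x => \sum_(i <- a :: s) h i x) = (fun x => h a x + \sum_(i <- s) h i x).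
  by apply/funext => x; rewrite big_cons.
rewrite E; split; first exact: (integrableD measurableT (hi a) IH1).
by rewrite RintegralD// IH2 big_cons.
Qed.

Lemma Rintegral_dominated (h k : T -> R) (c : R) : 0 <= c ->
  mu.-integrable setT (EFin \o h) -> mu.-integrable setT (EFin \o k) ->
  (forall x, `|h x| <= k x * c) -> `|\int[mu]_x h x| <= (\int[mu]_x k x) * c.
Proof.
move=> c0 hi ki hk; apply: (le_trans (le_normr_Rintegral measurableT hi)).
rewrite -RintegralZr//; apply: le_Rintegral => //.
  exact: integrable_norm.
by have := integrableZr measurableT c ki.
Qed.

Lemma normr_le_sqr (a : R) : `|a| <= 1 + a ^+ 2.
Proof.
rewrite -[X in _ + X]real_normK ?num_real//.
have := sqr_ge0 (`|a| - 1); rewrite sqrrB; have := sqr_ge0 `|a|; lra.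
Qed.

End RealIntegrals.

Section Regularity.
Context {R : realType} {d : nat} {dX : measure_display} {Xi : measurableType dX}
  (mu : probability Xi R) (f : 'rV[R]_d -> Xi -> R).
Hypothesis f_meas : measurable_fun setT (fun y : borel_rV R d * Xi => f y.1 y.2).
Hypothesis f_int : forall x, mu.-integrable setT (EFin \o f x).
Hypothesis f_diff : forall s x, differentiable (f^~ s) x.

(** A partial derivative is the pointwise limit of difference quotients with steps [1 / (m + 1)],
    each jointly measurable. *)
Lemma gradf_measurable (i : 'I_d) :
  measurable_fun setT (fun y : borel_rV R d * Xi => gradf f y.1 y.2 0 i).
Proof.
pose h (m : nat) (y : borel_rV R d * Xi) := (m.+1%:R : R) *
  (f ((y.1 : 'rV[R]_d) + (m.+1%:R)^-1 *: delta_mx 0 i) y.2 - f y.1 y.2).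
apply: (@measurable_fun_cvg _ _ _ setT h) => [m|[x s] _].
  apply: measurable_funM => //; apply: measurable_funB => //.
  pose sh (y : borel_rV R d * Xi) : borel_rV R d :=
    (y.1 : 'rV[R]_d) + (m.+1%:R)^-1 *: delta_mx 0 i.
  suff msh : measurable_fun setT (fun y => (sh y, y.2)) by exact: (measurableT_comp f_meas msh).
  apply: measurable_fun_pair => //; apply: measurable_row => j.
  rewrite [X in measurable_fun _ X](_ : _ = fun y : borel_rV R d * Xi =>
    (y.1 : 'rV[R]_d) 0 j + (m.+1%:R^-1 *: delta_mx 0 i : 'rV[R]_d) 0 j); last first.
    by apply/funext => y; rewrite /sh mxE.
  apply: measurable_funD => //.
  exact: (measurableT_comp (measurable_coord j) measurable_fst).
have /cvgr_dnbhsP : derivable (f^~ s) x (delta_mx 0 i) by exact: diff_derivable.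
move=> /(_ (fun m => m.+1%:R^-1)) H.
rewrite /gradf/grad mxE.
apply: cvg_trans (H _); last first.
  by split; [move=> m; rewrite invr_eq0 pnatr_eq0|exact: cvg_harmonic].
apply: near_eq_cvg; near=> m; rewrite /h /= invrK.
by rewrite [_ *: _ + x]addrC.
Unshelve. all: by end_near. Qed.

Hypothesis gradf2_int : forall x (i : 'I_d),
  mu.-integrable setT (fun s => (sqv (gradf f x s) 0 i)%:E).

(** On a probability space second moments control first ones, through [|a| <= 1 + a^2]. *)
Lemma gradf_integrable x i :
  mu.-integrable setT (EFin \o (fun s => gradf f x s 0 i)).
Proof.
have mg : measurable_fun setT (fun s => gradf f x s 0 i).
  exact: (measurableT_comp (gradf_measurable i) (pair1_measurable (x : borel_rV R d))).
have i1 : mu.-integrable setT (fun s => (1 + sqv (gradf f x s) 0 i)%:E).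
  exact: (integrableD measurableT (finite_measure_integrable_cst mu 1 measurableT) (gradf2_int x i)).
apply: (le_integrable measurableT _ _ i1); first exact/measurable_EFinP.
move=> s _ /=; have -> : sqv (gradf f x s) 0 i = gradf f x s 0 i ^+ 2 by rewrite mxE.
by rewrite lee_fin [leRHS]ger0_norm ?normr_le_sqr// addr_ge0// sqr_ge0.
Qed.

Definition mean_grad (x : 'rV[R]_d) : 'rV[R]_d :=
  \row_i \int[mu]_s gradf f x s 0 i.

Hypothesis f_lip : exists kappa : 'rV[R]_d -> Xi -> R,
    [/\ measurable_fun setT (fun y : borel_rV R d * Xi => kappa y.1 y.2),
        forall x s, 0 <= kappa x s &
        forall x, mu.-integrable setT (EFin \o kappa x) /\
          exists2 e : R, 0 < e & forall s u v, eball x e u -> eball x e v ->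
            Num.max (enorm (gradf f u s - gradf f v s))
                    (enorm (sqv (gradf f u s) - sqv (gradf f v s)))
            <= kappa x s * enorm (u - v)].

(** For each [s] the mean value theorem bounds the Taylor remainder by [kappa] times the squared
    distance, and this bound is integrated; no differentiation under the integral occurs. The third
    estimate serves twice, to identify the gradient of [F] and as descent inequality. *)
Lemma local_regularity x : exists e K : R, [/\ 0 < e, 0 <= K &
  forall u v, `|u - x| < e -> `|v - x| < e ->
  [/\ forall i, `|mean_grad u 0 i - mean_grad v 0 i| <= K * norm1 (u - v),
      forall i, `|objS mu f u 0 i - objS mu f v 0 i| <= K * norm1 (u - v) &
      `|objF mu f u - objF mu f v - dotv (mean_grad v) (u - v)| <=
        K * norm1 (u - v) ^+ 2]].
Proof.
have [k [_ k0 /(_ x)[ki [e0 e0_gt0 Hk]]]] := f_lip.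
(* The conclusion uses sup-norm balls; dividing by [d + 1] puts them inside the Euclidean ball of
   radius [e0]. *)
exists (e0 / (d%:R + 1)), (\int[mu]_s k x s); split.
- by rewrite divr_gt0// ltr_wpDl.
- exact: Rintegral_ge0.
have sub u : `|u - x| < e0 / (d%:R + 1) -> eball x e0 u.
  move=> ux; apply: (le_lt_trans (enorm_le_norm1 _)).
  apply: (le_lt_trans (norm1_le_norm _)).
  apply: (@le_lt_trans _ _ ((d%:R + 1) * `|u - x|)).
    by rewrite ler_wpM2r// lerDl.
  by rewrite mulrC -ltr_pdivlMr// ltr_wpDl.
move=> u v ux vx; have Hu := sub _ ux; have Hv := sub _ vx.
have K2 s : enorm (gradf f u s - gradf f v s) <= k x s * norm1 (u - v) /\
    enorm (sqv (gradf f u s) - sqv (gradf f v s)) <= k x s * norm1 (u - v).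
  have := Hk s u v Hu Hv; rewrite ge_max => /andP[H1 H2].
  have H3 : k x s * enorm (u - v) <= k x s * norm1 (u - v).
    by rewrite ler_wpM2l// enorm_le_norm1.
  by split; [exact: le_trans H1 H3|exact: le_trans H2 H3].
split.
- move=> i; rewrite !mxE -RintegralB//; try exact: gradf_integrable.
  apply: Rintegral_dominated => //; first exact: norm1_ge0.
    by have := integrableB measurableT (gradf_integrable u i) (gradf_integrable v i).
  move=> s; have [H _] := K2 s; apply: le_trans H.
  by have := enorm_coord (gradf f u s - gradf f v s) i; rewrite !mxE.
- move=> i; rewrite !mxE.
  have -> : fine 'E_mu[fun s => sqv (gradf f u s) 0 i] - 
     fine 'E_mu[fun s => sqv (gradf f v s) 0 i] =
     \int[mu]_s sqv (gradf f u s) 0 i - \int[mu]_s sqv (gradf f v s) 0 i.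
    by rewrite !unlock.
  rewrite -RintegralB//; try exact: gradf2_int.
  apply: Rintegral_dominated => //; first exact: norm1_ge0.
    by have := integrableB measurableT (gradf2_int u i) (gradf2_int v i).
  move=> s; have [_ H] := K2 s; apply: le_trans H.
  by have := enorm_coord (sqv (gradf f u s) - sqv (gradf f v s)) i; rewrite !mxE.
- have hi i : mu.-integrable setT (EFin \o (fun s => gradf f v s 0 i * (u - v) 0 i)).
    by have := integrableZr measurableT ((u - v) 0 i) (gradf_integrable v i).
  have [di dE] := Rintegral_sumr (index_enum _) hi.
  have -> : objF mu f u - objF mu f v - dotv (mean_grad v) (u - v) =
    \int[mu]_s (f u s - f v s - dotv (gradf f v s) (u - v)).
    have duv := integrableB measurableT (f_int u) (f_int v).
    rewrite RintegralB//= RintegralB// /objF unlock; congr (_ - _ - _).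
    rewrite dE; apply: eq_bigr => i _; rewrite mxE RintegralZr//.
    exact: gradf_integrable.
  have -> : norm1 (u - v) ^+ 2 = norm1 (u - v) * norm1 (u - v) by [].
  rewrite mulrA -mulrA.
  apply: Rintegral_dominated => //; first by rewrite mulr_ge0 ?norm1_ge0.
    by have := integrableB measurableT (integrableB measurableT (f_int u) (f_int v)) di.
  move=> s; have [t /andP[t0 t1] ->] := segment_mvt u v (f_diff s).
  set w := v + t *: (u - v).
  have Hw : eball x e0 w.
    apply: sub; rewrite /w.
    have -> : v + t *: (u - v) - x = t *: (u - x) + (1 - t) *: (v - x).
      by rewrite !scalerBr !scalerBl !scale1r; apply/rowP => j; rewrite !mxE; ring.
    apply: (le_lt_trans (ler_normD _ _)); rewrite !normrZ (ger0_norm t0).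
    have t1' : 0 <= 1 - t by rewrite subr_ge0.
    rewrite (ger0_norm t1'); move: ux vx.
    set A := `|u - x|; set B := `|v - x|; set e := e0 / _ => ux vx.
    have [->|tn0] := eqVneq t 0; first by lra.
    have tp : 0 < t by rewrite lt_neqAle eq_sym tn0.
    have H1 : t * A < t * e by rewrite ltr_pM2l.
    have H2 : (1 - t) * B <= (1 - t) * e by rewrite ler_wpM2l// ltW.
    lra.
  have -> : dotv (grad (f^~ s) w) (u - v) - dotv (gradf f v s) (u - v) =
     dotv (gradf f w s - gradf f v s) (u - v).
    by rewrite /dotv -sumrB; apply: eq_bigr => i _; rewrite !mxE mulrBl.
  apply: (le_trans (dotv_le _ _)); rewrite mulrA ler_wpM2r ?norm1_ge0//.
  have := Hk s w v Hw Hv; rewrite ge_max => /andP[H1 _].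
  apply: (le_trans H1); rewrite ler_wpM2l//.
  apply: (le_trans (enorm_le_norm1 _)).
  have -> : w - v = t *: (u - v) by rewrite /w addrC addKr.
  by rewrite norm1Z ger0_norm// ler_piMl ?norm1_ge0.
Qed.

End Regularity.

Section RowVectorAnalysis.
Context {R : realType} {d : nat}.
Implicit Types u v : 'rV[R]_d.

Lemma dotvZr (a : R) u v : dotv u (a *: v) = a * dotv u v.
Proof. by rewrite /dotv mulr_sumr; apply: eq_bigr => i _; rewrite mxE mulrCA. Qed.

Lemma dotv_delta u (i : 'I_d) : dotv u (delta_mx 0 i) = u 0 i.
Proof.
rewrite /dotv (bigD1 i)//= mxE !eqxx mulr1 big1 ?addr0// => j /negbTE ji.
by rewrite mxE ji andbF mulr0.
Qed.

Lemma norm1_delta (i : 'I_d) : norm1 (delta_mx 0 i : 'rV[R]_d) = 1.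
Proof.
rewrite /norm1 (bigD1 i)//= mxE !eqxx normr1 big1 ?addr0// => j /negbTE ji.
by rewrite mxE ji andbF normr0.
Qed.

Lemma norm1_sq u : norm1 u ^+ 2 <= d%:R * \sum_i u 0 i ^+ 2.
Proof.
rewrite expr2 {1}/norm1 mulr_suml.
apply: (@le_trans _ _ (\sum_i \sum_j (u 0 i ^+ 2 + u 0 j ^+ 2) / 2)).
  apply: ler_sum => i _; rewrite /norm1 mulr_sumr; apply: ler_sum => j _.
  rewrite -(real_normK (num_real (u 0 i))) -(real_normK (num_real (u 0 j))).
  have := sqr_ge0 (`|u 0 i| - `|u 0 j|); rewrite sqrrB; lra.
have E i : \sum_j (u 0 i ^+ 2 + u 0 j ^+ 2) / 2 =
    (d%:R * u 0 i ^+ 2 + \sum_j u 0 j ^+ 2) / 2.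
  by rewrite -mulr_suml big_split/= sumr_const card_ord mulr_natl.
rewrite (eq_bigr _ (fun i _ => E i)) -mulr_suml big_split/= sumr_const card_ord.
rewrite -mulr_sumr -mulr_natl; lra.
Qed.

Lemma row_continuousP (g : 'rV[R]_d -> R) x : {for x, continuous g} <->
  forall r : R, 0 < r -> exists2 e : R, 0 < e &
    forall u, `|u - x| < e -> `|g u - g x| <= r.
Proof.
apply: (iff_trans (@cvgrPdist_le R _ _ (nbhs (x : 'rV[R]_d)) _ g (g x))).
split=> H r r0.
  have /nbhs_ballP[e /= e0 He] := H r r0; exists e => // u ux.
  by rewrite distrC; apply: He; rewrite -ball_normE /ball_/= distrC.
have [e e0 He] := H r r0; apply/nbhs_ballP; exists e => //= u.
by rewrite -ball_normE /ball_/= distrC => /He; rewrite distrC.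
Qed.

Lemma lipschitz_at_continuous (g : 'rV[R]_d -> R) x (e C : R) : 0 < e -> 0 <= C ->
  (forall u, `|u - x| < e -> `|g u - g x| <= C * norm1 (u - x)) ->
  {for x, continuous g}.
Proof.
move=> e0 C0 H; apply/row_continuousP => r r0.
pose D := C * d%:R + 1.
have D0 : 0 < D by rewrite ltr_wpDl// mulr_ge0.
exists (Num.min e (r / D)) => [|u]; first by rewrite lt_min e0 divr_gt0.
rewrite lt_min => /andP[xu xr]; apply: (le_trans (H _ xu)).
apply: (@le_trans _ _ (D * `|u - x|)).
  rewrite mulrDl mul1r; have := normr_ge0 (u - x).
  have := ler_wpM2l C0 (norm1_le_norm (u - x)); rewrite mulrA; lra.
by rewrite mulrC -ler_pdivlMr// ltW.
Qed.

(* The radius and the bound are uniform on a compact set as soon as they are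
   locally uniform. *)
Lemma compact_uniform (A : set 'rV[R]_d) (P : nat -> 'rV[R]_d -> Prop) :
  compact A ->
  (forall x, A x -> exists (e : R) (N : nat), 0 < e /\
     forall u n, `|u - x| < e -> (N <= n)%N -> P n u) ->
  exists N : nat, forall u, A u -> P N u.
Proof.
move=> /compact_near_coveringP cA H.
suff [N _ HN] : \forall n \near \oo, A `<=` P n by exists N => u; exact: (HN N (leqnn N)).
apply: cA => x Ax.
have [e [N [e0 HN]]] := H x Ax.
exists (ball x e, [set n | (N <= n)%N]) => /=.
  by split; [exact: nbhsx_ballx|exists N].
move=> [u n] [/= xu Nn]; apply: HN => //.
by move: xu; rewrite -ball_normE /ball_/= distrC.
Qed.

Lemma compact_continuous_bounded (A : set 'rV[R]_d) (g : 'rV[R]_d -> R) :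
  compact A -> continuous g -> exists B : R, forall u, A u -> `|g u| <= B.
Proof.
move=> cA cg; have [x Ax|N HN] := @compact_uniform A (fun n u => `|g u| <= n%:R) cA.
  have [e e0 He] := iffLR (row_continuousP g x) (cg x) 1 ltr01.
  exists e, (Num.bound (`|g x| + 1)); split => // u n ux Nn.
  have := He u ux; rewrite distrC.
  have : `|g x| + 1 <= n%:R.
    apply: (@le_trans _ _ (Num.bound (`|g x| + 1))%:R); last by rewrite ler_nat.
    by apply/ltW/archi_boundP; rewrite addr_ge0.
  have := ler_normB (g x) (g x - g u).
  have -> : g x - (g x - g u) = g u by ring.
  lra.
by exists N%:R.
Qed.

End RowVectorAnalysis.

(** * Uniform regularity on compact sets *)

Section CompactRegularity.
Context {R : realType} {d : nat} (F : 'rV[R]_d -> R) (G S : 'rV[R]_d -> 'rV[R]_d).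
Hypothesis loc : forall x, exists e K : R, [/\ 0 < e, 0 <= K &
  forall u v, `|u - x| < e -> `|v - x| < e ->
  [/\ forall i, `|G u 0 i - G v 0 i| <= K * norm1 (u - v),
      forall i, `|S u 0 i - S v 0 i| <= K * norm1 (u - v) &
      `|F u - F v - dotv (G v) (u - v)| <= K * norm1 (u - v) ^+ 2]].

(** The quadratic remainder vanishes in the difference quotients along the coordinate directions. *)
Lemma grad_of_taylor x : grad F x = G x.
Proof.
have [e [K [e0 K0 H]]] := loc x.
apply/rowP => i; rewrite mxE; apply: cvg_lim => //.
apply/cvgrPdist_le => r r0; near=> h.
have hn0 : h != 0 by near: h; exact: nbhs_dnbhs_neq.
have he : `|h| < e by near: h; exact: dnbhs0_lt.
have hr : `|h| < r / (K + 1).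
  by near: h; apply: dnbhs0_lt; rewrite divr_gt0// ltr_wpDl.
have uE : h *: delta_mx 0 i + x - x = h *: (delta_mx 0 i : 'rV[R]_d).
  by rewrite addrK.
have n1E : norm1 (h *: (delta_mx 0 i : 'rV[R]_d)) = `|h|.
  by rewrite norm1Z norm1_delta mulr1.
have [||_ _] := H (h *: delta_mx 0 i + x) x.
- rewrite uE; apply: le_lt_trans he; rewrite -n1E; exact: norm_le_norm1.
- by rewrite subrr normr0.
rewrite uE n1E dotvZr dotv_delta => HF.
have -> : G x 0 i - h^-1 *: ((F \o shift x) (h *: delta_mx 0 i) - F x) =
   - (h^-1 * (F (h *: delta_mx 0 i + x) - F x - h * G x 0 i)).
  rewrite mulrBr mulKf// opprB; congr (_ - _).
rewrite normrN normrM normfV ler_pdivrMl ?normr_gt0//.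
apply: (le_trans HF); rewrite expr2 mulrCA ler_wpM2l//.
apply: (@le_trans _ _ ((K + 1) * `|h|)); first by rewrite ler_wpM2r// lerDl.
by rewrite mulrC -ler_pdivlMr ?ltr_wpDl// ltW.
Unshelve. all: by end_near. Qed.

Lemma taylor_continuous x :
  [/\ {for x, continuous F}, forall i, {for x, continuous (fun u => G u 0 i)} &
     forall i, {for x, continuous (fun u => S u 0 i)}].
Proof.
have [e [K [e0 K0 H]]] := loc x.
have xx : `|x - x| < e by rewrite subrr normr0.
split=> [|i|i].
- have m0 : 0 < Num.min e (1 / (d%:R + 1)) by rewrite lt_min e0 divr_gt0// ltr_wpDl.
  have C0 : 0 <= enorm (G x) + K by rewrite addr_ge0// enorm_ge0.
  apply: (lipschitz_at_continuous m0 C0) => u; rewrite lt_min => /andP[ue u1].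
  have [_ _ HF] := H u x ue xx.
  have n1 : norm1 (u - x) <= 1.
    apply: (le_trans (norm1_le_norm _)); move: u1.
    rewrite ltr_pdivlMr ?ltr_wpDl// mulrDr mulr1 mulrC.
    have := normr_ge0 (u - x); lra.
  have n0 := norm1_ge0 (u - x).
  rewrite -(subrK (dotv (G x) (u - x)) (F u - F x)) mulrDl addrC.
  apply: (le_trans (ler_normD _ _)); apply: lerD; first exact: dotv_le.
  apply: (le_trans HF); rewrite ler_wpM2l// expr2 ler_piMr//.
- apply: (lipschitz_at_continuous e0 K0) => u ue.
  by have [-> _ _] := H u x ue xx.
- apply: (lipschitz_at_continuous e0 K0) => u ue.
  by have [_ -> _] := H u x ue xx.
Qed.

(** [A] need not be convex, so local bounds cannot be chained along segments. Close pairs are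
    covered by a uniform radius; for the others, the bound on the values is divided by the minimal
    distance. *)
Lemma compact_regularity (A : set 'rV[R]_d) : compact A ->
  exists B L : R, [/\ 0 <= L,
  forall u, A u -> [/\ `|F u| <= B, forall i, `|G u 0 i| <= B &
     forall i, `|S u 0 i| <= B] &
  forall u v, A u -> A v ->
  [/\ forall i, `|G u 0 i - G v 0 i| <= L * norm1 (u - v),
      forall i, `|S u 0 i - S v 0 i| <= L * norm1 (u - v) &
      `|F u - F v - dotv (G v) (u - v)| <= L * norm1 (u - v) ^+ 2]].
Proof.
move=> cA.
have [BF HBF] := compact_continuous_bounded cA (fun x => let: And3 c _ _ := taylor_continuous x in c).
have bG i := compact_continuous_bounded cA (fun x => let: And3 _ c _ := taylor_continuous x in c i).
have bS i := compact_continuous_bounded cA (fun x => let: And3 _ _ c := taylor_continuous x in c i).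
have [BG HBG] := choice bG; have [BS HBS] := choice bS.
pose B := `|BF| + \sum_i `|BG i| + \sum_i `|BS i|.
have sum_ge (g : 'I_d -> R) i : g i <= \sum_j `|g j|.
  by apply: (le_trans (ler_norm _)); rewrite (bigD1 i)//= lerDl sumr_ge0.
have s0 (g : 'I_d -> R) : 0 <= \sum_j `|g j| by exact: sumr_ge0.
have FB u : A u -> `|F u| <= B.
  move=> Au; have := HBF u Au; have := ler_norm BF; have := s0 BG; have := s0 BS.
  rewrite /B; lra.
have GB u i : A u -> `|G u 0 i| <= B.
  move=> Au; have := HBG i u Au; have := normr_ge0 BF; have := sum_ge BG i; have := s0 BS.
  rewrite /B; lra.
have SB u i : A u -> `|S u 0 i| <= B.
  move=> Au; have := HBS i u Au; have := normr_ge0 BF; have := s0 BG; have := sum_ge BS i.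
  rewrite /B; lra.
have B0 : 0 <= B by rewrite !addr_ge0.
(* One integer is at once the constant and the inverse radius, as [compact_uniform] requires. *)
pose P (n : nat) u := forall v, `|u - v| < n.+1%:R^-1 ->
  [/\ forall i, `|G u 0 i - G v 0 i| <= n%:R * norm1 (u - v),
      forall i, `|S u 0 i - S v 0 i| <= n%:R * norm1 (u - v) &
      `|F u - F v - dotv (G v) (u - v)| <= n%:R * norm1 (u - v) ^+ 2].
have [x Ax|N HN] := @compact_uniform _ _ A P cA.
  have [e [K [e0 K0 H]]] := loc x.
  have e2 : 0 < e / 2 by rewrite divr_gt0.
  have e20 : 0 <= (e / 2)^-1 by rewrite invr_ge0 ltW.
  exists (e / 2), (maxn (Num.bound K) (Num.bound (e / 2)^-1)); split => //.
  move=> u n ux; rewrite geq_max => /andP[n1 n2] v uv.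
  have Kn : K <= n%:R.
    apply: (@le_trans _ _ (Num.bound K)%:R); last by rewrite ler_nat.
    exact/ltW/archi_boundP.
  have vx : `|v - x| < e.
    have -> : v - x = - (u - v) + (u - x) by rewrite opprB addrA subrK.
    apply: (le_lt_trans (ler_normD _ _)); rewrite normrN.
    suff : `|u - v| <= e / 2 by move: ux; lra.
    apply/ltW/(lt_le_trans uv); rewrite -[leRHS]invrK lef_pV2 ?posrE ?invr_gt0//.
    apply: (@le_trans _ _ (Num.bound (e / 2)^-1)%:R); first exact/ltW/archi_boundP.
    by rewrite ler_nat leqW.
  have ux' : `|u - x| < e by lra.
  have n0 := norm1_ge0 (u - v).
  have [H1 H2 H3] := H u v ux' vx; split.
  - by move=> i; apply: (le_trans (H1 i)); rewrite ler_wpM2r.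
  - by move=> i; apply: (le_trans (H2 i)); rewrite ler_wpM2r.
  - by apply: (le_trans H3); rewrite ler_wpM2r// sqr_ge0.
pose M : R := N.+1%:R.
have M1 : 1 <= M by rewrite ler1n.
have NM : N%:R <= M by rewrite ler_nat.
have M0 : 0 <= M by lra.
(* For a distant pair [M * norm1 (u - v) >= 1], so [2 * B] pays for the difference of two values and
   [d * B] for the linear Taylor term. *)
pose C := 2 * B + d%:R * B.
have C0 : 0 <= C by rewrite addr_ge0// mulr_ge0.
exists B, (M + C * M ^+ 2).
have L0 : 0 <= M + C * M ^+ 2 by rewrite addr_ge0// mulr_ge0// sqr_ge0.
split => // [u Au|u v Au Av]; first by split; [exact: FB|move=> i; exact: GB|move=> i; exact: SB].
have n0 := norm1_ge0 (u - v).
have [uv|uv] := ltP `|u - v| N.+1%:R^-1.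
  have NL : N%:R <= M + C * M ^+ 2.
    have : 0 <= C * M ^+ 2 by rewrite mulr_ge0// sqr_ge0.
    by lra.
  have [H1 H2 H3] := HN u Au v uv; split.
  - by move=> i; apply: (le_trans (H1 i)); rewrite ler_wpM2r.
  - by move=> i; apply: (le_trans (H2 i)); rewrite ler_wpM2r.
  - by apply: (le_trans H3); rewrite ler_wpM2r// sqr_ge0.
have Mn : 1 <= M * norm1 (u - v).
  rewrite -ler_pdivrMl ?mulr1 ?ltr0Sn//.
  exact: (le_trans uv (norm_le_norm1 _)).
have diffB (g : 'rV[R]_d -> R) : `|g u| <= B -> `|g v| <= B ->
    `|g u - g v| <= (M + C * M ^+ 2) * norm1 (u - v).
  move=> gu gv; apply: (@le_trans _ _ (2 * B)).
    by have := ler_normB (g u) (g v); lra.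
  apply: (@le_trans _ _ (C * M ^+ 2 * norm1 (u - v))).
    rewrite expr2 mulrA -mulrA; apply: (@le_trans _ _ (C * M * 1)).
      rewrite mulr1; apply: (@le_trans _ _ (C * 1)); last by rewrite ler_wpM2l.
      by rewrite mulr1 /C lerDl mulr_ge0.
    by rewrite ler_wpM2l// mulr_ge0.
  by rewrite ler_wpM2r// lerDr.
split.
- by move=> i; apply: (diffB (fun u => G u 0 i)); exact: GB.
- by move=> i; apply: (diffB (fun u => S u 0 i)); exact: SB.
have dG : `|dotv (G v) (u - v)| <= B * norm1 (u - v).
  apply: (le_trans (ler_norm_sum _ _ _)); rewrite mulr_sumr.
  by apply: ler_sum => i _; rewrite normrM ler_wpM2r// GB.
have MM : 1 <= (M * norm1 (u - v)) ^+ 2 by rewrite exprn_ege1.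
have MM' : M * norm1 (u - v) <= (M * norm1 (u - v)) ^+ 2.
  by rewrite expr2 ler_peMl// mulr_ge0.
(* In dimension 0 no pair is distant; otherwise [B <= d * B]. *)
have [d0|d1] := posnP d.
  have n00 : norm1 (u - v) = 0.
    by rewrite /norm1 big1// => i _; have := ltn_ord i; rewrite {2}d0.
  by move: Mn; rewrite n00 mulr0 ler10.
have dR : 1 <= d%:R :> R by rewrite ler1n.
have nM : norm1 (u - v) <= M * norm1 (u - v) by rewrite ler_peMl.
have := ler_normB (F u - F v) (dotv (G v) (u - v)).
have := ler_normB (F u) (F v); have := FB u Au; have := FB v Av.
have h1 := ler_wpM2l B0 MM'; have h2 := ler_wpM2l B0 MM; have h3 := ler_wpM2l B0 nM.
have h4 : B * (M * norm1 (u - v)) ^+ 2 <= d%:R * B * (M * norm1 (u - v)) ^+ 2.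
  by rewrite ler_wpM2r ?sqr_ge0// ler_peMl.
have h5 : 0 <= M * norm1 (u - v) ^+ 2 by rewrite mulr_ge0// sqr_ge0.
have -> : (M + C * M ^+ 2) * norm1 (u - v) ^+ 2 =
  M * norm1 (u - v) ^+ 2 + 2 * (B * (M * norm1 (u - v)) ^+ 2)
   + d%:R * B * (M * norm1 (u - v)) ^+ 2 by rewrite /C; ring.
lra.
Qed.

End CompactRegularity.

(** * Martingale noise along the algorithm *)

Section Freezing.
Local Open Scope ereal_scope.
Context {R : realType} {dO dT dX : measure_display} {Om : measurableType dO}
  {T : measurableType dT} {Xi : measurableType dX}
  (P : probability Om R) (mu : probability Xi R).

(** The joint law is the product of the law of [X] and [mu], so Tonelli's theorem applies.
    Integration over a fresh sample thereby replaces conditional expectation given the past. *)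
Lemma independent_integral (X : Om -> T) (Y : Om -> Xi) :
  measurable_fun setT X -> measurable_fun setT Y ->
  (forall A B, measurable A -> measurable B ->
     P (X @^-1` A `&` Y @^-1` B) = P (X @^-1` A) * mu B) ->
  forall Phi : T * Xi -> \bar R, measurable_fun setT Phi -> (forall y, 0 <= Phi y) ->
  \int[P]_w Phi (X w, Y w) = \int[P]_w \int[mu]_s Phi (X w, s).
Proof.
move=> mX mY indep Phi mPhi Phi0.
have mXY : measurable_fun setT (fun w => (X w, Y w)) by exact: measurable_fun_pair.
pose X' : {mfun Om >-> T} := HB.pack X (isMeasurableFun.Build _ _ _ _ X mX).
pose XY : {mfun Om >-> (T * Xi)%type} :=
  HB.pack (fun w => (X w, Y w)) (isMeasurableFun.Build _ _ _ _ (fun w => (X w, Y w)) mXY).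
have E : forall A, measurable A ->
    (distribution P X' \x mu) A = distribution P XY A.
  by apply: product_measure_unique => A B mA mB; exact: indep.
have mPs : measurable_fun setT (fun x => \int[mu]_s Phi (x, s)).
  exact: (measurable_fun_fubini_tonelli_F (m2 := mu)).
transitivity (\int[distribution P XY]_y Phi y).
  by rewrite ge0_integral_distribution.
rewrite -(eq_measure_integral _ (fun A mA _ => E A mA)) fubini_tonelli1//.
rewrite ge0_integral_distribution// => x.
exact: integral_ge0.
Qed.

End Freezing.

Section Past.
Context {R : realType} {dO dX : measure_display} {Om : measurableType dO}
  {Xi : measurableType dX} (P : probability Om R) (mu : probability Xi R)
  (xi : nat -> {RV P >-> Xi}).

(** Indices start at 1 because step [k] of the algorithm consumes sample [k.+1]. *)
Definition cylinder (n : nat) (B : nat -> set Xi) : set Om :=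
  \bigcap_(k in [set k | (1 <= k <= n)%N]) xi k @^-1` B k.

Lemma set_iota1 n : [set` iota 1 n] = [set k | (1 <= k <= n)%N].
Proof. by apply/seteqP; split => k /=; rewrite mem_iota add1n ltnS. Qed.

(* A pi-system generating the sigma-algebra of [xi 1, ..., xi n]. *)
Definition past (n : nat) : set (set Om) :=
  [set A | exists2 B : nat -> set Xi, (forall k, measurable (B k)) & A = cylinder n B].

(** The filtration as a family of measurable types on [Om]: being adapted is plain measurability
    from [pastT n]. *)
Definition pastT (n : nat) := g_sigma_algebraType (past n).

Lemma past_sub n A : past n A -> measurable A.
Proof.
case=> B mB ->; apply: fin_bigcap_measurable => [|k _].
  by rewrite -set_iota1; exact: finite_seq.
by rewrite -[X in measurable X]setTI; exact: measurable_funP.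
Qed.

Lemma past_measurable n (A : set (pastT n)) :
  measurable A -> measurable (A : set Om).
Proof. by apply: smallest_sub; [exact: sigma_algebra_measurable|exact: past_sub]. Qed.

Lemma past_measurable_fun n d' (T : measurableType d') (g : Om -> T) :
  measurable_fun setT (g : pastT n -> T) -> measurable_fun setT g.
Proof. by move=> mg _ A mA; apply: past_measurable; exact: mg. Qed.

Lemma pastS n A : past n A -> past n.+1 A.
Proof.
case=> B mB ->; exists (fun k => if k == n.+1 then setT else B k).
  by move=> k; case: ifP.
apply/seteqP; split => w H k /= /andP[k1 kn].
  case: eqP => // kn1; apply: H; rewrite /= k1/=.
  by move: kn; rewrite leq_eqVlt => /orP[/eqP//|].
have := H k; rewrite /= k1 (leqW kn) => /(_ isT).
by case: eqP => // kn1; rewrite kn1 ltnn in kn.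
Qed.

Lemma past_measurableS n (A : set Om) :
  measurable (A : set (pastT n)) -> measurable (A : set (pastT n.+1)).
Proof.
apply: smallest_sub; first exact: (@sigma_algebra_measurable _ (pastT n.+1)).
by move=> B /pastS; exact: sub_sigma_algebra.
Qed.

Lemma past_measurable_funS n d' (T : measurableType d') (g : Om -> T) :
  measurable_fun setT (g : pastT n -> T) -> measurable_fun setT (g : pastT n.+1 -> T).
Proof. by move=> mg _ A mA; apply: past_measurableS; exact: mg. Qed.

Lemma past_sample n : measurable_fun setT (xi n.+1 : pastT n.+1 -> Xi).
Proof.
move=> _ B mB; rewrite setTI; apply: sub_sigma_algebra.
exists (fun k => if k == n.+1 then B else setT); first by move=> k; case: ifP.
apply/seteqP; split => w H.
  by move=> k _ /=; case: eqP => // ->.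
by have := H n.+1; rewrite /= leqnn eqxx; exact.
Qed.

Hypothesis xi_iid : iid_with_law mu [set n | (1 <= n)%N] xi.

(** As functions of [A], both sides are finite measures, a restriction and a multiple of [P]. They
    agree on the pi-system [past n] by mutual independence, hence on what it generates. *)
Lemma past_independent n (A : set Om) (B : set Xi) :
  measurable (A : set (pastT n)) -> measurable B ->
  P (A `&` xi n.+1 @^-1` B) = (P A * mu B)%E.
Proof.
move=> mA mB; have [law ind] := xi_iid.
have mC : measurable (xi n.+1 @^-1` B).
  by rewrite -[X in measurable X]setTI; exact: measurable_funP.
have PB : P (xi n.+1 @^-1` B) = mu B by rewrite -(law n.+1).
have onP D : past n D -> P (D `&` xi n.+1 @^-1` B) = (P D * mu B)%E.
  case=> C mCk ->.
  pose C' k := if k == n.+1 then B else C k.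
  have mC' k : measurable (C' k) by rewrite /C'; case: ifP.
  have sub m : [set` iota 1 m] `<=` [set n | (1 <= n)%N].
    by move=> k /=; rewrite mem_iota => /andP[].
  have E : cylinder n C `&` xi n.+1 @^-1` B =
      \bigcap_(k in [set` iota 1 n.+1]) (xi k @^-1` C' k).
    rewrite set_iota1; apply/seteqP; split => w.
      move=> [H1 H2] k /= /andP[k1 kn]; rewrite /C'.
      case: eqP => [->//|kn1]; apply: H1; rewrite /= k1/=.
      by move: kn; rewrite leq_eqVlt => /orP[/eqP//|].
    move=> H; split => [k /= /andP[k1 kn]|].
      have := H k; rewrite /= k1 /C' (leqW kn) => /(_ isT).
      by case: eqP => // kn1; rewrite kn1 ltnn in kn.
    by have := H n.+1; rewrite /= /C' leqnn eqxx; exact.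
  rewrite E (ind _ _ (iota_uniq 1 n.+1) (@sub n.+1) mC').
  rewrite /cylinder -set_iota1 (ind _ _ (iota_uniq 1 n) (@sub n) mCk).
  rewrite -{1}(addn1 n) iotaD big_cat/= big_seq1 add1n {2}/C' eqxx PB.
  congr (_ * _)%E; rewrite big_seq_cond [RHS]big_seq_cond; apply: eq_bigr => k.
  rewrite mem_iota /C' add1n => /andP[/andP[_ kn] _].
  by case: eqP => // kn1; rewrite kn1 ltnn in kn.
have B01 : (0 <= fine (mu B))%R by rewrite fine_ge0.
have muBE : (fine (mu B))%:E = mu B by rewrite fineK// fin_num_measure.
pose m2 := mscale (NngNum B01) P.
have m2E D : m2 D = (P D * mu B)%E by rewrite /m2/= /mscale/= muBE muleC.
rewrite -m2E -[LHS]/(mrestr P mC A).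
apply: (@g_sigma_algebra_measure_unique _ R Om (past n) (@past_sub n) (fun=> setT)).
- move=> _; exists (fun=> setT) => //.
  by rewrite eqEsubset; split => w.
- by rewrite eqEsubset; split => // w _; exists 0%N.
- move=> _ _ [C mCk ->] [D mD ->]; exists (fun k => C k `&` D k).
    by move=> k; exact: measurableI.
  rewrite eqEsubset; split => w.
    by move=> [H1 H2] k Hk; split; [exact: H1|exact: H2].
  by move=> H; split => k Hk; have [] := H k Hk.
- by move=> D pD; exact: (etrans (onP D pD) (esym (m2E D))).
- move=> k; apply: (@le_lt_trans _ _ (P setT)); last by rewrite probability_setT ltry.
  by rewrite /= /mrestr; apply: le_measure; rewrite ?inE//; exact: measurableI.
- exact: mA.
Qed.

(** Taking the identity from [Om] to [pastT n] as first variable covers every function of the past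
    at once. *)
Lemma past_integral n (Phi : pastT n * Xi -> \bar R) :
  measurable_fun setT Phi -> (forall y, (0 <= Phi y)%E) ->
  (\int[P]_w Phi (w, xi n.+1 w) = \int[P]_w \int[mu]_s Phi (w, s))%E.
Proof.
move=> mPhi Phi0.
apply: (independent_integral (X := (id : Om -> pastT n)) (Y := xi n.+1)) => //.
- by move=> _ A mA; rewrite setTI; exact: (past_measurable mA).
- by move=> A B mA mB; exact: past_independent.
Qed.

End Past.

(** * Maximal inequality for supermartingales with drift *)

Section Maximal.
Local Open Scope ereal_scope.
Context {R : realType} {dO dX : measure_display} {Om : measurableType dO}
  {Xi : measurableType dX} (P : probability Om R) (mu : probability Xi R)
  (xi : nat -> {RV P >-> Xi}).
Local Notation pastT := (pastT xi).

Lemma measurable_lt_set d' (T : measurableType d') (V : T -> R) (a : R) :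
  measurable_fun setT V -> measurable [set w | (V w < a)%R].
Proof.
move=> mV; have := mV measurableT `]-oo, a[%classic.
rewrite setTI; have -> : V @^-1` `]-oo, a[%classic = [set w | (V w < a)%R].
  by apply/seteqP; split => w /=; rewrite in_itv.
by apply; exact: measurable_itv.
Qed.

Lemma measurable_ge_set d' (T : measurableType d') (V : T -> R) (a : R) :
  measurable_fun setT V -> measurable [set w | (a <= V w)%R].
Proof.
move=> mV; have -> : [set w | (a <= V w)%R] = ~` [set w | (V w < a)%R].
  by apply/seteqP; split => w /=; rewrite leNgt => /negP.
by apply: measurableC; exact: measurable_lt_set.
Qed.

(** Markov's inequality with the mass below the threshold retained, so that it can be iterated in
    time. *)
Lemma markov_split (V : Om -> R) (a : R) (D : set Om) :
  measurable D -> measurable_fun setT V -> (forall w, 0 <= V w)%R -> (0 <= a)%R ->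
  a%:E * P (D `&` [set w | (a <= V w)%R]) +
    \int[P]_(w in D `&` [set w | (V w < a)%R]) (V w)%:E <= \int[P]_(w in D) (V w)%:E.
Proof.
move=> mD mV V0 a0.
have m1 := measurable_ge_set a mV; have m2 := measurable_lt_set a mV.
have DE : D = (D `&` [set w | (a <= V w)%R]) `|` (D `&` [set w | (V w < a)%R]).
  rewrite -setIUr; apply/seteqP; split => w; last by case.
  by move=> Dw; split => //=; case: (leP a (V w)); [left|right].
rewrite [in leRHS]DE ge0_integral_setU//; first last.
- apply/disj_setPS => w [[_ /= H1] [_ /= H2]]; exfalso.
  by move: H2; rewrite ltNge H1.
- by move=> w _; rewrite lee_fin.
- by apply/measurable_EFinP; exact: measurable_funTS.
- exact: measurableI.
- exact: measurableI.
apply: leeD => //; rewrite -integral_cst; last exact: measurableI.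
apply: ge0_le_integral => //.
- exact: measurableI.
- by apply/measurable_EFinP; exact: measurable_funTS.
- by move=> w [_ /=]; rewrite lee_fin.
Qed.

Lemma doob_maximal (V : nat -> Om -> R) (c : nat -> R) (a : R) (n n' : nat) :
  (0 <= a)%R -> (n <= n')%N -> (forall k w, 0 <= V k w)%R ->
  (forall k, (n <= k <= n')%N -> measurable_fun setT (V k : pastT k -> R)) ->
  (forall k (A : set Om), (n <= k < n')%N -> measurable (A : set (pastT k)) ->
    \int[P]_(w in A) (V k.+1 w)%:E <= \int[P]_(w in A) (V k w)%:E + (c k)%:E) ->
  a%:E * P [set w | exists2 k, (n <= k <= n')%N & (a <= V k w)%R] <=
    \int[P]_w (V n w)%:E + (\sum_(n <= k < n') c k)%R%:E.
Proof.
move=> a0 nn' V0 mV step.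
(* On [A k] the level [a] has not been reached by time [k]. The quantity [a P(~ A k)] plus the
   integral of [V k] over [A k] grows by at most [c k] per step, as paths that have reached [a] are
   frozen at that value. *)
pose A k : set Om := [set w | forall j, (n <= j <= k)%N -> (V j w < a)%R].
have AS k : (n <= k)%N -> A k.+1 = A k `&` [set w | (V k.+1 w < a)%R].
  move=> nk; apply/seteqP; split => w.
    move=> H; split => [j /andP[nj jk]|/=]; apply: H; first by rewrite nj leqW.
    by rewrite leqnn leqW.
  move=> [H1 H2] j /andP[nj]; rewrite leq_eqVlt => /orP[/eqP ->//|jk].
  by apply: H1; rewrite nj.
have An : A n = [set w | (V n w < a)%R].
  apply/seteqP; split => w /= H; first by apply: H; rewrite leqnn.
  by move=> j; rewrite -eqn_leq => /eqP <-.
have mA k : (n <= k <= n')%N -> measurable (A k : set (pastT k)).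
  elim: k => [|k IH] /andP[nk kn'].
    have n0 : n = 0%N by apply/eqP; rewrite -leqn0.
    rewrite n0 in An *; rewrite An; apply: (@measurable_lt_set _ (pastT 0)).
    by apply: mV; rewrite n0.
  move: nk; rewrite leq_eqVlt => /orP[/eqP nk|nk].
    rewrite -nk An; apply: (@measurable_lt_set _ (pastT n)).
    by apply: mV; rewrite leqnn.
  rewrite AS//; apply: (@measurableI _ (pastT k.+1)).
    by apply: past_measurableS; apply: IH; rewrite -ltnS nk/= ltnW.
  apply: (@measurable_lt_set _ (pastT k.+1)).
  by apply: mV; rewrite ltnW.
have mA' k : (n <= k <= n')%N -> measurable (A k).
  by move=> /mA; exact: past_measurable.
have mV' k : (n <= k <= n')%N -> measurable_fun setT (V k).
  by move=> /mV; exact: past_measurable_fun.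
have main k : (n <= k <= n')%N -> a%:E * P (~` A k) + \int[P]_(w in A k) (V k w)%:E <=
    \int[P]_w (V n w)%:E + (\sum_(n <= j < k) c j)%R%:E.
  elim: k => [|k IH] /andP[nk kn'].
    have n0 : n = 0%N by apply/eqP; rewrite -leqn0.
    rewrite n0 big_geq// adde0; have := markov_split measurableT (mV' 0%N _) (V0 0%N) a0.
    rewrite !setTI n0 => /(_ isT); rewrite n0 in An; rewrite An.
    have -> : ~` [set w | (V 0%N w < a)%R] = [set w | (a <= V 0%N w)%R]; last exact.
    by apply/seteqP; split => w /=; rewrite leNgt => /negP.
  move: nk; rewrite leq_eqVlt => /orP[/eqP nk|nk].
    rewrite -nk big_geq// adde0; have := markov_split measurableT (mV' n _) (V0 n) a0.
    rewrite !setTI leqnn nn' => /(_ isT); rewrite An.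
    have -> : ~` [set w | (V n w < a)%R] = [set w | (a <= V n w)%R]; last exact.
    by apply/seteqP; split => w /=; rewrite leNgt => /negP.
  have nkn' : (n <= k <= n')%N by rewrite -ltnS nk ltnW.
  have nkn'' : (n <= k < n')%N by rewrite -ltnS nk.
  have IHk := IH nkn'.
  have -> : ~` A k.+1 = ~` A k `|` (A k `&` [set w | (a <= V k.+1 w)%R]).
    rewrite AS//; apply/seteqP; split => w.
      rewrite setCI => -[|H]; first by left.
      have [Aw|Aw] := pselect (A k w); last by left.
      by right; split => //=; rewrite leNgt; apply/negP.
    by move=> [H [H1 _]//|[H1 /= H2] [_ /=]]; rewrite ltNge H2.
  have mB : measurable (A k `&` [set w | (a <= V k.+1 w)%R]).
    apply: measurableI; first exact: mA'.
    by apply: measurable_ge_set; apply: mV'; rewrite kn' leqW// ltnW.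
  have mCA : measurable (~` A k) by apply: measurableC; exact: mA'.
  rewrite measureU//; last first.
    by apply/seteqP; split => // w [H [H1 _]].
  rewrite ge0_muleDr// -addeA.
  have mVk : measurable_fun setT (V k.+1) by apply: mV'; rewrite kn' leqW// ltnW.
  have H1 := markov_split (mA' k nkn') mVk (V0 k.+1) a0.
  rewrite AS//.
  apply: (@le_trans _ _ (a%:E * P (~` A k) +
      (\int[P]_(w in A k) (V k w)%:E + (c k)%:E))).
    apply: leeD => //; apply: (le_trans H1); apply: step => //; exact: mA.
  rewrite addeA big_nat_recr//= EFinD [leRHS]addeA; exact: leeD.
have -> : [set w | exists2 k, (n <= k <= n')%N & (a <= V k w)%R] = ~` A n'.
  apply/seteqP; split => w.
    by move=> [k nk ak] /(_ k nk); rewrite ltNge ak.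
  move=> /existsNP[k /not_implyP[nk /negP]]; rewrite -leNgt => ak.
  by exists k.
have nn : (n <= n' <= n')%N by rewrite nn' leqnn.
apply: le_trans (main n' nn); apply: leeDl.
by apply: integral_ge0 => w _; rewrite lee_fin.
Qed.

Hypothesis xi_iid : iid_with_law mu [set n | (1 <= n)%N] xi.

(** The indicator of [A] depends on the past only, so the fresh sample is integrated out first and
    the one-step bound is used pointwise. *)
Lemma supermartingale_step n (U : Om -> Xi -> R) (V : Om -> R) (c : R) :
  measurable_fun setT (fun y : pastT n * Xi => U y.1 y.2) ->
  (forall w s, 0 <= U w s)%R -> (0 <= c)%R ->
  measurable_fun setT (V : pastT n -> R) -> (forall w, 0 <= V w)%R ->
  (forall w, \int[mu]_s (U w s)%:E <= (V w + c)%:E) ->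
  forall A : set Om, measurable (A : set (pastT n)) ->
    \int[P]_(w in A) (U w (xi n.+1 w))%:E <= \int[P]_(w in A) (V w)%:E + c%:E.
Proof.
move=> mU U0 c0 mV V0 UV A mA.
have mA' : measurable A by exact: (past_measurable mA).
pose Phi (y : pastT n * Xi) : \bar R := (\1_A y.1 * U y.1 y.2)%:E.
have mPhi : measurable_fun setT Phi.
  apply/measurable_EFinP; apply: measurable_funM => //.
  have mi : measurable_fun setT (\1_A : pastT n -> R) by exact: measurable_indic.
  exact: (measurableT_comp mi measurable_fst).
have Phi0 y : 0 <= Phi y by rewrite lee_fin; apply: mulr_ge0; [rewrite indicE ler0n|].
rewrite integral_mkcond.
have -> : \int[P]_w ((fun w => (U w (xi n.+1 w))%:E) \_ A) w =
   \int[P]_w Phi (w, xi n.+1 w).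
  apply: eq_integral => w _; rewrite /Phi/= patchE indicE.
  by case: ifP => _; rewrite ?mul1r// mul0r.
rewrite (past_integral xi_iid mPhi Phi0).
have mUs w : measurable_fun setT (fun s => (U w s)%:E).
  apply/measurable_EFinP.
  exact: (measurableT_comp mU (pair1_measurable (w : pastT n))).
have mV' : measurable_fun setT V by exact: past_measurable_fun mV.
apply: (@le_trans _ _ (\int[P]_(w in A) (V w + c)%:E)).
  rewrite [leRHS]integral_mkcond; apply: ge0_le_integral => //.
  - by move=> w _; apply: integral_ge0.
  - apply: (@past_measurable_fun _ _ _ _ _ _ xi n).
    exact: (measurable_fun_fubini_tonelli_F (m2 := mu)).
  - apply/measurable_restrict => //.
    by apply/measurable_EFinP; apply: measurable_funTS; exact: measurable_funD.
  move=> w _; rewrite patchE /Phi/=; case: ifPn => [Aw|Aw].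
    rewrite indicE Aw; under eq_integral do rewrite mul1r.
    exact: UV.
  rewrite indicE (negbTE Aw); under eq_integral do rewrite mul0r.
  by rewrite integral0.
under eq_integral do rewrite EFinD.
rewrite ge0_integralD//; first last.
- by apply/measurable_EFinP; apply: measurable_funTS.
- by move=> w _; rewrite lee_fin.
apply: leeD => //; rewrite integral_cst//.
by rewrite -[leRHS]mule1; apply: lee_wpmul2l => //; exact: probability_le1.
Qed.

End Maximal.

(** * Borel-Cantelli on time blocks *)

Section Blocks.
Context {R : realType} {dO : measure_display} {Om : measurableType dO}
  (P : probability Om R) (tm : nat -> R) (Y : nat -> Om -> R).
Hypothesis tm_nd : {homo tm : n k / (n <= k)%N >-> n <= k}.
Hypothesis tm_oo : forall A : R, exists n, A <= tm n.
Hypothesis tm0 : tm 0%N = 0.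
Hypothesis mY : forall n, measurable_fun setT (Y n).

Definition partial_sum (n k : nat) (w : Om) : R := \sum_(n <= i < k) Y i w.

Lemma measurable_partial_sum n k : measurable_fun setT (partial_sum n k).
Proof. exact: measurable_sum. Qed.

Lemma partial_sumB n k l w : (n <= k)%N -> (k <= l)%N ->
  partial_sum k l w = partial_sum n l w - partial_sum n k w.
Proof.
by move=> nk kl; rewrite /partial_sum (big_cat_nat nk kl)/= [RHS]addrC addKr.
Qed.

(** Duration 2 is the right one: a window of length at most 1 that starts in [[j, j + 1)] ends
    before [j + 2]. *)
Hypothesis block_bound : forall a : R, 0 < a -> exists (g : nat -> R) (B : R) (N : nat),
  [/\ forall i, 0 <= g i, forall n, \sum_(0 <= i < n) g i <= B &
   forall n n', (N <= n)%N -> (n <= n')%N -> tm n' - tm n <= 2 ->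
     (P [set w | exists2 k, (n <= k <= n')%N & (a <= `|partial_sum n k w|)%R]
       <= (\sum_(n <= i < n') g i)%:E)%E].

Let start_ex (j : nat) : exists n, j%:R <= tm n.
Proof. exact: tm_oo. Qed.

Let start j := ex_minn (start_ex j).

Let start_ge j : j%:R <= tm (start j).
Proof. by rewrite /start; case: ex_minnP. Qed.

Let start_min j n : j%:R <= tm n -> (start j <= n)%N.
Proof. by rewrite /start; case: ex_minnP => m _ H /H. Qed.

Let start_lt j n : (n < start j)%N -> tm n < j%:R.
Proof. by rewrite ltnNge => H; rewrite ltNge; apply: contra H; exact: start_min. Qed.

Let bad (a : R) (j : nat) : set Om :=
  [set w | exists2 k, (start j <= k < start j.+2)%N & a <= `|partial_sum (start j) k w|].

Let measurable_bad a j : measurable (bad a j).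
Proof.
have -> : bad a j = \bigcup_(k in [set k | (start j <= k < start j.+2)%N])
    [set w | a <= `|partial_sum (start j) k w|].
  by apply/seteqP; split => w [k]; exists k.
apply: bigcup_measurable => k _; apply: measurable_ge_set.
by apply: measurableT_comp => //; exact: measurable_partial_sum.
Qed.

Let bad_bound (a : R) : 0 < a -> (\sum_(0 <= j <oo) P (bad a j) < +oo)%E.
Proof.
move=> a0; have [g [B [N [g0 gB HP]]]] := block_bound a0.
pose G n : R := \sum_(0 <= i < n) g i.
have Gnd n k : (n <= k)%N -> G n <= G k.
  move=> nk; rewrite /G (big_cat_nat (leq0n n) nk)/= lerDl.
  by rewrite sumr_ge0.
have [J JN] : exists J, (N <= start J)%N.
  have [J HJ] : exists J : nat, tm N <= J%:R.
    exists (Num.bound (tm N)); apply/ltW/archi_boundP.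
    by rewrite -tm0; exact: tm_nd.
  exists J.+1; rewrite leqNgt; apply/negP => H.
  have := tm_nd (ltnW H); have := start_ge J.+1.
  have : J%:R < J.+1%:R :> R by rewrite ltr_nat.
  lra.
have startnd j k : (j <= k)%N -> (start j <= start k)%N.
  by move=> jk; apply: start_min; apply: (le_trans _ (start_ge k)); rewrite ler_nat.
have Pbad j : (J <= j)%N -> (P (bad a j) <= (G (start j.+2) - G (start j))%:E)%E.
  move=> Jj; have [s0|s0] := leqP (start j.+2) (start j).
    rewrite (_ : bad a j = set0).
      by rewrite measure0 lee_fin subr_ge0 Gnd// startnd// leqW.
    apply/seteqP; split => // w [k /andP[k1 k2]].
    by have := leq_trans k2 s0; rewrite ltnNge k1.
  have [n' n'E] : exists n', start j.+2 = n'.+1.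
    by exists (start j.+2).-1; rewrite prednK// (leq_trans _ s0).
  have sn' : (start j <= n')%N by rewrite -ltnS -n'E.
  apply: (@le_trans _ _ (\sum_(start j <= i < n') g i)%:E).
    have -> : bad a j = [set w | exists2 k, (start j <= k <= n')%N &
        a <= `|partial_sum (start j) k w|].
      by rewrite /bad n'E; apply/seteqP; split => w [k Hk ak]; exists k; rewrite // ?ltnS// in Hk *.
    apply: HP => //; first by rewrite (leq_trans JN)// startnd.
    have : tm n' < j.+2%:R by apply: start_lt; rewrite n'E.
    have := start_ge j; rewrite -[j.+2]addn2 natrD; lra.
  rewrite lee_fin (_ : \sum_(start j <= i < n') g i = G n' - G (start j)).
    by rewrite lerD2r Gnd// n'E.
  by rewrite /G (big_cat_nat (leq0n (start j)) sn')/= [RHS]addrC addKr.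
rewrite (nneseries_split 0 J)//; apply: lte_add_pinfty.
  by apply/lte_sum_pinfty => i _; rewrite ltey_eq fin_num_measure.
rewrite add0n; apply: (@le_lt_trans _ _ (2 * B)%:E); last exact: ltry.
apply: lime_le; first exact: is_cvg_nneseries.
apply: nearW => m; have [Jm|Jm] := leqP J m; last first.
  rewrite big_geq ?(ltnW Jm)// lee_fin mulr_ge0//.
  by have := gB 0%N; rewrite big_geq.
apply: (@le_trans _ _ (\sum_(J <= j < m) (G (start j.+2) - G (start j))%:E)%E).
  rewrite big_nat_cond [leRHS]big_nat_cond; apply: lee_sum => j /andP[/andP[Jj _] _].
  exact: Pbad.
rewrite sumEFin lee_fin.
(* The blocks [[j, j + 2)] overlap: their increments telescope through sums of two consecutive
   values, whence the bound [2 * B]. *)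
pose H j := G (start j.+1) + G (start j).
rewrite (eq_bigr (fun j => H j.+1 - H j)); last by move=> j _; rewrite /H; ring.
rewrite telescope_sumr// /H.
have := gB (start m.+1); have := gB (start m); rewrite -!/(G _).
have G0 n : 0 <= G n by apply: sumr_ge0.
have := G0 (start J); have := G0 (start J.+1); lra.
Qed.

(** A short window lies in the block given by the integer part of its starting time, and its sum is
    a difference of two sums from the start of that block. Borel-Cantelli is applied for each
    threshold [1 / (m + 1)]. *)
Lemma window_ae : {ae P, forall w, forall e : R, 0 < e ->
  \forall n \near \oo, forall k, (n <= k)%N -> tm k - tm n <= 1 ->
    `|partial_sum n k w| <= e}.
Proof.
have H m : {ae P, forall w, \forall j \near \oo, ~ bad (m.+1%:R^-1) j w}.
  have m0 : 0 < m.+1%:R^-1 :> R by rewrite invr_gt0.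
  exists (lim_sup_set (bad (m.+1%:R^-1))); split.
  - apply: bigcap_measurable => [|k _]; first by exists 0%N.
    by apply: bigcup_measurable => k' _; exact: measurable_bad.
  - by apply: lim_sup_set_cvg0 => //; exact: bad_bound.
  move=> w /= Hw n _ /=; apply: contrapT => Hn; apply: Hw.
  by exists n => // j /= nj bj; apply: Hn; exists j.
have := ae_foralln H; apply: filterS => w Hw e e0.
have [m me] : exists m : nat, m.+1%:R^-1 <= e / 2.
  exists (Num.bound (e / 2)^-1).
  have e2 : 0 < (e / 2)^-1 by rewrite invr_gt0 divr_gt0.
  rewrite -[leRHS]invrK lef_pV2 ?posrE//.
  apply: (@le_trans _ _ (Num.bound (e / 2)^-1)%:R); last by rewrite ler_nat.
  exact/ltW/archi_boundP/ltW.
have [J _ HJ] := Hw m.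
exists (start J) => // n /= Jn k nk tnk.
have tn0 : 0 <= tm n by rewrite -tm0 tm_nd.
have /andP[j1 j2] := truncn_itv tn0.
set j := Num.truncn (tm n) in j1 j2.
have Jj : (J <= j)%N.
  have JR : J%:R <= tm n by apply: (le_trans (start_ge J)); exact: tm_nd.
  by rewrite -ltnS -(ltr_nat R); exact: le_lt_trans j2.
have sn : (start j <= n)%N by exact: start_min.
have small k' : (start j <= k')%N -> tm k' < j.+2%:R -> `|partial_sum (start j) k' w| < e / 2.
  move=> sk tk; apply: lt_le_trans me; rewrite ltNge; apply/negP => Hk.
  apply: (HJ j Jj); exists k' => //; rewrite sk/= ltnNge; apply/negP => H2.
  by have := le_trans (start_ge j.+2) (tm_nd H2); rewrite leNgt tk.
rewrite (partial_sumB _ sn nk).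
have tk : tm k < j.+2%:R by move: j2; rewrite -[j.+2]addn1 natrD; lra.
have tn : tm n < j.+2%:R by apply: (lt_trans j2); rewrite ltr_nat.
have := small k (leq_trans sn nk) tk; have := small n sn tn.
have := ler_normB (partial_sum (start j) k w) (partial_sum (start j) n w); lra.
Qed.

End Blocks.

(** * Taylor bounds for real powers *)

Section PowerTaylor.
Context {R : realType}.
Implicit Types (x y t u q : R).

Lemma expR_le_quadratic u : u <= 1 / 2 -> expR u <= 1 + u + 2 * u ^+ 2.
Proof.
move=> u2; have u1 : 0 < 1 - u by lra.
have H : expR u <= (1 - u)^-1.
  rewrite -[leLHS]invrK lef_pV2 ?posrE ?invr_gt0 ?expR_gt0// -expRN.
  exact: (le_trans _ (expR_ge1Dx (- u))).
apply: (le_trans H); rewrite -[leLHS]mul1r ler_pdivrMr//.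
have -> : (1 + u + 2 * u ^+ 2) * (1 - u) = 1 + u ^+ 2 * (1 - 2 * u) by ring.
by rewrite lerDl mulr_ge0 ?sqr_ge0//; lra.
Qed.

Lemma expR_le_quadratic_bounded u q : u <= q ->
  expR u <= 1 + u + (2 + 4 * expR q) * u ^+ 2.
Proof.
move=> uq; have e0 := expR_gt0 q; have [u2|u2] := leP u (1 / 2).
  have := expR_le_quadratic u2; have := sqr_ge0 u.
  have : 0 <= 4 * expR q * u ^+ 2 by rewrite mulr_ge0 ?sqr_ge0// mulr_ge0// ltW.
  lra.
have eu : expR u <= expR q by rewrite ler_expR.
have s1 : 1 <= 4 * u ^+ 2.
  have : 0 <= (2 * u - 1) * (2 * u + 1) by apply: mulr_ge0; lra.
  by rewrite expr2; lra.
have := ler_wpM2l (ltW e0) s1; have := sqr_ge0 u; lra.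
Qed.

(** The summands pay, in order, for the exponential bound when [|t| <= 1], for [|1 + t| <= 2 |t|]
    and for the linear term when [|t| > 1], and for [powc q >= 1]. *)
Definition powc q := q ^+ 2 * (2 + 4 * expR q) + 2 `^ q + q + 1.

Lemma powc_ge1 q : 0 <= q -> 1 <= powc q.
Proof.
move=> q0; rewrite /powc.
have := powR_ge0 2 q.
have : 0 <= q ^+ 2 * (2 + 4 * expR q).
  by rewrite mulr_ge0 ?sqr_ge0// addr_ge0// mulr_ge0// expR_ge0.
lra.
Qed.

(** When [|t| <= 1], [1 + t <= exp t] reduces the claim to a quadratic bound on the exponential;
    when [|t| > 1], the power of [|t|] dominates everything. No second derivative of a power is
    taken. *)
Lemma powR1D_le t q : 1 <= q ->
  `|1 + t| `^ q <= 1 + q * t + powc q * (t ^+ 2 + `|t| `^ q).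
Proof.
move=> q1; have q0 : 0 <= q by lra.
have P1 := powc_ge1 q0; have p2 := powR_ge0 2 q.
have pt := powR_ge0 `|t| q; have t2 := sqr_ge0 t.
have qe : 0 <= q ^+ 2 * (2 + 4 * expR q).
  by rewrite mulr_ge0 ?sqr_ge0// addr_ge0// mulr_ge0// expR_ge0.
have [t1|t1] := leP `|t| 1.
  have /andP[tl tu] : -1 <= t <= 1 by rewrite -ler_norml.
  have t10 : 0 <= 1 + t by lra.
  rewrite ger0_norm//; apply: (@le_trans _ _ (expR (q * t))).
    rewrite [q * t]mulrC expRM; apply: ge0_ler_powR => //; rewrite ?nnegrE ?expR_ge0//.
    exact: expR_ge1Dx.
  have qt : q * t <= q by rewrite ger_pMr//; lra.
  apply: (le_trans (expR_le_quadratic_bounded qt)).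
  rewrite lerD2l exprMn; apply: (@le_trans _ _ (powc q * t ^+ 2)).
    rewrite mulrA ler_wpM2r// /powc; lra.
  by rewrite ler_wpM2l//; lra.
have t0 : 0 < `|t| by lra.
apply: (@le_trans _ _ ((2 * `|t|) `^ q)).
  apply: ge0_ler_powR; rewrite ?nnegrE ?mulr_ge0//.
  by have := ler_normD 1 t; rewrite normr1; lra.
rewrite powRM//.
have tq : `|t| <= `|t| `^ q by apply: le1r_powR => //; lra.
have qt : - (q * `|t| `^ q) <= q * t.
  rewrite -mulrN ler_wpM2l//; have := ler_norm (- t); rewrite normrN; lra.
have h2 : 0 <= powc q * t ^+ 2 by rewrite mulr_ge0//; lra.
have h3 : powc q * `|t| `^ q = q ^+ 2 * (2 + 4 * expR q) * `|t| `^ q +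
    2 `^ q * `|t| `^ q + q * `|t| `^ q + `|t| `^ q by rewrite /powc; ring.
have h1 := mulr_ge0 qe pt.
rewrite mulrDr h3; move: h1 h2 qt pt.
lra.
Qed.

(** Homogeneity reduces this to [t = y / x]; the coefficient of [y] is the derivative of the power
    at [x]. *)
Lemma powRD_le x y q : 2 <= q ->
  `|x + y| `^ q <= `|x| `^ q + q * `|x| `^ q / x * y +
    powc q * (`|x| `^ (q - 2) * y ^+ 2 + `|y| `^ q).
Proof.
move=> q2; have q0 : 0 <= q by lra.
have qn0 : q != 0 by apply/eqP; lra.
have P1 := powc_ge1 q0.
(* By the convention [0^-1 = 0] the linear term vanishes here, as the derivative does. *)
have [->|xn0] := eqVneq x 0.
  rewrite add0r invr0 mulr0 mul0r addr0 normr0 powR0// add0r.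
  apply: (@le_trans _ _ (powc q * `|y| `^ q)); first by rewrite ler_peMl// powR_ge0.
  apply: ler_wpM2l; first lra.
  by rewrite lerDr mulr_ge0 ?powR_ge0 ?sqr_ge0.
have x0 : 0 < `|x| by rewrite normr_gt0.
have -> : x + y = x * (1 + y / x) by rewrite mulrDr mulr1 mulrC divfK.
rewrite normrM powRM//.
have q1 : 1 <= q by lra.
apply: (le_trans (ler_wpM2l (powR_ge0 _ _) (powR1D_le (y / x) q1))).
rewrite le_eqVlt; apply/orP; left; apply/eqP.
have e1 : `|x| `^ q = `|x| `^ (q - 2) * x ^+ 2.
  rewrite -real_normK ?num_real// -powR_mulrn// -powRD; first by rewrite subrK.
  by apply/implyP => _; rewrite gt_eqF.
have e2 : `|y / x| `^ q * `|x| `^ q = `|y| `^ q.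
  by rewrite -powRM// -normrM divfK.
rewrite -e2 e1; set a := `|y / x| `^ q; set b := `|x| `^ (q - 2); set c := powc q.
by field.
Qed.

(* [g] is a step size: the second-order term is split according to whether
   [|m| ^ 2 >= g], so that no moment of [m] of order [q - 2] is left. *)
Lemma powR_step_le m y g q : 2 <= q -> 0 < g -> g <= 1 ->
  `|m + g * y| `^ q <= `|m| `^ q + q * `|m| `^ q / m * g * y +
    2 * powc q * g * (`|m| `^ q + g `^ (q / 2)) * (1 + `|y| `^ q).
Proof.
move=> q2 g0 g1; have q0 : 0 <= q by lra.
have P1 := powc_ge1 q0.
apply: (le_trans (powRD_le m (g * y) q2)).
rewrite (mulrA _ g y) -addrA -[leRHS]addrA lerD2l lerD2l.
have -> : 2 * powc q * g * (`|m| `^ q + g `^ (q / 2)) * (1 + `|y| `^ q) =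
  powc q * (2 * (g * (`|m| `^ q + g `^ (q / 2)) * (1 + `|y| `^ q))) by ring.
rewrite ler_wpM2l//; first lra.
have gq0 := powR_ge0 g (q / 2); have mq0 := powR_ge0 `|m| q.
have yq0 := powR_ge0 `|y| q.
have h1 : `|m| `^ (q - 2) * (g * y) ^+ 2 <= g * (`|m| `^ q + g `^ (q / 2)) * (1 + `|y| `^ q).
  have -> : `|m| `^ (q - 2) * (g * y) ^+ 2 = g * (g * `|m| `^ (q - 2)) * y ^+ 2 by ring.
  apply: ler_pM; [|exact: sqr_ge0| |].
      by apply: mulr_ge0; [exact: ltW|apply: mulr_ge0; [exact: ltW|exact: powR_ge0]].
    apply: ler_wpM2l; first exact: ltW.
    have [gm|gm] := leP g (`|m| ^+ 2).
      have m0 : `|m| != 0.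
        by apply/eqP => m0; move: gm; rewrite m0 expr0n/=; lra.
      have -> : `|m| `^ q = `|m| ^+ 2 * `|m| `^ (q - 2).
        rewrite -powR_mulrn// -powRD; last exact/implyP.
        by rewrite addrC subrK.
      by apply: (@le_trans _ _ (`|m| ^+ 2 * `|m| `^ (q - 2)));
        [rewrite ler_wpM2r// powR_ge0|rewrite lerDl].
    have -> : g `^ (q / 2) = g * g `^ ((q - 2) / 2).
      rewrite -[X in _ = X * _]powRr1 ?(ltW g0)// -powRD; last first.
        by apply/implyP => _; rewrite gt_eqF.
      by congr (_ `^ _); field.
    apply: (@le_trans _ _ (g * g `^ ((q - 2) / 2))); last by rewrite lerDr.
    rewrite ler_wpM2l ?(ltW g0)//.
    have -> : `|m| `^ (q - 2) = (`|m| ^+ 2) `^ ((q - 2) / 2).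
      by rewrite -powR_mulrn// -powRrM; congr (_ `^ _); field.
    apply: ge0_ler_powR; rewrite ?nnegrE ?exprn_ge0 ?(ltW g0)//; last exact: ltW.
    by rewrite divr_ge0// subr_ge0.
  rewrite -(real_normK (num_real y)).
  have [y1|y1] := leP `|y| 1.
    have : `|y| ^+ 2 <= 1 by rewrite exprn_ile1.
    lra.
  have : `|y| ^+ 2 <= `|y| `^ q.
    by rewrite -powR_mulrn//; apply: ler_powR => //; exact: ltW.
  lra.
have h2 : `|g * y| `^ q <= g * (`|m| `^ q + g `^ (q / 2)) * (1 + `|y| `^ q).
  rewrite normrM (gtr0_norm g0) powRM ?(ltW g0)//.
  apply: ler_pM; rewrite ?powR_ge0//; last by rewrite lerDr.
  apply: (@le_trans _ _ (g * g `^ (q / 2))).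
    rewrite -{2}[g]powRr1 ?(ltW g0)// -powRD; last by apply/implyP => _; rewrite gt_eqF.
    apply: ger_powR; first by rewrite g0.
    lra.
  by rewrite ler_wpM2l ?(ltW g0)// lerDr.
lra.
Qed.

End PowerTaylor.

Section MeanStep.
Context {R : realType} {dX : measure_display} {Xi : measurableType dX}
  (mu : probability Xi R).

(** Averages the power bound over one sample: the centred [psi] removes the linear term, and [rho]
    carries the moment. *)
Lemma integral_affine_le (U psi rho : Xi -> R) (c0 c1 c2 C : R) :
  measurable_fun setT U -> (forall s, 0 <= U s) ->
  mu.-integrable setT (EFin \o psi) -> \int[mu]_s psi s = 0 ->
  measurable_fun setT rho -> (forall s, 0 <= rho s) ->
  (\int[mu]_s (rho s)%:E <= C%:E)%E -> 0 <= c2 ->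
  (forall s, U s <= c0 + c1 * psi s + c2 * (1 + rho s)) ->
  (\int[mu]_s (U s)%:E <= (c0 + c2 * (1 + C))%:E)%E.
Proof.
move=> mU U0 ipsi psi0 mrho rho0 rhoC c20 HU.
have irho : mu.-integrable setT (EFin \o rho).
  apply/integrableP; split; first exact/measurable_EFinP.
  apply: (le_lt_trans _ (ltry C)); apply: (le_trans _ rhoC).
  apply: ge0_le_integral => //=.
  - by apply/measurable_EFinP; apply: measurableT_comp.
  - exact/measurable_EFinP.
  - by move=> s _; rewrite lee_fin ger0_norm.
have icst (c : R) : mu.-integrable setT (EFin \o cst c).
  exact: finite_measure_integrable_cst.
have i1 : mu.-integrable setT (EFin \o (fun s => c1 * psi s)).
  by have := integrableZl measurableT c1 ipsi.
have i01 : mu.-integrable setT (EFin \o (fun s => c0 + c1 * psi s)).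
  by have := integrableD measurableT (icst c0) i1.
have i1r : mu.-integrable setT (EFin \o (fun s => 1 + rho s)).
  by have := integrableD measurableT (icst 1) irho.
have i2 : mu.-integrable setT (EFin \o (fun s => c2 * (1 + rho s))).
  by have := integrableZl measurableT c2 i1r.
have i3 : mu.-integrable setT (EFin \o (fun s => c0 + c1 * psi s + c2 * (1 + rho s))).
  by have := integrableD measurableT i01 i2.
apply: (@le_trans _ _ (\int[mu]_s (c0 + c1 * psi s + c2 * (1 + rho s))%:E)%E).
  apply: ge0_le_integral => //.
  - by move=> s _; rewrite lee_fin.
  - exact/measurable_EFinP.
  - exact: (measurable_int mu).
  - by move=> s _; rewrite lee_fin.
apply: (@le_trans _ _ (\int[mu]_s (c0 + c1 * psi s + c2 * (1 + rho s)))%:E).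
  by rewrite /Rintegral fineK//; exact: integrable_fin_num.
rewrite (RintegralD measurableT i01 i2) (RintegralD measurableT (icst c0) i1).
rewrite (RintegralZl c1 measurableT ipsi) (RintegralZl c2 measurableT i1r).
rewrite (RintegralD measurableT (icst 1) irho) psi0.
have m1 : fine (mu setT) = 1 by rewrite (@probability_setT _ _ _ mu).
rewrite !Rintegral_cst// !m1 !mulr1 mulr0 addr0 lee_fin.
rewrite lerD2l ler_wpM2l// lerD2l -lee_fin /Rintegral fineK//.
exact: integrable_fin_num.
Qed.

End MeanStep.

(** * Martingale sums of the noise *)

Section Noise.
Context {R : realType} {dO dX : measure_display} {Om : measurableType dO}
  {Xi : measurableType dX} (P : probability Om R) (mu : probability Xi R)
  (xi : nat -> {RV P >-> Xi}) (tm : nat -> R).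
Local Notation pastT := (pastT xi).
Let dt n : R := tm n.+1 - tm n.
Hypothesis xi_iid : iid_with_law mu [set n | (1 <= n)%N] xi.
Hypothesis tm_nd : {homo tm : n k / (n <= k)%N >-> n <= k}.

Context (Psi : nat -> Om -> Xi -> R).
Hypothesis mPsi : forall i, measurable_fun setT (fun y : pastT i * Xi => Psi i y.1 y.2).

(** [Psi i] depends on samples up to [i] and is fed the fresh sample [i.+1], so this term is known
    at time [i.+1]. *)
Definition noise (i : nat) (w : Om) : R := dt i * Psi i w (xi i.+1 w).

Lemma noise_adapted i : measurable_fun setT (noise i : pastT i.+1 -> R).
Proof.
apply: measurable_funM => //.
have mid : measurable_fun setT (id : pastT i.+1 -> pastT i).
  by move=> _ A mA; rewrite setTI; exact: past_measurableS.
have mp : measurable_fun setT (fun w : pastT i.+1 => ((w : pastT i), xi i.+1 w)).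
  by apply: measurable_fun_pair => //; exact: past_sample.
exact: (measurableT_comp (@mPsi i) mp).
Qed.

Lemma noise_measurable i : measurable_fun setT (noise i).
Proof. exact: (past_measurable_fun (@noise_adapted i)). Qed.

Lemma partial_sum_adapted n k :
  measurable_fun setT (partial_sum noise n k : pastT k -> R).
Proof.
elim: k => [|k IH].
  have -> : partial_sum noise n 0 = cst 0.
    by apply/funext => w; rewrite /partial_sum big_geq.
  exact: measurable_cst.
have [nk|nk] := leqP n k; last first.
  have -> : partial_sum noise n k.+1 = cst 0.
    by apply/funext => w; rewrite /partial_sum big_geq.
  exact: measurable_cst.
have -> : partial_sum noise n k.+1 = (fun w => partial_sum noise n k w + noise k w).
  by apply/funext => w; rewrite /partial_sum big_nat_recr.
apply: measurable_funD; last exact: noise_adapted.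
exact: past_measurable_funS.
Qed.

Lemma partial_sum_next n k w : (n <= k)%N ->
  partial_sum noise n k.+1 w =
  partial_sum noise n k w + dt k * Psi k w (xi k.+1 w).
Proof. by move=> nk; rewrite /partial_sum big_nat_recr. Qed.

Lemma measurable_step n k (phi : R -> R -> R) :
  measurable_fun setT (fun y : R * R => phi y.1 y.2) ->
  measurable_fun setT (fun y : pastT k * Xi => phi (partial_sum noise n k y.1) (Psi k y.1 y.2)).
Proof.
move=> mphi.
have m1 : measurable_fun setT (fun y : pastT k * Xi => partial_sum noise n k y.1).
  exact: (measurableT_comp (@partial_sum_adapted n k) measurable_fst).
exact: (measurableT_comp mphi (measurable_fun_pair m1 (@mPsi k))).
Qed.

Let dt_ge0 i : 0 <= dt i. Proof. by rewrite subr_ge0 tm_nd. Qed.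

Section Moment.
Variables (q C : R).
Hypothesis q2 : 2 <= q.
Hypothesis C0 : 0 <= C.
Hypothesis dt_gt0 : forall i, 0 < dt i.
Hypothesis Psi_int : forall i w, mu.-integrable setT (EFin \o Psi i w).
Hypothesis Psi_mean : forall i w, \int[mu]_s Psi i w s = 0.
Hypothesis Psi_moment : forall i w, (\int[mu]_s (`|Psi i w s| `^ q)%:E <= C%:E)%E.

(** Growth rate of the moment of order [q]: on average, one step multiplies it by at most [1 + D dt]
    and adds [D dt^(1 + q/2)]. *)
Let D : R := 2 * powc q * (1 + C).
Let D0 : 0 <= D.
Proof.
have q0 : 0 <= q by have := q2; lra.
have P1 := powc_ge1 q0.
have C1 : 0 <= 1 + C by rewrite addr_ge0.
rewrite /D; apply: mulr_ge0 => //; apply: mulr_ge0 => //; lra.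
Qed.

Let V n k w : R := expR (- (D * (tm k - tm n))) * `|partial_sum noise n k w| `^ q.

Lemma moment_maximal (a : R) n n' : 0 < a -> (n <= n')%N ->
  (forall i, (n <= i)%N -> dt i <= 1) -> tm n' - tm n <= 2 ->
  (P [set w | exists2 k, (n <= k <= n')%N & (a <= `|partial_sum noise n k w|)%R] <=
  (\sum_(n <= i < n') (expR (2 * D) / a `^ q * D * dt i `^ (1 + q / 2)))%:E)%E.
Proof.
move=> a0 nn' dt1 tm2.
have q0 : 0 <= q by have := q2; lra.
have V0 k w : 0 <= V n k w by rewrite mulr_ge0 ?expR_ge0 ?powR_ge0.
have mpow : measurable_fun setT (fun x : R => `|x| `^ q).
  by apply: (measurableT_comp (measurable_powR q)).
have mV k : measurable_fun setT (V n k : pastT k -> R).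
  by apply: measurable_funM => //; apply: (measurableT_comp mpow); exact: partial_sum_adapted.
(* On a window of duration at most 2 the discount in [V] is at least [expR (- (2 * D))], so reaching
   [a] forces [V] to reach [b]. *)
pose b : R := expR (- (2 * D)) * a `^ q.
have b0 : 0 < b by rewrite mulr_gt0 ?expR_gt0 ?powR_gt0.
have step k (A : set Om) : (n <= k < n')%N -> measurable (A : set (pastT k)) ->
  (\int[P]_(w in A) (V n k.+1 w)%:E <= \int[P]_(w in A) (V n k w)%:E +
    (D * dt k `^ (1 + q / 2))%:E)%E.
  move=> /andP[nk kn'] mA.
  pose U w s : R := expR (- (D * (tm k.+1 - tm n))) *
     `|partial_sum noise n k w + dt k * Psi k w s| `^ q.
  have -> : (\int[P]_(w in A) (V n k.+1 w)%:E = \int[P]_(w in A) (U w (xi k.+1 w))%:E)%E.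
    by apply: eq_integral => w _; rewrite /V /U partial_sum_next.
  apply: (supermartingale_step xi_iid) => //.
  - apply: (@measurable_step n k (fun x y => expR (- (D * (tm k.+1 - tm n))) *
      `|x + dt k * y| `^ q)).
    apply: measurable_funM => //; apply: (measurableT_comp mpow).
    by apply: measurable_funD => //; apply: measurable_funM.
  - by move=> w s; rewrite mulr_ge0 ?expR_ge0 ?powR_ge0.
  - by rewrite mulr_ge0// powR_ge0.
  move=> w; set m := partial_sum noise n k w.
  have e0 := expR_gt0 (- (D * (tm k.+1 - tm n))).
  have e1 : expR (- (D * (tm k.+1 - tm n))) <= 1.
    rewrite expR_le1 oppr_le0 mulr_ge0// subr_ge0 tm_nd//.
    exact: (leq_trans nk).
  have mPk : measurable_fun setT (Psi k w).
    by have /measurable_EFinP := measurable_int mu (Psi_int k w).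
  apply: (@le_trans _ _ (expR (- (D * (tm k.+1 - tm n))) * (`|m| `^ q +
     2 * powc q * dt k * (`|m| `^ q + dt k `^ (q / 2)) * (1 + C)))%:E).
    under eq_integral do rewrite EFinM.
    rewrite ge0_integralZl_EFin//; first last.
    - apply/measurable_EFinP; apply: (measurableT_comp mpow).
      by apply: measurable_funD => //; apply: measurable_funM.
    rewrite EFinM; apply: lee_pmul => //.
      by apply: integral_ge0 => s _; rewrite lee_fin powR_ge0.
    apply: (@integral_affine_le _ _ _ mu _ (Psi k w) (fun s => `|Psi k w s| `^ q)
      _ (q * `|m| `^ q / m * dt k)) => //.
    - apply: (measurableT_comp mpow).
      by apply: measurable_funD => //; apply: measurable_funM.
    - exact: (measurableT_comp mpow).
    - apply: mulr_ge0; last by rewrite addr_ge0// powR_ge0.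
      apply: mulr_ge0 => //; apply: mulr_ge0 => //.
      exact: le_trans ler01 (powc_ge1 q0).
    - move=> s; apply: powR_step_le => //; exact: dt1.
  rewrite lee_fin.
  have -> : `|m| `^ q + 2 * powc q * dt k * (`|m| `^ q + dt k `^ (q / 2)) * (1 + C) =
     (1 + D * dt k) * `|m| `^ q + D * (dt k * dt k `^ (q / 2)).
    by rewrite /D; ring.
  have dE : dt k * dt k `^ (q / 2) = dt k `^ (1 + q / 2).
    rewrite powRD; last by apply/implyP => _; rewrite gt_eqF.
    by rewrite powRr1.
  rewrite dE mulrDr; apply: lerD; last first.
    by rewrite ler_piMl// mulr_ge0// powR_ge0.
  rewrite /V -/m mulrA ler_wpM2r ?powR_ge0//.
  (* Over one step the discount changes by [expR (D * dt k)], which absorbs the factor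
     [1 + D * dt k]. *)
  have -> : - (D * (tm k - tm n)) = - (D * (tm k.+1 - tm n)) + D * dt k.
    by rewrite /dt; ring.
  by rewrite expRD ler_wpM2l ?expR_ge0// expR_ge1Dx.
have := doob_maximal (ltW b0) nn' V0 (fun k _ => mV k) step.
have -> : (\int[P]_w (V n n w)%:E = 0)%E.
  rewrite integral0_eq// => w _; rewrite /V /partial_sum big_geq// normr0.
  by rewrite powR0 ?mulr0// gt_eqF//; have := q2; lra.
rewrite add0e => Hmax.
have sub : [set w | exists2 k, (n <= k <= n')%N & a <= `|partial_sum noise n k w|]
    `<=` [set w | exists2 k, (n <= k <= n')%N & b <= V n k w].
  move=> w [k /andP[nk kn'] ak]; exists k; first by rewrite nk.
  rewrite /b /V; apply: ler_pM; rewrite ?expR_ge0 ?powR_ge0//.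
    rewrite ler_expR lerN2 mulrC; apply: ler_wpM2r => //.
    by apply: le_trans tm2; rewrite lerD2r tm_nd.
  by apply: ge0_ler_powR => //; rewrite ?nnegrE// ltW.
have mE (W : nat -> Om -> R) : (forall k, measurable_fun setT (W k)) -> forall c,
    measurable [set w | exists2 k, (n <= k <= n')%N & c <= W k w].
  move=> mW c; have -> : [set w | exists2 k, (n <= k <= n')%N & c <= W k w] =
    \bigcup_(k in [set k | (n <= k <= n')%N]) [set w | c <= W k w].
    by apply/seteqP; split => w [k]; exists k.
  by apply: bigcup_measurable => k _; exact: measurable_ge_set.
have mV' k : measurable_fun setT (V n k) by exact: (past_measurable_fun (@mV k)).
have mS k : measurable_fun setT (fun w => `|partial_sum noise n k w|).
  apply: measurableT_comp => //.
  exact: (past_measurable_fun (@partial_sum_adapted n k)).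
apply: (le_trans (le_measure P _ _ sub)).
- by rewrite inE; exact: (mE (fun k w => `|partial_sum noise n k w|)).
- by rewrite inE; exact: mE.
rewrite -(@lee_pmul2l _ b%:E)// ?lte_fin//.
apply: (le_trans Hmax); rewrite -EFinM lee_fin.
rewrite mulr_sumr le_eqVlt; apply/orP; left; apply/eqP; apply: eq_bigr => i _.
rewrite /b expRN; field.
by rewrite gt_eqF ?powR_gt0// gt_eqF// expR_gt0.
Qed.

End Moment.

Section Subgaussian.
Variable sg : R.
Hypothesis sg0 : sg != 0.
Hypothesis dt_gt0 : forall i, 0 < dt i.
Hypothesis Psi_exp : forall i w (l : R),
  (\int[mu]_s (expR (l * Psi i w s))%:E <= (expR (sg ^+ 2 * l ^+ 2 / 2))%:E)%E.

(** Subtracting the sub-Gaussian bound on each step in the exponent makes [V] a supermartingale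
    started at 1, without drift. *)
Lemma exponential_maximal (l a : R) n n' : (n <= n')%N ->
  (P [set w | exists2 k, (n <= k <= n')%N & (a <= l * partial_sum noise n k w)%R] <=
  (expR (- a + sg ^+ 2 * l ^+ 2 / 2 * \sum_(n <= i < n') dt i ^+ 2))%:E)%E.
Proof.
move=> nn'; pose K := sg ^+ 2 * l ^+ 2 / 2.
have K0 : 0 <= K by rewrite divr_ge0// mulr_ge0// sqr_ge0.
pose Q k : R := \sum_(n <= i < k) dt i ^+ 2.
pose V k w : R := expR (l * partial_sum noise n k w - K * Q k).
have V0 k w : 0 <= V k w by exact: expR_ge0.
have mV k : measurable_fun setT (V k : pastT k -> R).
  apply: (measurableT_comp (@measurable_expR R)).
  apply: measurable_funB => //; apply: measurable_funM => //.
  exact: partial_sum_adapted.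
pose b : R := expR (a - K * Q n').
have step k (A : set Om) : (n <= k < n')%N -> measurable (A : set (pastT k)) ->
  (\int[P]_(w in A) (V k.+1 w)%:E <= \int[P]_(w in A) (V k w)%:E + 0%:E)%E.
  move=> /andP[nk kn'] mA.
  pose U w s : R := expR (l * (partial_sum noise n k w + dt k * Psi k w s) - K * Q k.+1).
  have -> : (\int[P]_(w in A) (V k.+1 w)%:E = \int[P]_(w in A) (U w (xi k.+1 w))%:E)%E.
    by apply: eq_integral => w _; rewrite /V /U partial_sum_next.
  have mphi : measurable_fun setT
      (fun y : R * R => expR (l * (y.1 + dt k * y.2) - K * Q k.+1)).
    apply: (measurableT_comp (@measurable_expR R)).
    apply: measurable_funB => //; apply: measurable_funM => //.
    by apply: measurable_funD => //; apply: measurable_funM.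
  apply: (supermartingale_step xi_iid) => //.
  - exact: (@measurable_step n k (fun x y => expR (l * (x + dt k * y) - K * Q k.+1))).
  - by move=> w s; exact: expR_ge0.
  move=> w; rewrite addr0.
  have UE s : (U w s)%:E = ((expR (l * partial_sum noise n k w - K * Q k.+1))%:E *
     (expR (l * dt k * Psi k w s))%:E)%E.
    by rewrite -EFinM -expRD /U; congr (expR _)%:E; ring.
  under eq_integral do rewrite UE.
  have mPk : measurable_fun setT (Psi k w).
    exact: (measurableT_comp (@mPsi k) (pair1_measurable (w : pastT k))).
  rewrite ge0_integralZl_EFin ?expR_ge0//; last first.
    apply/measurable_EFinP; apply: (measurableT_comp (@measurable_expR R)).
    exact: measurable_funM.
  apply: (@le_trans _ _ ((expR (l * partial_sum noise n k w - K * Q k.+1))%:E *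
     (expR (sg ^+ 2 * (l * dt k) ^+ 2 / 2))%:E)%E).
    by apply: lee_pmul => //; apply: integral_ge0 => s _; rewrite lee_fin expR_ge0.
  rewrite -EFinM -expRD lee_fin ler_expR /Q big_nat_recr//= /K.
  by rewrite le_eqVlt; apply/orP; left; apply/eqP; field.
have b0 : 0 < b by exact: expR_gt0.
have := doob_maximal (ltW b0) nn' V0 (fun k _ => mV k) step.
have -> : (\int[P]_w (V n w)%:E = 1)%E.
  rewrite (eq_integral (cst 1%E)); last first.
    by move=> w _; rewrite /V /partial_sum /Q !big_geq// !mulr0 subr0 expR0.
  by rewrite integral_cst; [rewrite mul1e; exact: probability_setT|exact: measurableT].
rewrite big1_eq adde0 => Hmax.
have sub : [set w | exists2 k, (n <= k <= n')%N & a <= l * partial_sum noise n k w]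
    `<=` [set w | exists2 k, (n <= k <= n')%N & b <= V k w].
  move=> w [k /andP[nk kn'] ak]; exists k; first by rewrite nk.
  rewrite /b /V ler_expR; apply: lerB => //; rewrite ler_wpM2l//.
  rewrite /Q (big_cat_nat nk kn')/= lerDl; apply: sumr_ge0 => i _; exact: sqr_ge0.
have mE (W : nat -> Om -> R) : (forall k, measurable_fun setT (W k)) -> forall c,
    measurable [set w | exists2 k, (n <= k <= n')%N & c <= W k w].
  move=> mW c; have -> : [set w | exists2 k, (n <= k <= n')%N & c <= W k w] =
    \bigcup_(k in [set k | (n <= k <= n')%N]) [set w | c <= W k w].
    by apply/seteqP; split => w [k]; exists k.
  by apply: bigcup_measurable => k _; exact: measurable_ge_set.
have mV' k : measurable_fun setT (V k) by exact: (past_measurable_fun (@mV k)).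
have mS k : measurable_fun setT (fun w => l * partial_sum noise n k w).
  apply: measurable_funM => //.
  exact: (past_measurable_fun (@partial_sum_adapted n k)).
apply: (le_trans (le_measure P _ _ sub)).
- by rewrite inE; exact: (mE (fun k w => l * partial_sum noise n k w)).
- by rewrite inE; exact: mE.
rewrite -(@lee_pmul2l _ b%:E)// ?lte_fin//.
apply: (le_trans Hmax); rewrite -EFinM lee_fin /b -expRD -/K -/(Q n').
by rewrite -[leLHS]expR0 ler_expR; lra.
Qed.

(** The probability is controlled by the term of the largest step in the block, and that term is at
    most the whole sum. The factor 2 accounts for the signs of [l]. *)
Lemma subgaussian_maximal (a : R) n n' : 0 < a -> (n <= n')%N -> tm n' - tm n <= 2 ->
  (P [set w | exists2 k, (n <= k <= n')%N & (a <= `|partial_sum noise n k w|)%R] <=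
  (\sum_(n <= i < n') (2 * expR (- (a ^+ 2 / (4 * sg ^+ 2) / dt i))))%:E)%E.
Proof.
move=> a0 nn' tm2.
(* An empty block has no largest step, but there the event is empty. *)
move: nn'; rewrite leq_eqVlt => /orP[/eqP <-|nn'].
  rewrite (_ : [set w | _] = set0) ?measure0 ?big_geq//.
  apply/seteqP; split => // w [k /andP[nk kn]].
  have -> : k = n by apply/eqP; rewrite eqn_leq nk kn.
  by rewrite /partial_sum big_geq// normr0 leNgt a0.
have sg2 : 0 < sg ^+ 2 by rewrite exprn_even_gt0.
have [i0 [ni0 i0n' Hmax]] : exists i0, [/\ (n <= i0)%N, (i0 < n')%N &
    forall i, (n <= i < n')%N -> dt i <= dt i0].
  elim: n' nn' {tm2} => // n' IH; rewrite ltnS leq_eqVlt => /orP[/eqP <-|nn'].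
    by exists n; split => // i; rewrite ltnS -eqn_leq => /eqP <-.
  have [i0 [ni0 i0n' H]] := IH nn'.
  have [d|d] := leP (dt n') (dt i0).
    exists i0; split => //; first exact: ltnW.
    move=> i; rewrite ltnS => /andP[ni]; rewrite leq_eqVlt => /orP[/eqP ->//|in'].
    by apply: H; rewrite ni.
  exists n'; split => //; first exact: ltnW.
  move=> i; rewrite ltnS => /andP[ni]; rewrite leq_eqVlt => /orP[/eqP ->//|in'].
  by apply: (le_trans _ (ltW d)); apply: H; rewrite ni.
(* Minimiser of [- l a + sg^2 l^2 dt_i0], which bounds the exponent because the squared steps add up
   to at most [2 * dt i0]. *)
pose l := a / (2 * sg ^+ 2 * dt i0).
have d0 := dt_gt0 i0.
have l0 : 0 < l by apply: divr_gt0 => //; apply: mulr_gt0 => //; exact: mulr_gt0.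
have bound : expR (- (l * a) + sg ^+ 2 * l ^+ 2 / 2 * \sum_(n <= i < n') dt i ^+ 2) <=
    expR (- (a ^+ 2 / (4 * sg ^+ 2) / dt i0)).
  rewrite ler_expR.
  have S2 : \sum_(n <= i < n') dt i ^+ 2 <= dt i0 * 2.
    apply: (@le_trans _ _ (dt i0 * \sum_(n <= i < n') dt i)).
      rewrite mulr_sumr big_nat_cond [leRHS]big_nat_cond; apply: ler_sum => i.
      rewrite andbT => ni; rewrite expr2 ler_wpM2r//; exact: Hmax.
    by rewrite ler_wpM2l// sum_time// ltnW.
  have c0 : 0 <= sg ^+ 2 * l ^+ 2 / 2 by rewrite divr_ge0// mulr_ge0// sqr_ge0.
  have := ler_wpM2l c0 S2.
  have -> : sg ^+ 2 * l ^+ 2 / 2 * (dt i0 * 2) = a ^+ 2 / (4 * sg ^+ 2) / dt i0.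
    by rewrite /l; field; rewrite sg0 gt_eqF.
  have -> : l * a = 2 * (a ^+ 2 / (4 * sg ^+ 2) / dt i0).
    by rewrite /l; field; rewrite sg0 gt_eqF.
  lra.
have mS (c : R) : measurable [set w | exists2 k, (n <= k <= n')%N & l * a <= c * partial_sum noise n k w].
  have -> : [set w | exists2 k, (n <= k <= n')%N & l * a <= c * partial_sum noise n k w] =
    \bigcup_(k in [set k | (n <= k <= n')%N]) [set w | l * a <= c * partial_sum noise n k w].
    by apply/seteqP; split => w [k]; exists k.
  apply: bigcup_measurable => k _; apply: measurable_ge_set; apply: measurable_funM => //.
  exact: (past_measurable_fun (@partial_sum_adapted n k)).
have -> : [set w | exists2 k, (n <= k <= n')%N & a <= `|partial_sum noise n k w|] =
   [set w | exists2 k, (n <= k <= n')%N & l * a <= l * partial_sum noise n k w] `|`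
   [set w | exists2 k, (n <= k <= n')%N & l * a <= - l * partial_sum noise n k w].
  apply/seteqP; split => w.
    move=> [k nk]; rewrite ler_normr => /orP[H|H]; [left|right]; exists k => //.
      by rewrite ler_pM2l.
    by rewrite mulNr -mulrN ler_pM2l.
  move=> [[k nk]|[k nk]].
    by rewrite ler_pM2l// => H; exists k => //; rewrite ler_normr H.
  by rewrite mulNr -mulrN ler_pM2l// => H; exists k => //; rewrite ler_normr H orbT.
apply: (le_trans (measureU2 P (mS _) (mS _))).
have H1 := exponential_maximal l (l * a) (ltnW nn').
have H2 := exponential_maximal (- l) (l * a) (ltnW nn').
apply: (le_trans (leeD H1 H2)); rewrite sqrrN -EFinD lee_fin.
apply: (@le_trans _ _ (2 * expR (- (a ^+ 2 / (4 * sg ^+ 2) / dt i0)))).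
  by move: bound; lra.
rewrite (big_cat_nat ni0 (ltnW i0n'))/= [X in _ + X]big_ltn//.
have pos j k : 0 <= \sum_(j <= i < k) (2 * expR (- (a ^+ 2 / (4 * sg ^+ 2) / dt i))).
  by apply: sumr_ge0 => i _; rewrite mulr_ge0// expR_ge0.
have := pos n i0; have := pos i0.+1 n'; lra.
Qed.

End Subgaussian.

End Noise.

Section NoiseWindow.
Context {R : realType} {dO dX : measure_display} {Om : measurableType dO}
  {Xi : measurableType dX} (P : probability Om R) (mu : probability Xi R)
  (xi : nat -> {RV P >-> Xi}) (tm : nat -> R).
Hypothesis xi_iid : iid_with_law mu [set n | (1 <= n)%N] xi.
Hypothesis tm0 : tm 0%N = 0.
Hypothesis tm_oo : forall A : R, exists n, A <= tm n.
Hypothesis tm_gt : forall n, tm n < tm n.+1.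
Hypothesis tm_step : tm n.+1 - tm n @[n --> \oo] --> (0 : R).
Context (Psi : nat -> Om -> Xi -> R).
Hypothesis mPsi : forall i,
  measurable_fun setT (fun y : pastT xi i * Xi => Psi i y.1 y.2).

Let dt_gt0 i : 0 < tm i.+1 - tm i. Proof. by rewrite subr_gt0. Qed.

Let tm_nd : {homo tm : n k / (n <= k)%N >-> n <= k}.
Proof. by apply: homo_leq => //; [exact: le_trans|move=> n; exact: ltW]. Qed.

Let window_small (S : Om -> nat -> nat -> R) := {ae P, forall w, forall e : R, 0 < e ->
  \forall n \near \oo, forall k, (n <= k)%N -> tm k - tm n <= 1 ->
    `|S w n k| <= e}.

Lemma noise_window_moment (q C B : R) : 2 <= q -> 0 <= C ->
  (forall i w, mu.-integrable setT (EFin \o Psi i w)) ->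
  (forall i w, \int[mu]_s Psi i w s = 0) ->
  (forall i w, (\int[mu]_s (`|Psi i w s| `^ q)%:E <= C%:E)%E) ->
  (forall n, \sum_(0 <= i < n) (tm i.+1 - tm i) `^ (1 + q / 2) <= B) ->
  window_small (fun w n k => partial_sum (noise xi tm Psi) n k w).
Proof.
move=> q2 C0 iPsi Psi0 PsiC sumB.
apply: window_ae => // [n|a a0]; first exact: noise_measurable.
have [N _ HN] : \forall n \near \oo, tm n.+1 - tm n <= 1.
  have /cvgrPdist_le /(_ 1 ltr01) := tm_step.
  by apply: filterS => n; rewrite sub0r normrN; exact: le_trans (ler_norm _).
pose D : R := 2 * powc q * (1 + C).
have D0 : 0 <= D.
  have q0 : 0 <= q by lra.
  rewrite /D; apply: mulr_ge0; last by rewrite addr_ge0.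
  by apply: mulr_ge0 => //; exact: le_trans ler01 (powc_ge1 q0).
pose c : R := expR (2 * D) / a `^ q * D.
have c0 : 0 <= c by rewrite mulr_ge0// divr_ge0 ?expR_ge0 ?powR_ge0.
exists (fun i => c * (tm i.+1 - tm i) `^ (1 + q / 2)), (c * B), N; split.
- by move=> i; rewrite mulr_ge0// powR_ge0.
- by move=> n; rewrite -mulr_sumr ler_wpM2l.
move=> n n' Nn nn' tm2.
apply: (moment_maximal xi_iid tm_nd mPsi q2 C0) => // i ni.
by apply: HN => /=; exact: leq_trans ni.
Qed.

Lemma noise_window_subgaussian (sg : R) : sg != 0 ->
  (forall i w (l : R),
    (\int[mu]_s (expR (l * Psi i w s))%:E <= (expR (sg ^+ 2 * l ^+ 2 / 2))%:E)%E) ->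
  (forall alpha : R, 0 < alpha -> exists B : R, forall n,
     \sum_(0 <= i < n) expR (- (alpha / (tm i.+1 - tm i))) <= B) ->
  window_small (fun w n k => partial_sum (noise xi tm Psi) n k w).
Proof.
move=> sg0 HPsi sumB.
apply: window_ae => // [n|a a0]; first exact: noise_measurable.
have sg2 : 0 < sg ^+ 2 by rewrite exprn_even_gt0.
have al0 : 0 < a ^+ 2 / (4 * sg ^+ 2).
  by apply: divr_gt0; [exact: exprn_gt0|exact: mulr_gt0].
have [B HB] := sumB _ al0.
exists (fun i => 2 * expR (- (a ^+ 2 / (4 * sg ^+ 2) / (tm i.+1 - tm i)))), (2 * B), 0%N.
split.
- by move=> i; rewrite mulr_ge0// expR_ge0.
- by move=> n; rewrite -mulr_sumr ler_wpM2l.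
move=> n n' _ nn' tm2.
exact: (subgaussian_maximal xi_iid tm_nd mPsi sg0).
Qed.

End NoiseWindow.

(** * The iterates and their noise *)

Section AlgorithmStep.
Context {R : realType} {d : nat} {Xi : Type} (g : 'rV[R]_d -> Xi -> 'rV[R]_d)
  (eps : R) (gamma h r p q : nat -> R) (z0 : state R d) (s : nat -> Xi).
Local Notation z := (alg g eps gamma h r p q z0 s).

Lemma alg_v n i : (z n.+1).1.1 0 i = (1 - gamma n.+1 * q n) * (z n).1.1 0 i
  + gamma n.+1 * p n * (g (z n).2 (s n.+1)) 0 i ^+ 2.
Proof. by rewrite /=; case: (alg _ _ _ _ _ _ _ _ _ n) => -[v m] x /=; rewrite !mxE. Qed.

Lemma alg_m n i : (z n.+1).1.2 0 i = (1 - gamma n.+1 * r n) * (z n).1.2 0 i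
  + gamma n.+1 * h n * (g (z n).2 (s n.+1)) 0 i.
Proof. by rewrite /=; case: (alg _ _ _ _ _ _ _ _ _ n) => -[v m] x /=; rewrite !mxE. Qed.

Lemma alg_x n i : (z n.+1).2 0 i = (z n).2 0 i -
  gamma n.+1 * ((z n.+1).1.2 0 i / Num.sqrt ((z n.+1).1.1 0 i + eps)).
Proof. by rewrite /=; case: (alg _ _ _ _ _ _ _ _ _ n) => -[v m] x /=; rewrite !mxE. Qed.

End AlgorithmStep.

Section Measurability.
Context {R : realType}.

Lemma measurable_invsqrt : measurable_fun setT (fun y : R => (Num.sqrt y)^-1).
Proof.
have -> : (fun y : R => (Num.sqrt y)^-1) = (fun y => (Num.max y 0) `^ (- 2^-1)).
  apply/funext => y; rewrite powRN powR12_sqrt; last by rewrite le_max lexx orbT.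
  by have [y0|y0] := leP y 0; rewrite ?sqrtr0// ler0_sqrtr.
apply: (measurableT_comp (measurable_powR _)).
exact: measurable_maxr.
Qed.

Lemma continuous_borel d (g : 'rV[R]_d -> R) : continuous g ->
  measurable_fun setT (g : borel_rV R d -> R).
Proof.
move=> cg; apply: (measurability _ (RGenOInfty.measurableE R)) => _ [_ [a ->] <-].
rewrite setTI; apply: sub_sigma_algebra; apply: open_comp; last exact: interval_open.
by move=> x _; exact: cg.
Qed.

End Measurability.

Section Adapted.
Context {R : realType} {d : nat} {dO dX : measure_display} {Om : measurableType dO}
  {Xi : measurableType dX} (P : probability Om R) (xi : nat -> {RV P >-> Xi}).
Context (g : 'rV[R]_d -> Xi -> 'rV[R]_d) (eps : R) (gamma h r p q : nat -> R)
  (z0 : state R d).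
Hypothesis mg : forall i : 'I_d,
  measurable_fun setT (fun y : borel_rV R d * Xi => g y.1 y.2 0 i).
Local Notation z n w := (alg g eps gamma h r p q z0 (fun k => xi k w) n).

(** Inductively, step [n.+1] involves only the iterate at time [n] and the sample [n.+1]. *)
Lemma alg_adapted n :
  [/\ forall i, measurable_fun setT (fun w : pastT xi n => (z n w).1.1 0 i),
      forall i, measurable_fun setT (fun w : pastT xi n => (z n w).1.2 0 i) &
      forall i, measurable_fun setT (fun w : pastT xi n => (z n w).2 0 i)].
Proof.
elim: n => [|n [IHv IHm IHx]]; first by split => i; exact: measurable_cst.
have mx : measurable_fun setT (fun w : pastT xi n.+1 => ((z n w).2 : borel_rV R d)).
  by apply: measurable_row => i; exact: (past_measurable_funS (IHx i)).
have mgx i : measurable_fun setT (fun w : pastT xi n.+1 => g (z n w).2 (xi n.+1 w) 0 i).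
  have mp : measurable_fun setT
      (fun w : pastT xi n.+1 => ((z n w).2 : borel_rV R d, xi n.+1 w)).
    by apply: measurable_fun_pair => //; exact: past_sample.
  exact: (measurableT_comp (@mg i) mp).
have mv i : measurable_fun setT (fun w : pastT xi n.+1 => (z n.+1 w).1.1 0 i).
  under eq_fun do rewrite alg_v.
  apply: measurable_funD; apply: measurable_funM => //.
    exact: (past_measurable_funS (IHv i)).
  exact: measurable_funX.
have mm i : measurable_fun setT (fun w : pastT xi n.+1 => (z n.+1 w).1.2 0 i).
  under eq_fun do rewrite alg_m.
  apply: measurable_funD; apply: measurable_funM => //.
  exact: (past_measurable_funS (IHm i)).
split => // i; under eq_fun do rewrite alg_x.
apply: measurable_funB; first exact: (past_measurable_funS (IHx i)).
apply: measurable_funM => //; apply: measurable_funM => //.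
apply: (measurableT_comp measurable_invsqrt).
exact: measurable_funD.
Qed.

Lemma alg_x_adapted n :
  measurable_fun setT (fun w : pastT xi n => ((z n w).2 : borel_rV R d)).
Proof. by apply: measurable_row => i; have [_ _] := alg_adapted n. Qed.

End Adapted.

(** Scalar form of the alternative between moments and sub-Gaussian tails, restricted to points of
    [A]; convergent series appear as bounded partial sums over the time steps. *)
Definition tail_bound {R : realType} {d : nat} {dX : measure_display}
  {Xi : measurableType dX} (mu : probability Xi R) (dt : nat -> R)
  (A : set 'rV[R]_d) (phi : 'rV[R]_d -> Xi -> R) (mphi : 'rV[R]_d -> R) :=
  (exists q C B : R, [/\ 2 <= q, 0 <= C,
     forall y, A y -> (\int[mu]_s (`|phi y s - mphi y| `^ q)%:E <= C%:E)%E &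
     forall n, \sum_(0 <= i < n) dt i `^ (1 + q / 2) <= B]) \/
  (exists sg : R, [/\ sg != 0,
     forall y (l : R), A y ->
      (\int[mu]_s (expR (l * (phi y s - mphi y)))%:E <=
         (expR (sg ^+ 2 * l ^+ 2 / 2))%:E)%E &
     forall alpha : R, 0 < alpha -> exists B : R, forall n,
      \sum_(0 <= i < n) expR (- (alpha / dt i)) <= B]).

Section IterateNoise.
Context {R : realType} {d : nat} {dO dX : measure_display} {Om : measurableType dO}
  {Xi : measurableType dX} (P : probability Om R) (mu : probability Xi R)
  (xi : nat -> {RV P >-> Xi}) (tm : nat -> R).
Hypothesis xi_iid : iid_with_law mu [set n | (1 <= n)%N] xi.
Hypothesis tm0 : tm 0%N = 0.
Hypothesis tm_oo : forall A : R, exists n, A <= tm n.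
Hypothesis tm_gt : forall n, tm n < tm n.+1.
Hypothesis tm_step : tm n.+1 - tm n @[n --> \oo] --> (0 : R).
Context (x : nat -> Om -> 'rV[R]_d).
Hypothesis mx : forall n, measurable_fun setT (x n : pastT xi n -> borel_rV R d).
Context (phi : 'rV[R]_d -> Xi -> R) (mphi : 'rV[R]_d -> R).
Hypothesis phi_meas : measurable_fun setT (fun y : borel_rV R d * Xi => phi y.1 y.2).
Hypothesis phi_int : forall y, mu.-integrable setT (EFin \o phi y).
Hypothesis phi_mean : forall y, \int[mu]_s phi y s = mphi y.
Hypothesis mphi_cont : continuous mphi.

Context (A : set 'rV[R]_d) (wt : nat -> R) (W : R).
Hypothesis A_closed : closed A.
Hypothesis W0 : 0 < W.
Hypothesis wt_le : forall n, `|wt n| <= W.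

Hypothesis phi_tail : tail_bound mu (fun i => tm i.+1 - tm i) A phi mphi.

(** The indicator makes the tail bounds uniform in [n] and [w]; being determined by the past, it
    preserves centring. [wt] will be the coefficient [h_n] or [p_n]. *)
Let Psi n w s : R := wt n * (\1_A (x n w) * (phi (x n w) s - mphi (x n w))).

Let phi_s y : measurable_fun setT (phi y).
Proof. by have /measurable_EFinP := measurable_int mu (phi_int y). Qed.

Let mPsi n : measurable_fun setT (fun y : pastT xi n * Xi => Psi n y.1 y.2).
Proof.
have mx1 : measurable_fun setT (fun y : pastT xi n * Xi => (x n y.1 : borel_rV R d)).
  exact: (measurableT_comp (@mx n) measurable_fst).
have mA : measurable (A : set (borel_rV R d)).
  rewrite -[A]setCK; apply: measurableC; apply: sub_sigma_algebra.
  exact: closed_openC.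
have mI : measurable_fun setT (\1_A : borel_rV R d -> R) by exact: measurable_indic.
have mxs : measurable_fun setT
    (fun y : pastT xi n * Xi => (x n y.1 : borel_rV R d, y.2)).
  by apply: measurable_fun_pair => //; exact: measurable_snd.
apply: measurable_funM => //; apply: measurable_funM.
  exact: (measurableT_comp mI mx1).
apply: measurable_funB; first exact: (measurableT_comp phi_meas mxs).
exact: (measurableT_comp (continuous_borel mphi_cont) mx1).
Qed.

Lemma iterate_noise_ae : {ae P, forall w, forall e : R, 0 < e ->
  \forall n \near \oo, forall k, (n <= k)%N -> tm k - tm n <= 1 ->
    `|\sum_(n <= i < k) (tm i.+1 - tm i) * (wt i * (\1_A (x i w) *
        (phi (x i w) (xi i.+1 w) - mphi (x i w))))| <= e}.
Proof.
have icst (c : R) : mu.-integrable setT (EFin \o cst c).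
  exact: finite_measure_integrable_cst.
case: phi_tail => [[q [C [B [q2 C0 HC HB]]]]|[sg [sg0 Hsg HB]]].
  apply: (@noise_window_moment _ _ _ _ _ P mu xi tm xi_iid tm0 tm_oo tm_gt tm_step
    Psi mPsi q (W `^ q * C) B) => //.
  - by rewrite mulr_ge0// powR_ge0.
  - move=> i w.
    have i1 := integrableB measurableT (phi_int (x i w)) (icst (mphi (x i w))).
    have i2 := integrableZl measurableT (\1_A (x i w)) i1.
    by have := integrableZl measurableT (wt i) i2.
  - move=> i w; rewrite /Psi.
    have i1 : mu.-integrable setT (EFin \o (fun s => phi (x i w) s - mphi (x i w))).
      by have := integrableB measurableT (phi_int (x i w)) (icst (mphi (x i w))).
    have i2 : mu.-integrable setT
        (EFin \o (fun s => \1_A (x i w) * (phi (x i w) s - mphi (x i w)))).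
      by have := integrableZl measurableT (\1_A (x i w)) i1.
    rewrite (RintegralZl _ measurableT i2) (RintegralZl _ measurableT i1).
    have -> : \int[mu]_s (phi (x i w) s - mphi (x i w)) = 0; last by rewrite !mulr0.
    rewrite (RintegralB measurableT (phi_int _) (icst _)) phi_mean Rintegral_cst//.
    have m1 : fine (mu setT) = 1 by rewrite (@probability_setT _ _ _ mu).
    by rewrite m1 mulr1 subrr.
  move=> i w; rewrite /Psi indicE.
  case: (boolP (x i w \in A)) => [/set_mem Ax|_]; last first.
    under eq_integral do rewrite mul0r mulr0 normr0 powR0 ?gt_eqF ?(lt_le_trans _ q2)//.
    by rewrite integral0 lee_fin mulr_ge0// powR_ge0.
  have q0 : 0 <= q by lra.
  have mpow : measurable_fun setT (fun y : R => `|y| `^ q).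
    by apply: (measurableT_comp (measurable_powR q)).
  have mphis : measurable_fun setT (fun s => phi (x i w) s - mphi (x i w)).
    by apply: measurable_funB.
  apply: (@le_trans _ _ (\int[mu]_s ((W `^ q)%:E *
      (`|phi (x i w) s - mphi (x i w)| `^ q)%:E))%E).
    apply: ge0_le_integral => //.
    - apply/measurable_EFinP; apply: (measurableT_comp mpow).
      by apply: measurable_funM => //; apply: measurable_funM.
    - apply/measurable_EFinP; apply: measurable_funM => //.
      exact: (measurableT_comp mpow).
    move=> s _; rewrite -EFinM lee_fin mul1r normrM powRM// ler_wpM2r ?powR_ge0//.
    by apply: ge0_ler_powR; rewrite ?nnegrE// ltW.
  rewrite ge0_integralZl_EFin ?powR_ge0//; last first.
    by apply/measurable_EFinP; apply: (measurableT_comp mpow).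
  rewrite EFinM; apply: lee_pmul => //; last exact: HC.
    by rewrite lee_fin powR_ge0.
  by apply: integral_ge0 => s _; rewrite lee_fin powR_ge0.
apply: (@noise_window_subgaussian _ _ _ _ _ P mu xi tm xi_iid tm0 tm_oo tm_gt
  Psi mPsi (sg * W)) => //.
  by rewrite mulf_neq0// gt_eqF.
move=> i w l; rewrite /Psi indicE.
case: (boolP (x i w \in A)) => [/set_mem Ax|_]; last first.
  under eq_integral do rewrite mul0r !mulr0 expR0.
  rewrite integral_cst// mul1e; apply: (@le_trans _ _ 1%:E); first exact: probability_le1.
  by rewrite lee_fin -expR0 ler_expR divr_ge0// mulr_ge0// sqr_ge0.
have -> : (\int[mu]_s (expR (l * (wt i * (1 * (phi (x i w) s - mphi (x i w))))))%:E =
  \int[mu]_s (expR ((l * wt i) * (phi (x i w) s - mphi (x i w))))%:E)%E.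
  by apply: eq_integral => s _; rewrite mul1r mulrA.
apply: (le_trans (Hsg _ _ Ax)); rewrite lee_fin ler_expR.
have w2 : wt i ^+ 2 <= W ^+ 2.
  by rewrite -real_normK ?num_real// lerXn2r ?nnegrE// ltW.
have -> : sg ^+ 2 * (l * wt i) ^+ 2 / 2 = sg ^+ 2 * l ^+ 2 / 2 * wt i ^+ 2 by ring.
have -> : (sg * W) ^+ 2 * l ^+ 2 / 2 = sg ^+ 2 * l ^+ 2 / 2 * W ^+ 2 by ring.
by rewrite ler_wpM2l// divr_ge0// mulr_ge0// sqr_ge0.
Qed.

End IterateNoise.

(** * Convergence of a single trajectory *)

Section RealSequences.
Context {R : realType}.

(** The shift [u i.+1] matches step [i], of length [gamma i.+1]. *)
Lemma nneseries_partial_bounded (u : nat -> R) : (forall n, 0 <= u n) ->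
  (\sum_(1 <= n <oo) (u n)%:E < +oo)%E ->
  exists B : R, forall n, \sum_(0 <= i < n) u i.+1 <= B.
Proof.
move=> u0 ufin; set l := (\sum_(1 <= n <oo) (u n)%:E)%E in ufin.
have l0 : (0 <= l)%E by apply: nneseries_ge0 => n _ _; rewrite lee_fin.
have lfin : l \is a fin_num by rewrite ge0_fin_numE.
exists (fine l) => n; rewrite -lee_fin fineK//.
rewrite -sumEFin; apply: le_trans (nneseries_lim_ge n.+1 _).
  by rewrite big_add1.
by move=> i _ _; rewrite lee_fin.
Qed.

Lemma nneseries_partial_unbounded (u : nat -> R) : (forall n, (1 <= n)%N -> 0 <= u n) ->
  (\sum_(1 <= n <oo) (u n)%:E = +oo)%E ->
  forall A : R, exists n, A <= \sum_(1 <= k < n.+1) u k.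
Proof.
move=> u0 uoo A; apply: contrapT => /forallNP H.
suff : (\sum_(1 <= n <oo) (u n)%:E <= A%:E)%E by rewrite uoo leye_eq.
apply: lime_le; first by apply: is_cvg_nneseries => n n1 _; rewrite lee_fin u0.
near=> n; rewrite sumEFin lee_fin.
have n0 : (0 < n)%N by near: n; exists 1%N.
have /negP := H n.-1; rewrite -ltNge prednK// => /ltW.
exact.
Unshelve. all: by end_near. Qed.

Lemma bounded_series_small (u : nat -> R) (B : R) : (forall n, 0 <= u n) ->
  (forall n, \sum_(0 <= i < n) u i <= B) -> u n @[n --> \oo] --> (0 : R).
Proof.
move=> u0 uB; apply: cvg_series_cvg_0; apply: nondecreasing_is_cvgn.
  by apply: nondecreasing_series => n _ _; exact: u0.
by exists B => _ [n _ <-]; exact: uB.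
Qed.

Lemma powR_cvg0_base (u : nat -> R) (a : R) : 0 < a -> (forall n, 0 <= u n) ->
  u n `^ a @[n --> \oo] --> (0 : R) -> u n @[n --> \oo] --> (0 : R).
Proof.
move=> a0 u0 ua; apply/cvgrPdist_lt => e e0.
have ea : 0 < e `^ a by exact: powR_gt0.
have /cvgrPdist_lt /(_ _ ea) := ua; apply: filterS => n.
rewrite !sub0r !normrN (ger0_norm (powR_ge0 _ _)) (ger0_norm (u0 n)) => H.
rewrite ltNge; apply/negP => eu; move: H; rewrite ltNge => /negP; apply.
by apply: ge0_ler_powR; rewrite ?nnegrE// ltW.
Qed.

Lemma expR_inv_cvg0 (u : nat -> R) : (forall n, 0 < u n) ->
  expR (- (1 / u n)) @[n --> \oo] --> (0 : R) -> u n @[n --> \oo] --> (0 : R).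
Proof.
move=> u0 ua; apply/cvgrPdist_lt => e e0.
have /cvgrPdist_lt /(_ _ (expR_gt0 (- (1 / e)))) := ua; apply: filterS => n.
rewrite !sub0r !normrN (gtr0_norm (expR_gt0 _)) (gtr0_norm (u0 n)) ltr_expR ltrN2.
by rewrite !div1r ltf_pV2// posrE.
Qed.

(** Countable sets have Lebesgue measure 0, nonempty open intervals do not. *)
Lemma itv_avoid_countable (D : set R) (a b : R) : countable D -> a < b ->
  exists2 c, a < c < b & ~ D c.
Proof.
move=> cD ab; apply: contrapT => H.
have sub : `]a, b[ `<=` D.
  move=> c; rewrite /= in_itv/= => acb; apply: contrapT => nD.
  by apply: H; exists c.
have := countable_lebesgue_measure0 (sub_countable (subset_card_le sub) cD).
rewrite lebesgue_measure_itv/= lte_fin ab -EFinD => -[].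
by move/eqP; rewrite subr_eq0 => /eqP ba; rewrite ba ltxx in ab.
Qed.

(* A sequence with vanishing increments crosses every level strictly between
   its lower and upper limits infinitely often. *)
Lemma no_crossing_cvg (u : nat -> R) (B : R) : (forall n, `|u n| <= B) ->
  u n.+1 - u n @[n --> \oo] --> (0 : R) ->
  (forall a b : R, a < b -> exists c e : R, [/\ a < c < b, 0 < e &
     \forall n \near \oo, e < `|u n - c|]) ->
  exists l : R, u n @[n --> \oo] --> l.
Proof.
move=> uB du sep.
pose U : set R := [set y | \forall n \near \oo, u n <= y].
have U0 : U B by near=> n; apply: le_trans (uB n); exact: ler_norm.
have Ulb : lbound U (- B).
  move=> y [N _ HN]; have := HN N (leqnn N); apply: le_trans.
  by have := uB N; rewrite ler_norml => /andP[].
have Uinf : has_inf U by split; [exists B | exists (- B)].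
pose b := inf U.
have up (e : R) : 0 < e -> \forall n \near \oo, u n <= b + e.
  move=> e0; have [y Uy yb] := inf_adherent e0 Uinf.
  by apply: filterS Uy => n /le_trans; apply; exact: ltW.
have lo (e : R) : 0 < e -> \forall n \near \oo, b - e <= u n.
  move=> e0; have be : b - e < b by lra.
  have [c [s [/andP[c1 c2] s0 [N1 _ HN1]]]] := sep _ _ be.
  have /cvgrPdist_le /(_ _ s0)[N2 _ HN2] := du.
  pose N := maxn N1 N2.
  have N1N n : (N <= n)%N -> (N1 <= n)%N by exact: leq_trans (leq_maxl _ _).
  have N2N n : (N <= n)%N -> (N2 <= n)%N by exact: leq_trans (leq_maxr _ _).
  have [n0 Nn0 un0] : exists2 n, (N <= n)%N & c < u n.
    apply: contrapT => H; have : U c.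
      exists N => // n /= Nn; rewrite leNgt; apply/negP => cu.
      by apply: H; exists n.
    by move=> /(ge_inf (ex_intro _ _ Ulb)); rewrite -/b; lra.
  exists n0 => // n /= n0n.
  suff : c < u n by lra.
  elim: n n0n => [|n IH]; first by rewrite leqn0 => /eqP <-.
  rewrite leq_eqVlt => /orP[/eqP <-//|n0n].
  have {}IH := IH n0n.
  have Nn : (N <= n)%N by exact: leq_trans Nn0 (n0n : (n0 <= n)%N).
  have h1 := HN1 n (N1N _ Nn); have h2 := HN1 n.+1 (N1N _ (leqW Nn)).
  have h3 := HN2 n (N2N _ Nn).
  move: h1 h2 h3; rewrite /= sub0r normrN ler_norml => h1 h2 /andP[h3 h4].
  rewrite ltNge; apply/negP => uc.
  move: h1; rewrite gtr0_norm ?subr_gt0// => h1.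
  move: h2; rewrite ler0_norm ?subr_le0// => h2.
  lra.
exists b; apply/cvgrPdist_le => e e0; near=> n; rewrite ler_norml.
have : u n <= b + e by near: n; exact: up.
have : b - e <= u n by near: n; exact: lo.
lra.
Unshelve. all: by end_near. Qed.

End RealSequences.

(** * Compactness around the critical set *)

Section CriticalPoints.
Context {R : realType} {d : nat} (F : 'rV[R]_d -> R) (G S : 'rV[R]_d -> 'rV[R]_d).
Hypothesis G_cont : forall i, continuous (fun y => G y 0 i).
Variable A : set 'rV[R]_d.
Hypothesis A_compact : compact A.

Lemma nonzero_near (g : 'rV[R]_d -> R) x : {for x, continuous g} -> g x != 0 ->
  exists (e : R) (N : nat), 0 < e /\
    forall u n, `|u - x| < e -> (N <= n)%N -> ~ (`|g u| <= n.+1%:R^-1).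
Proof.
move=> cg gx0; have gx : 0 < `|g x| by rewrite normr_gt0.
have g2 : 0 < `|g x| / 2 by rewrite divr_gt0.
have [e e0 He] := iffLR (row_continuousP g x) cg _ g2.
exists e, (Num.bound (`|g x| / 2)^-1); split => // u n ux Nn gu.
have := He u ux.
have : n.+1%:R^-1 < `|g x| / 2.
  rewrite -[ltRHS]invrK ltf_pV2 ?posrE ?invr_gt0//.
  apply: (@lt_le_trans _ _ (Num.bound (`|g x| / 2)^-1)%:R).
    by apply: archi_boundP; rewrite invr_ge0 ltW.
  by rewrite ler_nat leqW.
have := ler_normB (g u) (g u - g x).
have -> : g u - (g u - g x) = g x by ring.
move: gu; move: (n.+1%:R^-1) => t; lra.
Qed.

(** Near a critical point [g] stays away from 0, elsewhere some component of [G] does; compactness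
    makes this uniform. Used with [g = F - c] to build barriers, and with a coordinate minus [c] for
    convergence to a point. *)
Lemma grad_bounded_away (g : 'rV[R]_d -> R) : continuous g ->
  (forall y, A y -> G y = 0 -> g y != 0) ->
  exists2 e : R, 0 < e & forall y, A y -> `|g y| <= e ->
    (forall i, `|G y 0 i| <= e) -> False.
Proof.
move=> cg Hg.
pose P (n : nat) y := ~ (`|g y| <= n.+1%:R^-1 /\ forall i, `|G y 0 i| <= n.+1%:R^-1).
have [x Ax|N HN] := @compact_uniform _ _ A P A_compact.
  have [Gx|Gx] := pselect (G x = 0).
    have [e [N [e0 HN]]] := nonzero_near (cg x) (Hg x Ax Gx).
    by exists e, N; split => // u n ux Nn [gu _]; exact: (HN u n ux Nn gu).
  have [i Gi] : exists i, G x 0 i != 0.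
    apply: contrapT => /forallNP H; apply: Gx; apply/rowP => i; rewrite mxE.
    by apply/eqP; have /negP := H i; rewrite negbK.
  have [e [N [e0 HN]]] := nonzero_near (@G_cont i x) Gi.
  by exists e, N; split => // u n ux Nn [_ /(_ i)]; exact: HN.
exists N.+1%:R^-1; first by rewrite invr_gt0.
by move=> y Ay gy Gy; apply: (HN y Ay).
Qed.

Hypothesis S_cont : forall i, continuous (fun y => S y 0 i).

(** Around a critical point, that point itself is the witness; around any other point the premise
    fails for a small threshold. *)
Lemma near_critical (e : R) : 0 < e -> exists2 e' : R, 0 < e' &
  forall y, A y -> (forall i, `|G y 0 i| <= e') ->
   exists x, [/\ G x = 0, forall i, `|y 0 i - x 0 i| <= e &
     forall i, `|S y 0 i - S x 0 i| <= e].
Proof.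
move=> e0.
pose P (n : nat) y := (forall i, `|G y 0 i| <= n.+1%:R^-1) ->
   exists x, [/\ G x = 0, forall i, `|y 0 i - x 0 i| <= e &
     forall i, `|S y 0 i - S x 0 i| <= e].
have [x Ax|N HN] := @compact_uniform _ _ A P A_compact.
  have [Gx|Gx] := pselect (G x = 0).
    have near_S (I : seq 'I_d) : exists2 r : R, 0 < r & forall u, `|u - x| < r ->
        forall i, i \in I -> `|S u 0 i - S x 0 i| <= e.
      elim: I => [|j I [r r0 Hr]]; first by exists 1.
      have [r' r'0 Hr'] := iffLR (row_continuousP _ x) (@S_cont j x) _ e0.
      exists (Num.min r r'); first by rewrite lt_min r0.
      move=> u; rewrite lt_min => /andP[ur ur'] i.
      by rewrite inE => /orP[/eqP ->|]; [exact: Hr'|exact: Hr].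
    have [r r0 Hr] := near_S (index_enum 'I_d).
    exists (Num.min r e), 0%N; split; first by rewrite lt_min r0.
    move=> u n; rewrite lt_min => /andP[ur ue] _ _; exists x; split => // i.
      by have := row_coord_le (u - x) i; rewrite !mxE => /le_trans; apply; exact: ltW.
    by apply: Hr => //; rewrite mem_index_enum.
  have [i Gi] : exists i, G x 0 i != 0.
    apply: contrapT => /forallNP H; apply: Gx; apply/rowP => i; rewrite mxE.
    by apply/eqP; have /negP := H i; rewrite negbK.
  have [r [N [r0 HN]]] := nonzero_near (@G_cont i x) Gi.
  by exists r, N; split => // u n ux Nn /(_ i) H; exfalso; exact: (HN u n ux Nn H).
by exists N.+1%:R^-1; [rewrite invr_gt0|exact: HN].
Qed.

End CriticalPoints.

Section StateNorm.
Context {R : realType} {d : nat}.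

Lemma snorm_le (z : state R d) : snorm z <= norm1 z.1.1 + norm1 z.1.2 + norm1 z.2.
Proof.
have H3 (a b c : R) : 0 <= a -> 0 <= b -> 0 <= c ->
    Num.sqrt (a ^+ 2 + b ^+ 2 + c ^+ 2) <= a + b + c.
  move=> a0 b0 c0; rewrite -[leRHS]ger0_norm ?addr_ge0// -sqrtr_sqr.
  apply: ler_wsqrtr; have := mulr_ge0 a0 b0; have := mulr_ge0 a0 c0.
  have := mulr_ge0 b0 c0; rewrite !expr2; lra.
apply: (le_trans (H3 _ _ _ (enorm_ge0 _) (enorm_ge0 _) (enorm_ge0 _))).
by rewrite !lerD// enorm_le_norm1.
Qed.

Lemma snorm_coord (z : state R d) i : [/\ `|z.1.1 0 i| <= snorm z,
  `|z.1.2 0 i| <= snorm z & `|z.2 0 i| <= snorm z].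
Proof.
have H (a b c : R) : 0 <= a -> a <= Num.sqrt (a ^+ 2 + b ^+ 2 + c ^+ 2).
  move=> a0; rewrite -{1}[a]ger0_norm// -sqrtr_sqr; apply: ler_wsqrtr.
  have := sqr_ge0 b; have := sqr_ge0 c; lra.
split; apply: (le_trans (enorm_coord _ i)); rewrite /snorm.
- exact/H/enorm_ge0.
- by rewrite (addrC (enorm z.1.1 ^+ 2)); exact/H/enorm_ge0.
- by rewrite addrC addrA; exact/H/enorm_ge0.
Qed.

Lemma norm1_le u (e : R) : (forall i, `|(u : 'rV[R]_d) 0 i| <= e) -> norm1 u <= d%:R * e.
Proof.
move=> H; apply: (@le_trans _ _ (\sum_(i < d) e)); first exact: ler_sum.
by rewrite sumr_const card_ord mulr_natl.
Qed.

Lemma sdist_cvg0 (zn : nat -> state R d) (A : set (state R d)) :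
  (forall e : R, 0 < e -> \forall n \near \oo, exists2 a, A a & snorm (zn n - a) <= e) ->
  sdist (zn n) A @[n --> \oo] --> 0%E.
Proof.
move=> H.
have ge0 n : (0 <= sdist (zn n) A)%E.
  by apply: le_ereal_inf_tmp => _ [a _ <-]; rewrite lee_fin sqrtr_ge0.
have le_e (e : R) : 0 < e -> \forall n \near \oo, (sdist (zn n) A <= e%:E)%E.
  move=> e0; have := H e e0; apply: filterS => n [a Aa ae].
  apply: (@le_trans _ _ (snorm (zn n - a))%:E); last by rewrite lee_fin.
  by apply: ereal_inf_lbound; exists a.
apply/fine_cvgP; split.
  have := le_e 1 ltr01; apply: filterS => n H1.
  by rewrite ge0_fin_numE//; apply: le_lt_trans H1 _; exact: ltry.
apply/cvgrPdist_le => e e0; have := le_e e e0; apply: filterS => n H1.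
rewrite sub0r normrN ger0_norm ?fine_ge0//=.
have fin : sdist (zn n) A \is a fin_num.
  by rewrite ge0_fin_numE//; apply: le_lt_trans H1 _; exact: ltry.
by rewrite -lee_fin fineK.
Qed.

Lemma row_cvg (u : nat -> 'rV[R]_d) (l : 'rV[R]_d) :
  (forall i, u n 0 i @[n --> \oo] --> l 0 i) -> u n @[n --> \oo] --> l.
Proof.
move=> H; apply/cvgrPdist_le => e e0.
have E (I : seq 'I_d) : \forall n \near \oo, forall i, i \in I -> `|l 0 i - u n 0 i| <= e / (d%:R + 1).
  elim: I => [|j I IH]; first by near=> n.
  have e1 : 0 < e / (d%:R + 1) by rewrite divr_gt0// ltr_wpDl.
  have /cvgrPdist_le /(_ _ e1) Hj := H j.
  near=> n; move=> i; rewrite inE => /orP[/eqP ->|iI]; first by near: n.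
  by move: i iI; near: n.
have := E (index_enum 'I_d); apply: filterS => n Hn.
apply: (le_trans (norm_le_norm1 _)); apply: (@le_trans _ _ (d%:R * (e / (d%:R + 1)))).
  by apply: norm1_le => i; rewrite !mxE; apply: Hn; rewrite mem_index_enum.
rewrite mulrA ler_pdivrMr ?ltr_wpDl// mulrC ler_wpM2l ?(ltW e0)//.
by rewrite lerDl.
Unshelve. all: by end_near. Qed.

End StateNorm.

Section Box.
Context {R : realType} {d : nat}.

Definition box (C : R) : set 'rV[R]_d := [set y | forall i, `[- C, C]%classic (y 0 i)].

Lemma box_compact (C : R) : compact (box C).
Proof. by apply: (@rV_compact _ _ (fun=> `[- C, C]%classic)) => i; exact: segment_compact. Qed.

Lemma box_closed (C : R) : closed (box C).
Proof. by apply: compact_closed; [exact: norm_hausdorff|exact: box_compact]. Qed.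

End Box.

(** * From the averaged dynamics to the limit set *)

Section Pathwise.
Context {R : realType} {d : nat} (F : 'rV[R]_d -> R) (G S : 'rV[R]_d -> 'rV[R]_d).
Hypothesis loc : forall x, exists e K : R, [/\ 0 < e, 0 <= K &
  forall u v, `|u - x| < e -> `|v - x| < e ->
  [/\ forall i, `|G u 0 i - G v 0 i| <= K * norm1 (u - v),
      forall i, `|S u 0 i - S v 0 i| <= K * norm1 (u - v) &
      `|F u - F v - dotv (G v) (u - v)| <= K * norm1 (u - v) ^+ 2]].
Hypothesis S_ge0 : forall y i, 0 <= S y 0 i.
Hypothesis sard : forall a b : R, a < b ->
  exists2 c, a < c < b & forall y, G y = 0 -> F y != c.

Context (tm : nat -> R).
Hypothesis tm_nd : {homo tm : n k / (n <= k)%N >-> n <= k}.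
Hypothesis tm_oo : forall A : R, exists n, A <= tm n.
Hypothesis tm_step : tm n.+1 - tm n @[n --> \oo] --> (0 : R).
Context (h r p q : nat -> R) (hoo roo poo qoo eps : R).
Hypotheses (h_lim : h n @[n --> \oo] --> hoo) (r_lim : r n @[n --> \oo] --> roo)
  (p_lim : p n @[n --> \oo] --> poo) (q_lim : q n @[n --> \oo] --> qoo).
Hypotheses (hoo0 : 0 < hoo) (poo0 : 0 <= poo) (qoo0 : 0 < qoo)
  (rq : qoo / 4 < roo) (eps0 : 0 < eps).
Context (z : nat -> state R d) (C : R) (nv nm : 'I_d -> nat -> R).
Hypothesis z_bounded : forall n i, [/\ `|(z n).1.1 0 i| <= C, `|(z n).1.2 0 i| <= C &
  `|(z n).2 0 i| <= C].
Hypothesis v_ge0 : forall n i, 0 <= (z n).1.1 0 i.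
Hypothesis v_rec : forall i n, (z n.+1).1.1 0 i - (z n).1.1 0 i =
  (tm n.+1 - tm n) * (p n * S (z n).2 0 i - q n * (z n).1.1 0 i) + nv i n.
Hypothesis m_rec : forall i n, (z n.+1).1.2 0 i - (z n).1.2 0 i =
  (tm n.+1 - tm n) * (h n * G (z n).2 0 i - r n * (z n).1.2 0 i) + nm i n.
Hypothesis x_rec : forall i n, (z n.+1).2 0 i - (z n).2 0 i =
  - ((tm n.+1 - tm n) * ((z n.+1).1.2 0 i / Num.sqrt ((z n.+1).1.1 0 i + eps))).
Hypothesis nv_small : forall i (e : R), 0 < e -> \forall n \near \oo, forall k,
  (n <= k)%N -> tm k - tm n <= 1 -> `|\sum_(n <= l < k) nv i l| <= e.
Hypothesis nm_small : forall i (e : R), 0 < e -> \forall n \near \oo, forall k,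
  (n <= k)%N -> tm k - tm n <= 1 -> `|\sum_(n <= l < k) nm i l| <= e.

Let A : set 'rV[R]_d := box C.

Let A_compact : compact A.
Proof. exact: box_compact. Qed.

Let zA n : A (z n).2.
Proof. by move=> i /=; rewrite in_itv/= -ler_norml; have [] := z_bounded n i. Qed.

Let G_cont i : continuous (fun y => G y 0 i).
Proof. by move=> x; have [_ + _] := taylor_continuous loc x; apply. Qed.

Let S_cont i : continuous (fun y => S y 0 i).
Proof. by move=> x; have [_ _] := taylor_continuous loc x; apply. Qed.

Let F_cont : continuous F.
Proof. by move=> x; have [] := taylor_continuous loc x. Qed.

Lemma pathwise_dynamics : [/\ forall i, (z n).1.2 0 i @[n --> \oo] --> (0 : R),
  forall i, G (z n).2 0 i @[n --> \oo] --> (0 : R) &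
  forall i, (z n).1.1 0 i - poo / qoo * S (z n).2 0 i @[n --> \oo] --> (0 : R)].
Proof.
have [B [L [L0 HB HL]]] := compact_regularity loc A_compact.
pose M := `|B| + `|C|.
have BM : B <= M by apply: (le_trans (ler_norm B)); rewrite lerDl.
have CM : C <= M by apply: (le_trans (ler_norm C)); rewrite lerDr.
(* [L * d] is needed in the Taylor bound, where the squared [norm1] is at most [d] times the sum of
   squares; one constant serves all three estimates. *)
have L'0 : 0 <= L + L * d%:R by rewrite addr_ge0// mulr_ge0.
have LL : L <= L + L * d%:R by rewrite lerDl mulr_ge0.
have lipS (g : 'rV[R]_d -> R) n k : `|g (z k).2 - g (z n).2| <= L * norm1 ((z k).2 - (z n).2) ->
    `|g (z k).2 - g (z n).2| <= (L + L * d%:R) * \sum_j `|(z k).2 0 j - (z n).2 0 j|.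
  have -> : norm1 ((z k).2 - (z n).2) = \sum_j `|(z k).2 0 j - (z n).2 0 j|.
    by apply: eq_bigr => j _; rewrite !mxE.
  by move=> H; apply: (le_trans H); rewrite ler_wpM2r// sumr_ge0.
apply: (dynamics_cvg tm_nd tm_oo tm_step (F := fun n => F (z n).2)
  (v := fun i n => (z n).1.1 0 i) (m := fun i n => (z n).1.2 0 i)
  (x := fun i n => (z n).2 0 i) (G := fun i n => G (z n).2 0 i)
  (S := fun i n => S (z n).2 0 i) (B := M) (L := L + L * d%:R)
  (eps := eps) (nv := nv) (nm := nm) _ _ _ _ _ _ _ _ _ _ _ h_lim r_lim p_lim q_lim) => //.
- by move=> n; have [H _ _] := HB _ (zA n); exact: le_trans H BM.
- by move=> i n; have [H _ _] := z_bounded n i; exact: le_trans H CM.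
- by move=> i n; have [_ H _] := z_bounded n i; exact: le_trans H CM.
- by move=> i n; have [_ H _] := HB _ (zA n); exact: le_trans (H i) BM.
- by move=> i n; have [_ _ H] := HB _ (zA n); exact: le_trans (H i) BM.
- move=> n k; have [_ _ H] := HL _ _ (zA k) (zA n).
  have E : dotv (G (z n).2) ((z k).2 - (z n).2) =
     \sum_i G (z n).2 0 i * ((z k).2 0 i - (z n).2 0 i).
    by apply: eq_bigr => j _; rewrite !mxE.
  have E2 : \sum_i ((z k).2 - (z n).2) 0 i ^+ 2 = \sum_i ((z k).2 0 i - (z n).2 0 i) ^+ 2.
    by apply: eq_bigr => j _; rewrite !mxE.
  have := norm1_sq ((z k).2 - (z n).2); rewrite E2 => H2.
  move: H; rewrite E => /(le_trans (ler_norm _)).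
  have := ler_wpM2l L0 H2; rewrite mulrA.
  set SS := \sum_i _ ^+ 2 => H3 H4.
  have : 0 <= L * SS by rewrite mulr_ge0// sumr_ge0// => i _; exact: sqr_ge0.
  rewrite mulrDl; lra.
- by move=> i n k; apply: (lipS (fun y => G y 0 i)); have [H _ _] := HL _ _ (zA k) (zA n).
- by move=> i n k; apply: (lipS (fun y => S y 0 i)); have [_ H _] := HL _ _ (zA k) (zA n).
- by move=> i; apply: winO_small; exact: nv_small.
- by move=> i; apply: winO_small; exact: nm_small.
(* A regular value between [a] and [b] is the barrier; compactness gives its width. *)
move=> a b ab; have [c /andP[ac cb] Hc] := sard ab.
have [|y Ay Gy|e e0 He] := @grad_bounded_away _ _ G G_cont A A_compact (fun y => F y - c).
- move=> y; apply: continuousB; first exact: F_cont.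
  exact: cst_continuous.
- by rewrite subr_eq0; exact: Hc.
exists c, (Num.min e (Num.min ((c - a) / 2) ((b - c) / 2))); split.
- by rewrite !lt_min e0 !divr_gt0// subr_gt0.
- have : Num.min e (Num.min ((c - a) / 2) ((b - c) / 2)) <= (c - a) / 2.
    by rewrite !ge_min lexx orbT.
  lra.
- have : Num.min e (Num.min ((c - a) / 2) ((b - c) / 2)) <= (b - c) / 2.
    by rewrite !ge_min lexx !orbT.
  lra.
- move=> n Hn HG; have le : Num.min e (Num.min ((c - a) / 2) ((b - c) / 2)) <= e.
    by rewrite ge_min lexx.
  apply: (He _ (zA n)); first exact: le_trans Hn le.
  by move=> i; exact: le_trans (HG i) le.
Qed.

Let limit_point y : state R d := ((poo / qoo) *: S y, 0 : 'rV[R]_d, y).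

Let near_all (P : 'I_d -> nat -> Prop) : (forall i, \forall n \near \oo, P i n) ->
  \forall n \near \oo, forall i, P i n.
Proof.
move=> H.
have E (I : seq 'I_d) : \forall n \near \oo, forall i, i \in I -> P i n.
  elim: I => [|j I IH]; first by near=> n.
  near=> n; move=> i; rewrite inE => /orP[/eqP ->|iI]; first by near: n.
  by move: i iI; near: n.
have := E (index_enum 'I_d); apply: filterS => n Hn i.
by apply: Hn; rewrite mem_index_enum.
Unshelve. all: by end_near. Qed.

Let small_all (u : 'I_d -> nat -> R) : (forall i, u i n @[n --> \oo] --> (0 : R)) ->
  forall e : R, 0 < e -> \forall n \near \oo, forall i, `|u i n| <= e.
Proof.
move=> H e e0; apply: near_all => i.
have /cvgrPdist_le /(_ e e0) := H i; apply: filterS => n.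
by rewrite sub0r normrN.
Qed.

Lemma pathwise_set (e : R) : 0 < e -> \forall n \near \oo,
  exists2 y, G y = 0 & snorm (z n - limit_point y) <= e.
Proof.
move=> e0; have [Hm HG Hv] := pathwise_dynamics.
(* Three vectors of [d] coordinates, each at most [t], total less than [e]. The smaller [t'] is due
   to errors in [S] being multiplied by [poo / qoo]. *)
pose t := e / (3 * (d%:R + 1)).
have t0 : 0 < t by rewrite divr_gt0// mulr_gt0// ltr_wpDl.
pose c := poo / qoo.
have c0 : 0 <= c by rewrite divr_ge0// ltW.
pose t' := t / (2 * (1 + c)).
have t'0 : 0 < t' by rewrite divr_gt0// mulr_gt0// ltr_wpDr.
have t't : t' <= t.
  rewrite /t' ler_pdivrMr ?mulr_gt0 ?ltr_wpDr// mulrDr mulr1.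
  have := mulr_ge0 (ltW t0) c0; lra.
have ct' : c * t' <= t / 2.
  have -> : t / 2 = (1 + c) * t'.
    by rewrite /t'; field; rewrite gt_eqF// ltr_wpDr.
  by rewrite ler_wpM2r ?(ltW t'0)// lerDr.
have [e' e'0 He'] := near_critical G_cont A_compact S_cont t'0.
have t20 : 0 < t / 2 by rewrite divr_gt0.
near=> n.
have Gn : forall i, `|G (z n).2 0 i| <= e' by near: n; exact: (small_all HG).
have vn : forall i, `|(z n).1.1 0 i - c * S (z n).2 0 i| <= t / 2.
  by near: n; exact: (small_all Hv).
have mn : forall i, `|(z n).1.2 0 i| <= t by near: n; exact: (small_all Hm).
have [y [Gy yx yS]] := He' _ (zA n) Gn.
exists y => //; apply: (le_trans (snorm_le _)) => /=.
have n1 : norm1 ((z n).1.1 - c *: S y) <= d%:R * t.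
  apply: norm1_le => i; rewrite !mxE.
  have -> : (z n).1.1 0 i - c * S y 0 i = ((z n).1.1 0 i - c * S (z n).2 0 i) +
     c * (S (z n).2 0 i - S y 0 i) by ring.
  apply: (le_trans (ler_normD _ _)); rewrite normrM (ger0_norm c0).
  have := vn i; have := ler_wpM2l c0 (yS i); lra.
have n2 : norm1 ((z n).1.2 - 0) <= d%:R * t.
  by apply: norm1_le => i; rewrite subr0.
have n3 : norm1 ((z n).2 - y) <= d%:R * t.
  by apply: norm1_le => i; rewrite !mxE; exact: le_trans (yx i) t't.
have : d%:R * t + t = e / 3.
  rewrite -{2}[t]mul1r -mulrDl /t; field.
  by rewrite gt_eqF// ltr_wpDl.
move: n1 n2 n3; rewrite -/c; lra.
Unshelve. all: by end_near. Qed.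

(** Coordinates of [x] are treated one at a time. The [i]-th coordinates of critical points form a
    countable set, so every interval contains a level that none of them takes; the iterates
    eventually keep away from it and, with vanishing steps, cannot keep crossing it. *)
Lemma pathwise_point : countable [set y | G y = 0] ->
  exists2 y, G y = 0 & z n @[n --> \oo] --> limit_point y.
Proof.
move=> cG; have [Hm HG Hv] := pathwise_dynamics.
(* [m] is bounded and the denominator is at least the square root of [eps]. *)
have dx i : (z n.+1).2 0 i - (z n).2 0 i @[n --> \oo] --> (0 : R).
  have s0 : 0 < Num.sqrt eps by rewrite sqrtr_gt0.
  have C1 : 0 < `|C| + 1 by rewrite ltr_wpDl.
  apply/cvgrPdist_le => e e0.
  have e1 : 0 < e * Num.sqrt eps / (`|C| + 1) by rewrite divr_gt0// mulr_gt0.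
  have /cvgrPdist_le /(_ _ e1) := tm_step; apply: filterS => n.
  rewrite !sub0r !normrN x_rec normrN normrM => H.
  have a1 : `|(z n.+1).1.2 0 i / Num.sqrt ((z n.+1).1.1 0 i + eps)| <= (`|C| + 1) / Num.sqrt eps.
    rewrite normrM; apply: ler_pM => //.
      have [_ H1 _] := z_bounded n.+1 i; apply: (le_trans H1).
      by have := ler_norm C; lra.
    rewrite ger0_norm ?invr_ge0 ?sqrtr_ge0// lef_pV2 ?posrE// ?sqrtr_gt0 ?ltr_wpDl//.
    by apply: ler_wsqrtr; rewrite lerDr.
  apply: (le_trans (ler_pM _ _ H a1)) => //.
  by rewrite le_eqVlt; apply/orP; left; apply/eqP; field; rewrite !gt_eqF.
have cvx i : exists l : R, (z n).2 0 i @[n --> \oo] --> l.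
  apply: (@no_crossing_cvg _ _ C) => //; first by move=> n; have [] := z_bounded n i.
  move=> a b ab.
  have cD : countable [set y 0 i | y in [set y | G y = 0]].
    exact: (sub_countable (card_image_le _ _) cG).
  have [c acb Hc] := itv_avoid_countable cD ab.
  have [|y Ay Gy|e e0 He] := @grad_bounded_away _ _ G G_cont A A_compact (fun y => y 0 i - c).
  - move=> y; apply: continuousB; first exact: coord_continuous.
    exact: cst_continuous.
  - by rewrite subr_eq0; apply/eqP => yc; apply: Hc; exists y.
  exists c, e; split => //.
  have := small_all HG e0; apply: filterS => n Gn.
  by rewrite ltNge; apply/negP => H; exact: (He _ (zA n) H Gn).
have [l Hl] := choice cvx.
pose y : 'rV[R]_d := \row_i l i.
have xy : (z n).2 @[n --> \oo] --> y by apply: row_cvg => i; rewrite mxE.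
have Gy : G y = 0.
  apply/rowP => i; rewrite mxE.
  have c1 : G (z n).2 0 i @[n --> \oo] --> G y 0 i.
    exact: (continuous_cvg _ (@G_cont i y) xy).
  exact: (cvg_unique (@norm_hausdorff _ R) c1 (HG i)).
exists y => //.
have cv : (z n).1.1 @[n --> \oo] --> (poo / qoo) *: S y.
  apply: row_cvg => i; rewrite mxE.
  have cS : S (z n).2 0 i @[n --> \oo] --> S y 0 i.
    exact: (continuous_cvg _ (@S_cont i y) xy).
  have cS' : poo / qoo * S (z n).2 0 i @[n --> \oo] --> poo / qoo * S y 0 i.
    by apply: cvgM => //; exact: cvg_cst.
  rewrite -[X in _ --> X]add0r.
  have -> : (fun n => (z n).1.1 0 i) =
      (fun n => ((z n).1.1 0 i - poo / qoo * S (z n).2 0 i) + poo / qoo * S (z n).2 0 i).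
    by apply/funext => n; rewrite subrK.
  exact: (cvgD (Hv i) cS').
have cm : (z n).1.2 @[n --> \oo] --> (0 : 'rV[R]_d).
  by apply: row_cvg => i; rewrite mxE; exact: Hm.
have -> : z = (fun n => ((z n).1.1, (z n).1.2, (z n).2)).
  by apply/funext => n; case: (z n) => [[? ?] ?].
exact: (cvg_pair (cvg_pair cv cm) xy).
Qed.

End Pathwise.

(** * The stochastic algorithm *)

Section Times.
Context {R : realType} (gamma : nat -> R).
Hypothesis gamma_gt0 : forall n, (1 <= n)%N -> 0 < gamma n.

Lemma tau0 : tau gamma 0 = 0.
Proof. by rewrite /tau big_geq. Qed.

Lemma tauS n : tau gamma n.+1 - tau gamma n = gamma n.+1.
Proof. by rewrite /tau [X in X - _]big_nat_recr//= addrAC subrr add0r. Qed.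

Lemma tau_lt n : tau gamma n < tau gamma n.+1.
Proof. by rewrite -subr_gt0 tauS gamma_gt0. Qed.

Lemma tau_homo : {homo tau gamma : n k / (n <= k)%N >-> n <= k}.
Proof. by apply: homo_leq => // [x y z|n]; [exact: le_trans|exact/ltW/tau_lt]. Qed.

Lemma tau_gt0 n : (0 < n)%N -> 0 < tau gamma n.
Proof.
case: n => // n _; apply: le_lt_trans (tau_lt n).
by rewrite -tau0; exact: tau_homo.
Qed.

Hypothesis gamma_sum : (\sum_(1 <= n <oo) (gamma n)%:E = +oo)%E.

Lemma tau_unbounded (A : R) : exists n, A <= tau gamma n.
Proof. by apply: nneseries_partial_unbounded => // n n1; exact/ltW/gamma_gt0. Qed.

Lemma tau_cvgy : tau gamma n @[n --> \oo] --> +oo.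
Proof.
apply/cvgryPge => A; have [n An] := tau_unbounded A.
by exists n => // k /= nk; exact: le_trans (tau_homo nk).
Qed.

Lemma coef_cvg (c0 l : R) (c : R -> R) : c t @[t --> +oo] --> l ->
  coef gamma c0 c n @[n --> \oo] --> l.
Proof.
move=> cl; apply/cvgrPdist_le => e e0.
(* Index 0 is excluded, since it carries the free initial coefficient. *)
have /cvgrPdist_le /(_ e e0) := cvg_comp _ _ tau_cvgy cl; apply: filterS2 (nbhs_infty_gt 0).
by case=> // n _.
Qed.

Lemma coef_ge0 (c0 : R) (c : R -> R) : 0 < c0 -> (forall t, 0 < t -> 0 <= c t) ->
  forall n, 0 <= coef gamma c0 c n.
Proof. by move=> /ltW ? H [|n] //=; apply/H/tau_gt0. Qed.

End Times.

(** * Tail estimates for the stochastic gradient *)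

Section Tails.
Context {R : realType} {d : nat} {dX : measure_display} {Xi : measurableType dX}
  (mu : probability Xi R).

Lemma powR_distD (a b c : R) : 0 <= a -> `|b - c| `^ a <= 2 `^ a * (`|b| `^ a + `|c| `^ a).
Proof.
move=> a0; pose m := Num.max `|b| `|c|.
have bm : `|b| <= m by rewrite le_max lexx.
have cm : `|c| <= m by rewrite le_max lexx orbT.
have m0 : 0 <= m by exact: le_trans bm.
apply: (@le_trans _ _ ((2 * m) `^ a)).
  apply: ge0_ler_powR; rewrite ?nnegrE ?mulr_ge0//.
  by apply: (le_trans (ler_normB _ _)); lra.
rewrite powRM// ler_wpM2l ?powR_ge0// /m.
by case: (leP `|b| `|c|) => _; [rewrite lerDr|rewrite lerDl]; exact: powR_ge0.
Qed.

Lemma integral_const (c : R) : (\int[mu]_s c%:E = c%:E)%E.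
Proof. by have := expectation_cst mu c; rewrite unlock. Qed.

Lemma centered_moment (Y : Xi -> R) (a b B C : R) : 0 <= a -> `|b| <= B ->
  measurable_fun setT Y -> (\int[mu]_s (`|Y s| `^ a)%:E <= C%:E)%E ->
  (\int[mu]_s (`|Y s - b| `^ a)%:E <= (2 `^ a * (C + B `^ a))%:E)%E.
Proof.
move=> a0 bB mY YC.
have mpow : measurable_fun setT (fun y : R => `|y| `^ a).
  by apply: (measurableT_comp (measurable_powR a)).
apply: (@le_trans _ _ (\int[mu]_s ((2 `^ a)%:E * ((`|Y s| `^ a)%:E + (B `^ a)%:E)))%E).
  apply: ge0_le_integral => //.
  - apply/measurable_EFinP; apply: (measurableT_comp mpow).
    exact: measurable_funB.
  - apply: measurable_funeM; apply: emeasurable_funD => //.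
    by apply/measurable_EFinP; exact: (measurableT_comp mpow).
  - move=> s _; rewrite -EFinD -EFinM lee_fin; apply: (le_trans (powR_distD _ _ a0)).
    rewrite ler_wpM2l ?powR_ge0// lerD2l; apply: ge0_ler_powR; rewrite ?nnegrE//.
    exact: le_trans bB.
have mYa : measurable_fun setT (fun s => (`|Y s| `^ a)%:E).
  by apply/measurable_EFinP; exact: (measurableT_comp mpow).
rewrite ge0_integralZl_EFin ?powR_ge0//; last 2 first.
- by move=> s _; rewrite -EFinD lee_fin addr_ge0 ?powR_ge0.
- exact: emeasurable_funD.
rewrite EFinM; apply: lee_pmul => //.
- by apply: integral_ge0 => s _; rewrite -EFinD lee_fin addr_ge0 ?powR_ge0.
rewrite ge0_integralD//; last by move=> s _; rewrite lee_fin powR_ge0.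
rewrite integral_const EFinD.
exact: leeD2r.
Qed.

Context (f : 'rV[R]_d -> Xi -> R) (gamma : nat -> R).
Hypothesis gamma_gt0 : forall n, (1 <= n)%N -> 0 < gamma n.
Hypothesis mgrad : forall y (i : 'I_d), measurable_fun setT (fun s => gradf f y s 0 i).

Hypothesis moment_or_subgaussian :
    (exists a : R,
      [/\ 2 <= a,
          forall K : set 'rV[R]_d, compact K ->
            (ereal_sup [set 'E_mu[(fun s => enorm (gradf f x s) `^ (2 * a))%R]
                       | x in K] < +oo)%E &
          (\sum_(1 <= n <oo) (gamma n `^ (1 + a / 2))%R%:E < +oo)%E])
    \/
    ((forall K : set 'rV[R]_d, compact K ->
        exists2 sigma : R, sigma != 0 & forall x u : 'rV[R]_d,
          ('E_mu[(fun s => expR (dotv u (gradf f x s - grad (objF mu f) x)))%R]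
             * (\1_K x)%:E
           <= (expR (sigma ^+ 2 * enorm u ^+ 2 / 2))%R%:E)%E /\
          ('E_mu[(fun s => expR (dotv u (sqv (gradf f x s) - objS mu f x)))%R]
             * (\1_K x)%:E
           <= (expR (sigma ^+ 2 * enorm u ^+ 2 / 2))%R%:E)%E) /\
     (forall alpha : R, 0 < alpha ->
        (\sum_(1 <= n <oo) (expR (- (alpha / gamma n)))%R%:E < +oo)%E)).

(** Vanishing steps follow from summability: of a positive power of [gamma] in one case, of
    [exp(-1/gamma)] in the other. *)
Lemma gamma_cvg0 : gamma n.+1 @[n --> \oo] --> (0 : R).
Proof.
have g0 n : 0 < gamma n.+1 by exact: gamma_gt0.
case: moment_or_subgaussian => [[a [a2 _ sum]]|[_ /(_ 1 ltr01) sum]].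
  have [B HB] := nneseries_partial_bounded (fun n => powR_ge0 _ _) sum.
  apply: (@powR_cvg0_base _ _ (1 + a / 2)); first by lra.
    by move=> n; exact/ltW.
  by apply: (bounded_series_small _ HB) => n; exact: powR_ge0.
have [B HB] := nneseries_partial_bounded (fun n => ltW (expR_gt0 _)) sum.
apply: expR_inv_cvg0 => //.
by apply: (bounded_series_small _ HB) => n; exact/ltW/expR_gt0.
Qed.

Lemma enorm_powR (u : 'rV[R]_d) (a : R) : enorm u `^ (2 * a) = (\sum_j u 0 j ^+ 2) `^ a.
Proof.
rewrite powRrM powR_mulrn ?enorm_ge0// sqr_sqrtr//.
by apply: sumr_ge0 => j _; exact: sqr_ge0.
Qed.

(** The moment of order [2 * a] controls the order [a] of the gradient and of its square alike. In
    the sub-Gaussian case, the test vector [l] times a basis vector isolates one coordinate. *)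
Lemma tail_bound_coord (K : set 'rV[R]_d) (phi : 'rV[R]_d -> Xi -> 'rV[R]_d)
    (m : 'rV[R]_d -> 'rV[R]_d) (i : 'I_d) : compact K ->
  (forall y, measurable_fun setT (fun s => phi y s 0 i)) ->
  continuous (fun y => m y 0 i) ->
  (forall a y s, 2 <= a -> `|phi y s 0 i| `^ a <= 1 + enorm (gradf f y s) `^ (2 * a)) ->
  (phi = gradf f /\ m = grad (objF mu f)) \/ (phi = (fun y s => sqv (gradf f y s)) /\ m = objS mu f) ->
  tail_bound mu (fun n => tau gamma n.+1 - tau gamma n) K (fun y s => phi y s 0 i)
    (fun y => m y 0 i).
Proof.
move=> cK mphi0 cm phia phim.
case: moment_or_subgaussian => [[a [a2 supK sum]]|[sub sum]].
  left; have a0 : 0 <= a by lra.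
  have [Bm HBm] := compact_continuous_bounded cK cm.
  have [B HB] := nneseries_partial_bounded (fun n => powR_ge0 _ _) sum.
  (* The supremum lives in the extended reals, and is [-oo] when [K] is empty; the maximum with 0
     gives a real bound in all cases. *)
  have [C C0 HC] : exists2 C : R, 0 <= C & forall y, K y ->
      (\int[mu]_s (enorm (gradf f y s) `^ (2 * a))%:E <= C%:E)%E.
    have := supK _ cK; set su := ereal_sup _ => sufin.
    have Hsu y : K y -> (\int[mu]_s (enorm (gradf f y s) `^ (2 * a))%:E <= su)%E.
      by move=> Ky; apply: ereal_sup_ubound; exists y => //; rewrite unlock.
    exists (Num.max 0 (fine su)); first by rewrite le_max lexx.
    move=> y Ky; have := Hsu y Ky; move: sufin; case: su {Hsu} => [r _| |_] //=.
      by move=> H; apply: (le_trans H); rewrite lee_fin le_max lexx orbT.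
    by rewrite leeNy_eq => /eqP ->; rewrite leNye.
  exists a, (2 `^ a * (1 + C + (Num.max 0 Bm) `^ a)), B; split => //.
  - by rewrite mulr_ge0 ?powR_ge0// addr_ge0 ?powR_ge0// addr_ge0.
  - move=> y Ky; apply: centered_moment => //.
      by rewrite le_max (HBm _ Ky) orbT.
    have mE : measurable_fun setT (fun s => (enorm (gradf f y s) `^ (2 * a))%:E).
      apply/measurable_EFinP; under eq_fun do rewrite enorm_powR.
      apply: (measurableT_comp (measurable_powR a)).
      by apply: measurable_sum => j; exact: measurable_funX.
    apply: (@le_trans _ _ (\int[mu]_s (1 + (enorm (gradf f y s) `^ (2 * a))%:E))%E).
      apply: ge0_le_integral => //.
      - apply/measurable_EFinP; apply: (measurableT_comp (measurable_powR a)).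
        exact: (measurableT_comp _ (mphi0 y)).
      - exact: emeasurable_funD.
      - by move=> s _; rewrite -EFinD lee_fin phia.
    rewrite ge0_integralD//; last by move=> s _; rewrite lee_fin powR_ge0.
    rewrite integral_const EFinD.
    by apply: leeD2l; exact: HC.
  - by move=> n; under eq_bigr do rewrite tauS; exact: HB.
right; have [sg sg0 Hsg] := sub _ cK; exists sg; split => // [y l Ky|alpha alpha0].
  have dl (u : 'rV[R]_d) : dotv (l *: delta_mx 0 i) u = l * u 0 i.
    rewrite /dotv (bigD1 i)//= !mxE !eqxx mulr1 big1 ?addr0// => j /negbTE ji.
    by rewrite !mxE ji andbF mulr0 mul0r.
  have el : enorm (l *: delta_mx 0 i : 'rV[R]_d) ^+ 2 = l ^+ 2.
    rewrite sqr_sqrtr; last by apply: sumr_ge0 => j _; exact: sqr_ge0.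
    rewrite (bigD1 i)//= !mxE !eqxx mulr1 big1 ?addr0// => j /negbTE ji.
    by rewrite !mxE ji andbF mulr0 expr0n.
  have [] := Hsg y (l *: delta_mx 0 i); rewrite el indicE mem_set// !mule1 unlock => H1 H2.
  have E (g : Xi -> 'rV[R]_d) (c : 'rV[R]_d) :
      (\int[mu]_s (expR (l * (g s 0 i - c 0 i)))%:E =
       \int[mu]_s (expR (dotv (l *: delta_mx 0 i) (g s - c)))%:E)%E.
    by apply: eq_integral => s _; rewrite dl !mxE.
  by case: phim => -[-> ->]; rewrite E.
have [B HB] := nneseries_partial_bounded (fun n => ltW (expR_gt0 _)) (sum _ alpha0).
by exists B => n; under eq_bigr do rewrite tauS; exact: HB.
Qed.

End Tails.

Lemma ae_forall_ord {dO : measure_display} {Om : measurableType dO} {R : realType}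
    (P : probability Om R) (d : nat) (Q : 'I_d -> Om -> Prop) :
  (forall i, {ae P, forall w, Q i w}) -> {ae P, forall w, forall i, Q i w}.
Proof.
move=> H.
have E (n : nat) : {ae P, forall w, forall i : 'I_d, val i = n -> Q i w}.
  have [nd|dn] := ltnP n d.
    have := H (Ordinal nd); apply: filterS => w Hw i ni.
    by have -> : i = Ordinal nd by exact: val_inj.
  by apply: aeW => w i ni; have := ltn_ord i; rewrite ni ltnNge dn.
have := ae_foralln E; apply: filterS => w Hw i; exact: (Hw i).
Qed.

Lemma cvg_bounded_by {R : realType} (u : nat -> R) (l : R) : u n @[n --> \oo] --> l ->
  exists2 W : R, 0 < W & forall n, `|u n| <= W.
Proof.
move=> /cvgP/cvg_seq_bounded [M [_ /(_ (`|M| + 1))]] H.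
exists (`|M| + 1) => [|n]; first by rewrite ltr_wpDl.
by apply: H => //; apply: (le_lt_trans (ler_norm M)); rewrite ltrDl.
Qed.

Lemma cvg_ge0 {R : realType} (u : nat -> R) (l : R) : (forall n, 0 <= u n) ->
  u n @[n --> \oo] --> l -> 0 <= l.
Proof.
move=> u0 ul; rewrite -(cvg_lim _ ul)//; apply: limr_ge; first exact: cvgP ul.
by near=> n.
Unshelve. all: by end_near. Qed.

Lemma empty_interior_avoid {R : realType} (D : set R) (a b : R) : D^° = set0 -> a < b ->
  exists2 c, a < c < b & ~ D c.
Proof.
move=> D0 ab; apply: contrapT => H.
have sub : `]a, b[ `<=` D.
  move=> c; rewrite /= in_itv/= => acb; apply: contrapT => nD.
  by apply: H; exists c.
move: sub; rewrite open_subsetE; last exact: interval_open.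
rewrite D0 => /(_ ((a + b) / 2)); apply; rewrite /= in_itv/=.
by apply/andP; split; lra.
Qed.

Section CoordinatePowers.
Context {R : realType} {d : nat}.

Lemma sqvE (u : 'rV[R]_d) i : sqv u 0 i = u 0 i ^+ 2.
Proof. by rewrite mxE. Qed.

Lemma powR_coord_le (u : 'rV[R]_d) i (a : R) : 2 <= a ->
  `|u 0 i| `^ a <= 1 + enorm u `^ (2 * a).
Proof.
move=> a2; have a0 : 0 <= a by lra.
apply: (@le_trans _ _ (enorm u `^ a)).
  by apply: ge0_ler_powR; rewrite ?nnegrE ?enorm_ge0 ?enorm_coord.
have [u1|/ltW u1] := leP (enorm u) 1.
  rewrite -[leLHS]addr0 lerD ?powR_ge0//.
  have := @ge0_ler_powR _ a a0 (enorm u) 1; rewrite powR1 !nnegrE; apply => //.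
  exact: enorm_ge0.
apply: (@le_trans _ _ (enorm u `^ (2 * a))); last by rewrite lerDr.
by apply: ler_powR => //; lra.
Qed.

Lemma powR_sqv_le (u : 'rV[R]_d) i (a : R) : 2 <= a ->
  `|sqv u 0 i| `^ a <= 1 + enorm u `^ (2 * a).
Proof.
move=> a2; have a0 : 0 <= a by lra.
rewrite powRrM powR_mulrn ?enorm_ge0// sqvE normrX -[leLHS]add0r lerD//.
apply: ge0_ler_powR; rewrite ?nnegrE ?exprn_ge0 ?enorm_ge0//.
by rewrite lerXn2r ?nnegrE ?enorm_ge0 ?enorm_coord.
Qed.

End CoordinatePowers.

Theorem theorem3p1 (R : realType) (d : nat) (d_gt0 : (0 < d)%N)
  (dX : measure_display) (Xi : measurableType dX) (mu : probability Xi R)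
  (dO : measure_display) (Om : measurableType dO) (P : probability Om R)
  (* the function f *)
  (f : 'rV[R]_d -> Xi -> R)
  (f_meas : measurable_fun setT (fun y : borel_rV R d * Xi => f y.1 y.2))
  (f_int : forall x, mu.-integrable setT (EFin \o f x))
  (f_diff : forall s x, differentiable (f^~ s) x)
  (gradf2_int : forall x (i : 'I_d),
    mu.-integrable setT (fun s => (sqv (gradf f x s) 0 i)%:E))
  (f_lip : exists kappa : 'rV[R]_d -> Xi -> R,
    [/\ measurable_fun setT (fun y : borel_rV R d * Xi => kappa y.1 y.2),
        forall x s, 0 <= kappa x s &
        forall x, mu.-integrable setT (EFin \o kappa x) /\
          exists2 e : R, 0 < e & forall s u v, eball x e u -> eball x e v ->
            Num.max (enorm (gradf f u s - gradf f v s))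
                    (enorm (sqv (gradf f u s) - sqv (gradf f v s)))
            <= kappa x s * enorm (u - v)])
  (* the algorithm *)
  (gamma : nat -> R) (gamma_gt0 : forall n, (1 <= n)%N -> 0 < gamma n)
  (xi : nat -> {RV P >-> Xi})
  (xi_iid : iid_with_law mu [set n | (1 <= n)%N] xi)
  (h r p q : R -> R) (h0 r0 p0 q0 : R)
  (h0_gt0 : 0 < h0) (r0_gt0 : 0 < r0) (p0_gt0 : 0 < p0) (q0_gt0 : 0 < q0)
  (gamma_q : forall n, 0 <= 1 - gamma n.+1 * coef gamma q0 q n)
  (eps : R) (eps_gt0 : 0 < eps)
  (z0 : state R d) (z0_ge0 : state_nonneg z0)
  (z : nat -> Om -> state R d)
  (z_alg : forall n w,
    z n w = alg (gradf f) eps gamma (coef gamma h0 h) (coef gamma r0 r)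
              (coef gamma p0 p) (coef gamma q0 q) z0 (fun k => xi k w) n)
  (* (1) *)
  (F_coercive : forall A : R, exists B : R, forall x : 'rV[R]_d,
    B <= enorm x -> A <= objF mu f x)
  (* (2) *)
  (h_cont : {within `]0, +oo[, continuous h})
  (r_cont : {within `]0, +oo[, continuous r})
  (p_cont : {within `]0, +oo[, continuous p})
  (q_cont : {within `]0, +oo[, continuous q})
  (h_ge0 : forall t : R, 0 < t -> 0 <= h t) (r_ge0 : forall t : R, 0 < t -> 0 <= r t)
  (p_ge0 : forall t : R, 0 < t -> 0 <= p t) (q_ge0 : forall t : R, 0 < t -> 0 <= q t)
  (h_derivable : forall t : R, 0 < t -> derivable h t 1)
  (h_C1 : {within `]0, +oo[, continuous (derive1 h)})
  (h_decr : forall t : R, 0 < t -> derive1 h t <= 0)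
  (r_noninc : {in `]0, +oo[ &, nonincreasing_fun r})
  (q_noninc : {in `]0, +oo[ &, nonincreasing_fun q})
  (h_oo r_oo p_oo q_oo : R)
  (h_lim : h t @[t --> +oo] --> h_oo) (h_oo_gt0 : 0 < h_oo)
  (r_lim : r t @[t --> +oo] --> r_oo) (r_oo_gt0 : 0 < r_oo)
  (q_lim : q t @[t --> +oo] --> q_oo) (q_oo_gt0 : 0 < q_oo)
  (p_lim : p t @[t --> +oo] --> p_oo)
  (r_ge_q4 : forall t : R, 0 < t -> q t / 4 <= r t)
  (r_oo_gt : q_oo / 4 < r_oo)
  (* (3) *)
  (gamma_ratio : gamma n.+1 / gamma n @[n --> \oo] --> (1 : R))
  (gamma_sum : (\sum_(1 <= n <oo) (gamma n)%:E = +oo)%E)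
  (* (4) *)
  (moment_or_subgaussian :
    (exists a : R,
      [/\ 2 <= a,
          forall K : set 'rV[R]_d, compact K ->
            (ereal_sup [set 'E_mu[(fun s => enorm (gradf f x s) `^ (2 * a))%R]
                       | x in K] < +oo)%E &
          (\sum_(1 <= n <oo) (gamma n `^ (1 + a / 2))%R%:E < +oo)%E])
    \/
    ((forall K : set 'rV[R]_d, compact K ->
        exists2 sigma : R, sigma != 0 & forall x u : 'rV[R]_d,
          ('E_mu[(fun s => expR (dotv u (gradf f x s - grad (objF mu f) x)))%R]
             * (\1_K x)%:E
           <= (expR (sigma ^+ 2 * enorm u ^+ 2 / 2))%R%:E)%E /\
          ('E_mu[(fun s => expR (dotv u (sqv (gradf f x s) - objS mu f x)))%R]
             * (\1_K x)%:E
           <= (expR (sigma ^+ 2 * enorm u ^+ 2 / 2))%R%:E)%E) /\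
     (forall alpha : R, 0 < alpha ->
        (\sum_(1 <= n <oo) (expR (- (alpha / gamma n)))%R%:E < +oo)%E)))
  (* (5) *)
  (sard : (objF mu f @` crit mu f)^° = set0)
  (z_bounded : {ae P, forall w, exists C : R, forall n, snorm (z n w) <= C}) :
  {ae P, forall w,
    sdist (z n w) (limit_set mu f p_oo q_oo) @[n --> \oo] --> 0%E} /\
  (countable (crit mu f) ->
    {ae P, forall w, exists2 zs : state R d,
      limit_set mu f p_oo q_oo zs & z n w @[n --> \oo] --> zs}).
Proof.
have loc := local_regularity f_meas f_int f_diff gradf2_int f_lip.
(* Critical points thereby become zeros of the mean gradient, the form used by the pathwise
   results. *)
have gradE : grad (objF mu f) = mean_grad mu f.
  by apply/funext => y; exact: (grad_of_taylor loc).
have mgrad i := gradf_measurable f_meas f_diff i.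
have mgrad_s y (i : 'I_d) : measurable_fun setT (fun s => gradf f y s 0 i).
  by apply/measurable_EFinP; exact: (measurable_int mu (gradf_integrable f_meas f_diff gradf2_int y i)).
have cG (i : 'I_d) : continuous (fun y => mean_grad mu f y 0 i).
  by move=> y; have [_ + _] := taylor_continuous loc y; apply.
have cS (i : 'I_d) : continuous (fun y => objS mu f y 0 i).
  by move=> y; have [_ _] := taylor_continuous loc y; apply.
have tm_step : tau gamma n.+1 - tau gamma n @[n --> \oo] --> (0 : R).
  under eq_cvg do rewrite tauS.
  exact: gamma_cvg0 gamma_gt0 moment_or_subgaussian.
have h_cvg := coef_cvg gamma_gt0 gamma_sum h0 h_lim.
have r_cvg := coef_cvg gamma_gt0 gamma_sum r0 r_lim.
have p_cvg := coef_cvg gamma_gt0 gamma_sum p0 p_lim.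
have q_cvg := coef_cvg gamma_gt0 gamma_sum q0 q_lim.
have p_pos := coef_ge0 gamma_gt0 p0_gt0 p_ge0.
have p_oo_ge0 : 0 <= p_oo := cvg_ge0 p_pos p_cvg.
have S_ge0 y (i : 'I_d) : 0 <= objS mu f y 0 i.
  rewrite /objS [X in _ <= X]mxE; apply: fine_ge0; apply: expectation_ge0 => s.
  by rewrite sqvE sqr_ge0.
have sep (a b : R) : a < b ->
    exists2 c, a < c < b & forall y, mean_grad mu f y = 0 -> objF mu f y != c.
  move=> ab; have [c acb Hc] := empty_interior_avoid sard ab.
  exists c => // y Gy; apply/eqP => Fc; apply: Hc; exists y => //.
  by rewrite /crit /= gradE.
(* All box sizes [N] are quantified inside the event, so that [N] may later depend on [w]. *)
pose noise_small (phi : 'rV[R]_d -> Xi -> 'rV[R]_d) (mphi : 'rV[R]_d -> 'rV[R]_d)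
  (wt : nat -> R) w := forall (N : nat) (i : 'I_d) (e : R), 0 < e ->
  \forall n \near \oo, forall k, (n <= k)%N -> tau gamma k - tau gamma n <= 1 ->
    `|\sum_(n <= l < k) (tau gamma l.+1 - tau gamma l) * (wt l *
       (\1_(box N%:R) (z l w).2 *
        (phi (z l w).2 (xi l.+1 w) 0 i - mphi (z l w).2 0 i)))| <= e.
have noise_ae (phi : 'rV[R]_d -> Xi -> 'rV[R]_d) (mphi : 'rV[R]_d -> 'rV[R]_d)
    (wt : nat -> R) (l : R) : wt n @[n --> \oo] --> l ->
    (forall i, measurable_fun setT (fun y : borel_rV R d * Xi => phi y.1 y.2 0 i)) ->
    (forall y i, mu.-integrable setT (EFin \o (fun s => phi y s 0 i))) ->
    (forall y i, \int[mu]_s phi y s 0 i = mphi y 0 i) ->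
    (forall i, continuous (fun y => mphi y 0 i)) ->
    (forall i a y s, 2 <= a -> `|phi y s 0 i| `^ a <= 1 + enorm (gradf f y s) `^ (2 * a)) ->
    (phi = gradf f /\ mphi = grad (objF mu f)) \/
    (phi = (fun y s => sqv (gradf f y s)) /\ mphi = objS mu f) ->
    {ae P, forall w, noise_small phi mphi wt w}.
  move=> wtl mphi_meas phi_int phi_mean cm phi_le phiE.
  have [W W0 HW] := cvg_bounded_by wtl.
  apply: ae_foralln => N; apply: ae_forall_ord => i.
  apply: (@iterate_noise_ae _ _ _ _ _ _ P mu xi (tau gamma) xi_iid (tau0 gamma)
    (tau_unbounded gamma_gt0 gamma_sum) (tau_lt gamma_gt0) tm_step (fun n w => (z n w).2)
    _ (fun y s => phi y s 0 i) (fun y => mphi y 0 i) (mphi_meas i) (fun y => phi_int y i)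
    (fun y => phi_mean y i) (cm i) _ wt W (@box_closed _ _ N%:R) W0 HW).
    move=> n; under eq_fun do rewrite z_alg.
    exact: (alg_x_adapted _ _ _ _ _ _ _ mgrad).
  have mphi_s y : measurable_fun setT (fun s => phi y s 0 i).
    by apply/measurable_EFinP; exact: (measurable_int mu (phi_int y i)).
  exact: (tail_bound_coord mgrad_s moment_or_subgaussian (@box_compact _ _ N%:R) mphi_s
    (cm i) (phi_le i) phiE).
have noise_m : {ae P, forall w, noise_small (gradf f) (mean_grad mu f) (coef gamma h0 h) w}.
  apply: (noise_ae _ _ _ _ h_cvg) => //.
  - by move=> y i; exact: gradf_integrable.
  - by move=> y i; rewrite /mean_grad [RHS]mxE.
  - by move=> i a y s; exact: powR_coord_le.
  - by left.
have noise_v : {ae P, forall w, noise_small (fun y s => sqv (gradf f y s)) (objS mu f)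
    (coef gamma p0 p) w}.
  apply: (noise_ae _ _ _ _ p_cvg) => //.
  - move=> i; under eq_fun do rewrite sqvE.
    exact: measurable_funX.
  - by move=> y i; rewrite /objS [RHS]mxE unlock.
  - by move=> i a y s; exact: powR_sqv_le.
  - by right.
have main : {ae P, forall w, (forall e : R, 0 < e -> \forall n \near \oo,
      exists2 y, mean_grad mu f y = 0 &
        snorm (z n w - ((p_oo / q_oo) *: objS mu f y, 0 : 'rV[R]_d, y)) <= e) /\
    (countable [set y | mean_grad mu f y = 0] -> exists2 y, mean_grad mu f y = 0 &
      z n w @[n --> \oo] --> (((p_oo / q_oo) *: objS mu f y, 0 : 'rV[R]_d, y) : state R d))}.
  apply: filterS3 noise_m noise_v z_bounded => w Hm Hv [C HC].
  (* The random bound selects the box; along this trajectory every indicator then equals 1. *)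
  pose N := Num.bound `|C|.
  have CN : `|C| <= N%:R by exact: ltW (archi_boundP (normr_ge0 C)).
  have zN n i : [/\ `|(z n w).1.1 0 i| <= N%:R, `|(z n w).1.2 0 i| <= N%:R &
      `|(z n w).2 0 i| <= N%:R].
    have Cn : snorm (z n w) <= N%:R by apply: (le_trans (HC n)); exact: le_trans (ler_norm C) CN.
    by have [H1 H2 H3] := snorm_coord (z n w) i; split; exact: le_trans Cn.
  have zbox n : box N%:R (z n w).2.
    by move=> i /=; rewrite in_itv/= -ler_norml; have [] := zN n i.
  have ind n : \1_(box N%:R) (z n w).2 = 1 :> R by rewrite indicE mem_set.
  (* Replacing the sampled gradient and its square by their means puts the recursions in the
     averaged form; the differences are the noise. *)
  pose nv i l := (tau gamma l.+1 - tau gamma l) * (coef gamma p0 p l *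
    (sqv (gradf f (z l w).2 (xi l.+1 w)) 0 i - objS mu f (z l w).2 0 i)).
  pose nm i l := (tau gamma l.+1 - tau gamma l) * (coef gamma h0 h l *
    (gradf f (z l w).2 (xi l.+1 w) 0 i - mean_grad mu f (z l w).2 0 i)).
  (* By [gamma_q], each update of [v] is a combination with nonnegative coefficients. *)
  have v_ge0 n i : 0 <= (z n w).1.1 0 i.
    elim: n => [|n IH]; first by rewrite z_alg; exact: z0_ge0.
    rewrite z_alg alg_v -z_alg addr_ge0//; first exact: mulr_ge0.
    by rewrite mulr_ge0 ?sqr_ge0// mulr_ge0// ltW ?gamma_gt0.
  have v_rec i n : (z n.+1 w).1.1 0 i - (z n w).1.1 0 i = (tau gamma n.+1 - tau gamma n) *
      (coef gamma p0 p n * objS mu f (z n w).2 0 i - coef gamma q0 q n * (z n w).1.1 0 i) +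
      nv i n.
    by rewrite /nv tauS (z_alg n.+1) alg_v -z_alg sqvE; ring.
  have m_rec i n : (z n.+1 w).1.2 0 i - (z n w).1.2 0 i = (tau gamma n.+1 - tau gamma n) *
      (coef gamma h0 h n * mean_grad mu f (z n w).2 0 i - coef gamma r0 r n * (z n w).1.2 0 i) +
      nm i n.
    by rewrite /nm tauS (z_alg n.+1) alg_m -z_alg; ring.
  have x_rec i n : (z n.+1 w).2 0 i - (z n w).2 0 i = - ((tau gamma n.+1 - tau gamma n) *
      ((z n.+1 w).1.2 0 i / Num.sqrt ((z n.+1 w).1.1 0 i + eps))).
    by rewrite tauS (z_alg n.+1) alg_x -z_alg; ring.
  have nv_small i (e : R) : 0 < e -> \forall n \near \oo, forall k,
      (n <= k)%N -> tau gamma k - tau gamma n <= 1 -> `|\sum_(n <= l < k) nv i l| <= e.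
    move=> /(Hv N i); apply: filterS => n Hn k nk tk.
    by have := Hn k nk tk; under eq_bigr do rewrite ind mul1r.
  have nm_small i (e : R) : 0 < e -> \forall n \near \oo, forall k,
      (n <= k)%N -> tau gamma k - tau gamma n <= 1 -> `|\sum_(n <= l < k) nm i l| <= e.
    move=> /(Hm N i); apply: filterS => n Hn k nk tk.
    by have := Hn k nk tk; under eq_bigr do rewrite ind mul1r.
  split.
    exact: (pathwise_set loc S_ge0 sep (tau_homo gamma_gt0)
      (tau_unbounded gamma_gt0 gamma_sum) tm_step h_cvg r_cvg p_cvg q_cvg h_oo_gt0 p_oo_ge0
      q_oo_gt0 r_oo_gt eps_gt0 zN v_ge0 v_rec m_rec x_rec nv_small nm_small).
  exact: (pathwise_point loc S_ge0 sep (tau_homo gamma_gt0)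
      (tau_unbounded gamma_gt0 gamma_sum) tm_step h_cvg r_cvg p_cvg q_cvg h_oo_gt0 p_oo_ge0
      q_oo_gt0 r_oo_gt eps_gt0 zN v_ge0 v_rec m_rec x_rec nv_small nm_small).
split; [|move=> cc]; apply: filterS main => w [Hset Hpoint].
  apply: sdist_cvg0 => e /Hset; apply: filterS => n [y Gy Hy].
  exists ((p_oo / q_oo) *: objS mu f y, 0 : 'rV[R]_d, y) => //.
  by exists y => //; rewrite /crit /= gradE.
have [|y Gy Hy] := Hpoint; first by move: cc; rewrite /crit gradE.
exists ((p_oo / q_oo) *: objS mu f y, 0 : 'rV[R]_d, y) => //.
by exists y => //; rewrite /crit /= gradE.
Qed.
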